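(* There exists an absolute constant $C>0$ such that the following holds. Fix $\epsilon>0$, integers $n\ge k\ge1$, $s\ge 2$ and $T\ge1$. Let $\bm A$ be the adjacency matrix of a graph drawn from a stochastic block model $\mathcal M(\bm{\mathcal A})$ on $n$ nodes with $k$ groups, where $\bm{\mathcal A}=\bm G\bm\Omega\bm G^\top$ has rank $k$ and $\mathcal M(\bm{\mathcal A})\in\mathcal M_n(\epsilon)$, i.e. $\delta_{\min}>27\ln(4n/\epsilon)$. Let $\bm L=\bm D^{-1/2}\bm A\bm D^{-1/2}$ with $\bm D=\operatorname{diag}(\bm A\bm 1)$. Let $\bm x_0^{(1)},\ldots,\bm x_0^{(s)}\in\mathbb R^n$ be i.i.d. zero-mean sub-Gaussian random vectors, independent of $\bm A$, with covariance matrix $\bm I$, satisfying the bounded moments assumption, and let $\bm x_T^{(i)}=\bm L^T\bm x_0^{(i)}$ (i.e. $\bm x_{t+1}^{(i)}=\bm L\bm x_t^{(i)}$). Let $$\widehat{\bm\Sigma}(T)=\frac1s\sum_{i=1}^s[\bm x_T^{(i)}-\bar{\bm x}_T][\bm x_T^{(i)}-\bar{\bm x}_T]^\top,\qquad \bar{\bm x}_T=\frac1s\sum_{i=1}^s\bm x_T^{(i)},$$ and $\bm S(T)=\bm{\mathcal L}^{2T}$. Then with probability at least $1-5s^{-1}-2\epsilon$, $$\|\widehat{\bm\Sigma}(T)-\bm S(T)\|\le 2TM+B(T),$$ where $$M=3\sqrt{\frac{3\ln(4n/\epsilon)}{\delta_{\min}}},\qquad B(T)=C\Big(1+\sum_{i=2}^k\min\{1,|\mu_i|+M\}^{2T}+(n-k)M^{2T}\Big)\sqrt{\frac{\ln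 s}{s}},$$ and $\mu_1,\ldots,\mu_n$ are the eigenvalues of $\bm{\mathcal L}$ ordered so that $|\mu_1|\ge|\mu_2|\ge\cdots\ge|\mu_n|$.
   Context: Stochastic block model (SBM): there are $k$ nonempty groups, node $i$ has group label $g_i\in\{1,\dots,k\}$, $\bm G\in\{0,1\}^{n\times k}$ has $G_{ij}=1$ iff $g_i=j$, $\bm\Omega\in[0,1]^{k\times k}$ is symmetric, and the entries $A_{ij}=A_{ji}$ ($i\le j$, self-loops allowed) are independent Bernoulli$(\Omega_{g_ig_j})$ random variables. $\bm{\mathcal A}=\mathbb E[\bm A]=\bm G\bm\Omega\bm G^\top$; $\delta_i=(\bm{\mathcal A}\bm1)_i$ is the expected degree of node $i$ and $\delta_{\min}=\min_i\delta_i$; $\bm{\mathcal L}=\operatorname{diag}(\bm{\mathcal A}\bm1)^{-1/2}\bm{\mathcal A}\operatorname{diag}(\bm{\mathcal A}\bm1)^{-1/2}$. The class $\mathcal M_n(\epsilon)$ consists of SBMs on $n$ nodes with $\delta_{\min}>27\ln(4n/\epsilon)$. A zero-mean random vector $\bm x$ is sub-Gaussian if $\bm u^\top\bm x$ is sub-Gaussian for every fixed $\bm u$; the sub-Gaussian norm of a random variable is $\|x\|_{\Psi_2}=\sup_{p\ge1}p^{-1/2}(\mathbb E|x|^p)^{1/p}$. Bounded moments assumption: there is an absolute constant $c_0>0$ with $\mathbb E[(\bm u^\top\bm x_0^{(i)})^2]\ge c_0\|\bm u^\top\bm x_0^{(i)}\|_{\Psi_2}^2$ for all $\bm u\in\mathbb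 R^n$. $\|\cdot\|$ is the spectral norm. *)

(* Defs.v *)
From HB Require Import structures.
From mathcomp Require Import all_boot all_order all_algebra.
From mathcomp Require Import all_classical all_reals all_analysis.
Set Implicit Arguments. Unset Strict Implicit. Unset Printing Implicit Defensive.
Import Order.TTheory GRing.Theory Num.Theory.
Local Open Scope classical_set_scope.
Local Open Scope ring_scope.

Section Defs.
Context {R : realType}.

Section Prob.
Context {d : measure_display} {Omega : measurableType d} (P : probability Omega R).

(* sigma-algebra on Omega generated by a random element X : Omega -> (I -> R),
   I finite, i.e. the smallest sigma-algebra making every coordinate measurable
   (generated by preimages of measurable rectangles) *)
Definition sigmaRV (I : finType) (X : Omega -> I -> R) : set (set Omega) :=
  <<s [set X @^-1` [set v | forall i, B i (v i)] |
        B in [set B : I -> set R | forall i, measurable (B i)]] >>.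

Definition mutual_indep (I : finType) (D : {pred I}) (F : I -> set (set Omega)) :=
  forall (J : {set I}) (E : I -> set Omega),
    J \subset D -> (forall i, i \in J -> F i (E i)) ->
    P (\big[setI/setT]_(i in J) E i) = (\prod_(i in J) P (E i))%E.

Definition indep2 (F1 F2 : set (set Omega)) :=
  forall E1 E2, F1 E1 -> F2 E2 -> P (E1 `&` E2) = (P E1 * P E2)%E.

Definition ident_distr (I : finType) (X Y : Omega -> I -> R) :=
  forall S : set (I -> R),
    <<s [set [set v | forall i, B i (v i)] |
          B in [set B : I -> set R | forall i, measurable (B i)]] >> S ->
    P (X @^-1` S) = P (Y @^-1` S).

Definition psi2norm (y : Omega -> R) : \bar R :=
  ereal_sup [set ((p `^ (- 2^-1))%:E * poweR (\int[P]_w (`|y w| `^ p)%:E) p^-1)%E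
            | p in [set p : R | 1 <= p]].

Definition subgaussian (y : Omega -> R) := (psi2norm y < +oo)%E.

End Prob.

Definition norm2 (n : nat) (x : 'cV[R]_n) : R := Num.sqrt (\sum_i x i 0 ^+ 2).

Definition specnorm (n : nat) (M : 'M[R]_n) : R :=
  sup [set norm2 (M *m x) | x in [set x : 'cV[R]_n | norm2 x <= 1]].

Definition memb_mx (n k : nat) (g : 'I_n -> 'I_k) : 'M[R]_(n, k) :=
  \matrix_(i, j) (g i == j)%:R.

Definition exp_adj (n k : nat) (g : 'I_n -> 'I_k) (Om : 'M[R]_k) : 'M[R]_n :=
  memb_mx g *m Om *m (memb_mx g)^T.

Definition degs (n : nat) (A : 'M[R]_n) (i : 'I_n) : R := \sum_j A i j.

Definition deg_min (n : nat) (A : 'M[R]_n) : R := inf (range (degs A)).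

Definition norm_lap (n : nat) (A : 'M[R]_n) : 'M[R]_n :=
  let Dm := diag_mx (\row_i (Num.sqrt (degs A i))^-1) in Dm *m A *m Dm.

Definition sample_cov (n s : nat) (x : 'I_s -> 'cV[R]_n) : 'M[R]_n :=
  let xbar := s%:R^-1 *: \sum_i x i in
  s%:R^-1 *: \sum_i ((x i - xbar) *m (x i - xbar)^T).

End Defs.

(* Main.v *)
(* With high probability ||L - calL|| <= M, and for a fixed graph the error splits as
     Sigma(T) - calL^(2T) = (L^(2T) - calL^(2T)) + (Sigma(T) - L^(2T)).
   The first term is at most 2TM because ||L|| and ||calL|| are at most 1.  The
   second is at most tr(L^(2T)) times sqrt(ln s / s), and Weyl's inequality for
   absolute values of eigenvalues bounds that trace.

   Graph: degrees concentrate by the scalar Chernoff bound; the adjacency matrix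
   normalized by the expected degrees is a sum of independent multiples
   (a_e - q_e) w_e N_e of symmetric matrices with N_e^3 = N_e.  The variance proxy
   is the diagonal matrix sum_e q_e w_e^2 N_e^2, and the trace of the exponential
   is propagated edge by edge with the Golden-Thompson inequality, in the finite
   form tr((PQ)^(2^k)) <= tr(P^(2^k) Q^(2^k)).  The matrix exponential is replaced
   by (1 + A/2^k)^(2^k) throughout.

   Signals: the entries y_j of L^T x are sub-Gaussian with psi_2 norm at most
   sqrt(S_jj / c0), where S = L^(2T).  After division by sqrt(S_jj S_ll) the
   entries of the empirical covariance are averages of centered subexponential
   variables.  Their squares, weighted by S_jj S_ll, are controlled at once by
   Jensen's inequality for the convex function t -> exp(sqrt(4 + t)), so that the
   Frobenius error is at most tr S times sqrt(ln s / s) with no union bound over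
   the n^2 entries. *)

Require Import Defs.
From HB Require Import structures.
From mathcomp Require Import all_boot all_order all_algebra.
From mathcomp Require Import all_classical all_reals all_analysis.
From mathcomp Require Import measurable_realfun complex ring lra.
Import Order.TTheory GRing.Theory Num.Theory.
Local Open Scope classical_set_scope.
Local Open Scope ring_scope.

Set Implicit Arguments.
Unset Strict Implicit.
Unset Printing Implicit Defensive.

(** * Frobenius inner product and operator bounds *)

Section Frobenius.
Context {R : realType}.

(** The graph is treated on the finite cube of edge configurations with product weights; only the
    end of the proof returns to the probability space. There the event is the disjoint union, over
    good configurations [a], of the event [A w = cfg_adj a] intersected with a signal event built
    for that fixed graph. The signal events lie in the sigma-algebra of the signals, so independence
    multiplies probabilities graph by graph and no conditioning on [A] occurs.

    The finite exponentials satisfy the Golden-Thompson inequality only up to an error [eta], which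
    disappears as k grows. As k is chosen after the finite set of edges and the threshold, the whole
    loss is a factor 2 in the matrix tail.

    The constants fit closely. With L = ln(4n/eps) and u = 2 sqrt(L/delta) each tail is a multiple
    of exp(-L), in total 6 n exp(-L) = (3/2) eps. The condition 27 L < delta gives u <= 2/5, and
    then ||L - calL|| is at most (5/2) u = 5 sqrt(L/delta), just below M = 3 sqrt 3
    sqrt(L/delta). *)

Definition frob (m n : nat) (A B : 'M[R]_(m, n)) : R := \tr (A^T *m B).

Definition sqn (m n : nat) (A : 'M[R]_(m, n)) : R := frob A A.

Lemma frobE m n (A B : 'M[R]_(m, n)) : frob A B = \sum_i \sum_j A i j * B i j.
Proof.
rewrite /frob /mxtrace exchange_big /=; apply: eq_bigr => j _.
by rewrite mxE; apply: eq_bigr => i _; rewrite mxE.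
Qed.

Lemma frobC m n (A B : 'M[R]_(m, n)) : frob A B = frob B A.
Proof. by rewrite !frobE; do 2![apply: eq_bigr => ? _]; rewrite mulrC. Qed.

Lemma frobDl m n (A A' B : 'M[R]_(m, n)) : frob (A + A') B = frob A B + frob A' B.
Proof. by rewrite /frob linearD mulmxDl linearD. Qed.

Lemma frobDr m n (A B B' : 'M[R]_(m, n)) : frob A (B + B') = frob A B + frob A B'.
Proof. by rewrite /frob mulmxDr linearD. Qed.

Lemma frobZl m n a (A B : 'M[R]_(m, n)) : frob (a *: A) B = a * frob A B.
Proof. by rewrite /frob linearZ -scalemxAl linearZ. Qed.

Lemma frobZr m n a (A B : 'M[R]_(m, n)) : frob A (a *: B) = a * frob A B.
Proof. by rewrite /frob -scalemxAr linearZ. Qed.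

Lemma frobNl m n (A B : 'M[R]_(m, n)) : frob (- A) B = - frob A B.
Proof. by rewrite -scaleN1r frobZl mulN1r. Qed.

Lemma frobNr m n (A B : 'M[R]_(m, n)) : frob A (- B) = - frob A B.
Proof. by rewrite -scaleN1r frobZr mulN1r. Qed.

Lemma frob_mull m n p (A : 'M[R]_(p, m)) (B : 'M[R]_(m, n)) C :
  frob (A *m B) C = frob B (A^T *m C).
Proof. by rewrite /frob trmx_mul mulmxA. Qed.

Lemma sqnE m n (A : 'M[R]_(m, n)) : sqn A = \sum_i \sum_j A i j ^+ 2.
Proof. by rewrite /sqn frobE; do 2![apply: eq_bigr => ? _]; rewrite expr2. Qed.

Lemma sqn_ge0 m n (A : 'M[R]_(m, n)) : 0 <= sqn A.
Proof. by rewrite sqnE; do 2![apply: sumr_ge0 => ? _]; exact: sqr_ge0. Qed.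

Lemma sqn_eq0 m n (A : 'M[R]_(m, n)) : (sqn A == 0) = (A == 0).
Proof.
apply/idP/eqP => [|->]; last by rewrite /sqn /frob mulmx0 linear0.
rewrite sqnE psumr_eq0 => [/allP A0|? _]; last by apply: sumr_ge0 => ? _; exact: sqr_ge0.
apply/matrixP => i j; have := A0 i (mem_index_enum i) => /=.
rewrite psumr_eq0 => [/allP /(_ j (mem_index_enum j))|? _]; last exact: sqr_ge0.
by rewrite /= sqrf_eq0 mxE => /eqP.
Qed.

Lemma sqnD m n (A B : 'M[R]_(m, n)) : sqn (A + B) = sqn A + frob A B *+ 2 + sqn B.
Proof. by rewrite /sqn frobDl !frobDr (frobC B A) mulr2n !addrA. Qed.

Lemma sqnZ m n a (A : 'M[R]_(m, n)) : sqn (a *: A) = a ^+ 2 * sqn A.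
Proof. by rewrite /sqn frobZl frobZr mulrA expr2. Qed.

Lemma sqnN m n (A : 'M[R]_(m, n)) : sqn (- A) = sqn A.
Proof. by rewrite /sqn frobNl frobNr opprK. Qed.

Lemma sqn_trmx m n (A : 'M[R]_(m, n)) : sqn A^T = sqn A.
Proof.
by rewrite !sqnE exchange_big; do 2![apply: eq_bigr => ? _]; rewrite mxE.
Qed.

Lemma frob_CS m n (A B : 'M[R]_(m, n)) : frob A B ^+ 2 <= sqn A * sqn B.
Proof.
have [B0|B0] := eqVneq B 0.
  by rewrite B0 /sqn /frob !mulmx0 !linear0 expr0n mulr0.
have cp : 0 < sqn B by rewrite lt_neqAle sqn_ge0 eq_sym sqn_eq0 B0.
have := sqn_ge0 (sqn B *: A - frob A B *: B).
rewrite sqnD sqnN !sqnZ frobNr frobZl frobZr.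
set a := sqn A; set c := sqn B; set b := frob A B => h.
have : 0 <= c * (a * c - b ^+ 2).
  by apply: le_trans h _; rewrite le_eqVlt; apply/orP; left; apply/eqP; ring.
by rewrite pmulr_rge0 // subr_ge0.
Qed.

Lemma frob_le m n (A B : 'M[R]_(m, n)) a b : 0 <= a -> 0 <= b ->
  sqn A <= a ^+ 2 -> sqn B <= b ^+ 2 -> `|frob A B| <= a * b.
Proof.
move=> a0 b0 ha hb; rewrite -(@ler_pXn2r _ 2) // ?nnegrE ?mulr_ge0 //.
rewrite -normrX ger0_norm ?sqr_ge0 // exprMn.
by apply: le_trans (frob_CS _ _) _; apply: ler_pM => //; exact: sqn_ge0.
Qed.

Lemma norm2E n (x : 'cV[R]_n) : norm2 x = Num.sqrt (sqn x).
Proof.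
by rewrite /norm2 sqnE; congr Num.sqrt; apply: eq_bigr => i _; rewrite big_ord1.
Qed.

End Frobenius.

Section OpBound.
Context {R : realType} {n : nat}.
Implicit Types (A B P Q : 'M[R]_n) (x : 'cV[R]_n).

(** The bound ||A|| <= K without a supremum and in squared form; K >= 0 is included so that squares
    can be compared. *)
Definition opb A (K : R) := 0 <= K /\ forall x, sqn (A *m x) <= K ^+ 2 * sqn x.

Lemma opb_ge0 A K : opb A K -> 0 <= K. Proof. by case. Qed.

Lemma opbW A K K' : K <= K' -> opb A K -> opb A K'.
Proof.
move=> KK' [K0 h]; split=> [|x]; first exact: le_trans KK'.
apply: le_trans (h x) _; rewrite ler_wpM2r ?sqn_ge0 //.
by rewrite ler_pXn2r // nnegrE // (le_trans K0).
Qed.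

Lemma opb1 : opb 1 1.
Proof. by split=> // x; rewrite mul1mx expr1n mul1r. Qed.

Lemma opbD A B K K' : opb A K -> opb B K' -> opb (A + B) (K + K').
Proof.
move=> [K0 hA] [K'0 hB]; split=> [|x]; first exact: addr_ge0.
have s0 := Num.Theory.sqrtr_ge0 (sqn x).
have sx : sqn x = Num.sqrt (sqn x) ^+ 2 by rewrite sqr_sqrtr ?sqn_ge0.
have {}hA : sqn (A *m x) <= (K * Num.sqrt (sqn x)) ^+ 2.
  by rewrite exprMn -sx; exact: hA.
have {}hB : sqn (B *m x) <= (K' * Num.sqrt (sqn x)) ^+ 2.
  by rewrite exprMn -sx; exact: hB.
have := @frob_le _ _ _ (A *m x) (B *m x) _ _ (mulr_ge0 K0 s0) (mulr_ge0 K'0 s0) hA hB.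
rewrite ler_norml => /andP[_ hAB].
rewrite mulmxDl sqnD sx; move: hA hB hAB; set s := Num.sqrt _ => hA hB hAB.
rewrite mulr2n; apply: le_trans (_ : (K * s) ^+ 2 + 2 * (K * s * (K' * s)) + (K' * s) ^+ 2 <= _).
  by apply: lerD => //; apply: lerD => //; lra.
by rewrite le_eqVlt; apply/orP; left; apply/eqP; ring.
Qed.

Lemma opbZ a A K : opb A K -> opb (a *: A) (`|a| * K).
Proof.
move=> [K0 hA]; split=> [|x]; first by rewrite mulr_ge0.
rewrite -scalemxAl sqnZ exprMn real_normK ?num_real // -(mulrA (a ^+ 2)).
by rewrite ler_wpM2l ?sqr_ge0.
Qed.

Lemma opbN A K : opb A K -> opb (- A) K.
Proof. by move=> /(opbZ (-1)); rewrite scaleN1r normrN1 mul1r. Qed.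

Lemma opbM A B K K' : opb A K -> opb B K' -> opb (A *m B) (K * K').
Proof.
move=> [K0 hA] [K'0 hB]; split=> [|x]; first exact: mulr_ge0.
rewrite -mulmxA exprMn; apply: le_trans (hA _) _; rewrite -(mulrA (K ^+ 2)).
by rewrite ler_wpM2l ?sqr_ge0.
Qed.

Lemma opbX A K m : opb A K -> opb (A ^+ m) (K ^+ m).
Proof.
move=> hA; elim: m => [|m IH]; first by rewrite !expr0; exact: opb1.
by rewrite !exprS; exact: opbM.
Qed.

(** The difference telescopes into m+1 products, each with one factor P - Q and m factors of norm at
    most r. It serves both the Golden-Thompson error and the term 2TM. *)
Lemma opb_expB P Q r d m : opb P r -> opb Q r -> opb (P - Q) d ->
  opb (P ^+ m.+1 - Q ^+ m.+1) (m.+1%:R * d * r ^+ m).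
Proof.
move=> hP hQ hd; elim: m => [|m IH]; first by rewrite !expr1 expr0 mulr1 mul1r.
have -> : P ^+ m.+2 - Q ^+ m.+2 = P *m (P ^+ m.+1 - Q ^+ m.+1) + (P - Q) *m Q ^+ m.+1.
  rewrite mulmxBr mulmxBl -![_ *m _]/(_ * _) -!exprS.
  by rewrite addrA subrK.
have -> : m.+2%:R * d * r ^+ m.+1 = r * (m.+1%:R * d * r ^+ m) + d * r ^+ m.+1.
  by rewrite -natr1 exprS; ring.
by apply: opbD; apply: opbM => //; exact: opbX.
Qed.

Lemma opb_sqn A : opb A (Num.sqrt (sqn A)).
Proof.
split=> [|x]; first exact: sqrtr_ge0.
rewrite sqr_sqrtr ?sqn_ge0 // (sqnE A) mulr_suml sqnE; apply: ler_sum => i _.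
rewrite big_ord1 mxE.
have -> : \sum_j A i j * x j 0 = frob (row i A)^T x.
  by rewrite frobE; apply: eq_bigr => j _; rewrite big_ord1 !mxE.
apply: le_trans (frob_CS _ _) _; rewrite sqn_trmx sqnE big_ord1.
by rewrite le_eqVlt; apply/orP; left; apply/eqP; congr (_ * _); apply: eq_bigr => j _; rewrite mxE.
Qed.

Lemma opb_trace A K : opb A K -> `|\tr A| <= n%:R * K.
Proof.
move=> [K0 hA]; apply: le_trans (ler_norm_sum _ _ _) _.
have -> : n%:R * K = \sum_(i < n) K by rewrite sumr_const card_ord mulr_natl.
apply: ler_sum => i _; rewrite -(@ler_pXn2r _ 2) // ?nnegrE //.
have := hA (delta_mx i 0); rewrite -colE.
have -> : sqn (delta_mx i 0 : 'cV[R]_n) = 1.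
  rewrite sqnE (bigD1 i) //= big_ord1 mxE !eqxx expr1n big1 ?addr0 // => j /negPf ji.
  by rewrite big_ord1 mxE ji expr0n.
rewrite mulr1; apply: le_trans.
rewrite sqnE (bigD1 i) //= big_ord1 mxE -normrX ger0_norm ?sqr_ge0 // lerDl.
by apply: sumr_ge0 => j _; rewrite big_ord1; exact: sqr_ge0.
Qed.

(** Polarization replaces the spectral theorem: with y = A x, the forms at x + t y and x - t y
    differ by 4 t |y|^2, and t = 1/K is the right choice. For K = 0, t = 1 already forces y = 0. *)
Lemma opb_sym A K : 0 <= K -> A^T = A ->
  (forall x, `|frob x (A *m x)| <= K * sqn x) -> opb A K.
Proof.
move=> K0 sA h; split=> // x.
set y := A *m x.
have polar t : 4 * (t * sqn y) <= 2 * K * (sqn x + t ^+ 2 * sqn y).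
  have e : 4 * (t * sqn y) = frob (x + t *: y) (A *m (x + t *: y)) -
                             frob (x - t *: y) (A *m (x - t *: y)).
    rewrite !mulmxDr !mulmxN -!scalemxAr -/y !(frobDl, frobDr, frobNl, frobNr, frobZl, frobZr).
    have -> : frob x (A *m y) = frob y y by rewrite -{1}sA -frob_mull.
    by rewrite /sqn; ring.
  have hp := h (x + t *: y); have hm := h (x - t *: y).
  have /andP[_ {}hp] : - (K * sqn (x + t *: y)) <= frob (x + t *: y) (A *m (x + t *: y)) <= K * sqn (x + t *: y).
    by rewrite -ler_norml.
  have /andP[{}hm _] : - (K * sqn (x - t *: y)) <= frob (x - t *: y) (A *m (x - t *: y)) <= K * sqn (x - t *: y).
    by rewrite -ler_norml.
  rewrite e; apply: le_trans (lerB hp hm) _.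
  rewrite !sqnD sqnN frobNr !sqnZ le_eqVlt; apply/orP; left; apply/eqP; ring.
have [K00|K0'] := eqVneq K 0.
  have := polar 1; rewrite K00 mulr0 mul0r expr0n mul0r mul1r.
  by rewrite pmulr_rle0.
have Kp : 0 < K by rewrite lt_neqAle eq_sym K0'.
have := polar K^-1.
have : 0 < K^-1 by rewrite invr_gt0.
move=> Ki /(ler_wpM2l (ltW Kp)).
have -> : K * (4 * (K^-1 * sqn y)) = 4 * sqn y by field; rewrite gt_eqF.
have -> : K * (2 * K * (sqn x + K^-1 ^+ 2 * sqn y)) = 2 * (K ^+ 2 * sqn x) + 2 * sqn y.
  by field; rewrite gt_eqF.
lra.
Qed.

Lemma specnorm_le A K : opb A K -> specnorm A <= K.
Proof.
move=> [K0 hA]; apply: sup_le_ub.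
  exists (norm2 (A *m 0)); exists 0 => //=.
  by rewrite norm2E (_ : sqn 0 = 0) ?sqrtr0 //; apply/eqP; rewrite sqn_eq0.
move=> _ [x /= x1 <-]; rewrite norm2E -(ger0_norm K0) -sqrtr_sqr ler_wsqrtr //.
apply: le_trans (hA x) _; rewrite ler_piMr ?sqr_ge0 //.
move: x1; rewrite norm2E -{2}(sqr_sqrtr (sqn_ge0 x)) => x1.
by rewrite exprn_ile1 // sqrtr_ge0.
Qed.

End OpBound.

(** * Trace inequalities *)

Lemma tr_mulX_C (K : comNzRingType) (n : nat) (A B : 'M[K]_n) m : \tr ((A *m B) ^+ m) = \tr ((B *m A) ^+ m).
Proof.
case: m => [|m]; first by rewrite !expr0.
suff -> : (A *m B) ^+ m.+1 = A *m ((B *m A) ^+ m *m B).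
  by rewrite mxtrace_mulC -mulmxA exprSr.
elim: m => [|m IH]; first by rewrite expr1 expr0 mul1mx.
by rewrite exprS IH exprS -[_ * _]/(_ *m _) -[_ * _ ^+ _]/(_ *m _) !mulmxA.
Qed.

Section TracePowers.
Context {R : realType} {n : nat}.
Implicit Types (A B P Q X : 'M[R]_n).

Lemma trmx_exp A m : (A ^+ m)^T = A^T ^+ m.
Proof.
elim: m => [|m IH]; first by rewrite !expr0 trmx1.
by rewrite exprS exprSr -[_ * _]/(_ *m _) trmx_mul IH.
Qed.

Lemma tr_mul_CS A B : \tr (A *m B) ^+ 2 <= \tr (A *m A^T) * \tr (B *m B^T).
Proof.
have := frob_CS A^T B; rewrite /frob trmxK /sqn /frob trmxK.
by rewrite (mxtrace_mulC B^T).
Qed.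

Lemma tr_sqr_ge0 A : 0 <= \tr (A *m A^T).
Proof. by rewrite mxtrace_mulC; exact: (sqn_ge0 A). Qed.

(** Neither half can be proved alone. The first at j+1 is its instance j at X^2, where cyclicity
    produces tr((P Q)^(2^j)) with P = X X^T and Q = X^T X; the second half and Cauchy-Schwarz
    finish, since P and Q have the same traces of powers. The second at j+1 is the first half at X =
    P Q followed by the second half at Q^2 and P^2. *)
Lemma tr_pow2_le j :
  (forall X, `|\tr (X ^+ (2 ^ j.+1))| <= \tr ((X *m X^T) ^+ (2 ^ j))) /\
  (forall P Q, P^T = P -> Q^T = Q ->
    \tr ((P *m Q) ^+ (2 ^ j)) <= \tr (P ^+ (2 ^ j) *m Q ^+ (2 ^ j))).
Proof.
elim: j => [|j [S T]]; split.
- move=> X; rewrite expn0 expr1 expn1 expr2 -[_ * _]/(_ *m _).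
  rewrite -(@ler_pXn2r _ 2) ?nnegrE ?tr_sqr_ge0 // real_normK ?num_real //.
  by apply: le_trans (tr_mul_CS _ _) _; rewrite expr2.
- by move=> P Q _ _; rewrite expn0 !expr1.
- move=> X; rewrite (expnS 2 j.+1) exprM.
  apply: le_trans (S _) _.
  have -> : X ^+ 2 *m (X ^+ 2)^T = X *m (X *m X^T *m X^T).
    by rewrite trmx_exp !expr2 -![_ * _]/(_ *m _) !mulmxA.
  pose P := X *m X^T; pose Q := X^T *m X.
  rewrite tr_mulX_C (_ : _ *m X = P *m Q); last by rewrite /P /Q !mulmxA.
  have sP : P^T = P by rewrite trmx_mul trmxK.
  have sQ : Q^T = Q by rewrite trmx_mul trmxK.
  apply: le_trans (T _ _ sP sQ) _.
  have PX0 : 0 <= \tr (P ^+ (2 ^ j.+1)).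
    by rewrite expnS mulnC exprM expr2 -{2}sP -trmx_exp tr_sqr_ge0.
  rewrite -/P; apply: le_trans (ler_norm _) _.
  rewrite -(@ler_pXn2r _ 2) ?nnegrE // real_normK ?num_real //.
  apply: le_trans (tr_mul_CS _ _) _.
  rewrite !trmx_exp sP sQ -![_ *m _]/(_ * _) -!expr2 -!exprM -![(2 ^ j * 2)%N]mulnC -expnS.
  by rewrite (_ : \tr (Q ^+ _) = \tr (P ^+ (2 ^ j.+1))) ?expr2 // /P tr_mulX_C.
move=> P Q sP sQ; apply: le_trans (ler_norm _) _; apply: le_trans (S _) _.
have -> : P *m Q *m (P *m Q)^T = P *m (Q ^+ 2 *m P).
  by rewrite trmx_mul sP sQ expr2 -[_ * _]/(_ *m _) !mulmxA.
rewrite tr_mulX_C -mulmxA -[P *m P]/(P * P) -expr2; apply: le_trans (T _ _ _ _) _; rewrite ?trmx_exp ?sP ?sQ //.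
by rewrite -!exprM -!expnS mxtrace_mulC.
Qed.

Lemma tr_mul_pow2 k P Q : P^T = P -> Q^T = Q ->
  \tr ((P *m Q) ^+ (2 ^ k)) <= \tr (P ^+ (2 ^ k) *m Q ^+ (2 ^ k)).
Proof. by case: (tr_pow2_le k) => _; apply. Qed.

(** The exponent is a power of two because [tr_mul_pow2] is an inequality for such powers. For k > 0
    and symmetric [A] it also makes [expm k A] the square of a symmetric matrix. *)
Definition expm k A : 'M[R]_n := (1%:M + (2 ^ k)%:R^-1 *: A) ^+ (2 ^ k).

Lemma expm_sqr k A : expm k.+1 A =
  (1%:M + (2 ^ k.+1)%:R^-1 *: A) ^+ (2 ^ k) *m (1%:M + (2 ^ k.+1)%:R^-1 *: A) ^+ (2 ^ k).
Proof. by rewrite /expm -[RHS]/(_ * _) -expr2 -exprM -expnSr. Qed.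

Lemma ler_expR_pow (z : R) m : (0 < m)%N -> -m%:R <= z ->
  (1 + z / m%:R) ^+ m <= expR z.
Proof.
move=> m0 zm; have mp : 0 < (m%:R : R) by rewrite ltr0n.
have -> : expR z = expR (z / m%:R) ^+ m.
  by rewrite -expRM_natl mulrC divfK // gt_eqF.
apply: lerXn2r; rewrite ?nnegrE ?expR_ge0 ?expR_ge1Dx //.
by rewrite -lerBlDl sub0r ler_pdivlMr // mulN1r.
Qed.

(* The trace of (P Q)^m with P = 1 + A/m and Q = 1 + B/m is controlled by
   tr_mul_pow2, and P Q = 1 + (A + B)/m + O(1/m^2). *)
Lemma golden_thompson A B : A^T = A -> B^T = B -> forall eta : R, 0 < eta ->
  exists k0, forall k, (k0 <= k)%N ->
    \tr (expm k (A + B)) <= \tr (expm k A *m expm k B) + eta.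
Proof.
move=> sA sB eta eta0.
have [oA oB] := (opb_sqn A, opb_sqn B).
set a := Num.sqrt (sqn A) in oA; set b := Num.sqrt (sqn B) in oB.
have [a0 b0] := (opb_ge0 oA, opb_ge0 oB).
(* The error will be n * m * (a b / m^2) * exp((a + b)/m)^(m - 1) <= c / m, so m = 2^k >= k >= c /
   eta suffices. *)
pose c := n%:R * (a * b * expR (a + b)).
have [k0 hk0] : exists k0 : nat, c / eta <= k0%:R.
  exists (Num.truncn (c / eta)).+1; apply: ltW.
  by apply: Num.Theory.truncnS_gt.
exists k0 => k k0k.
have m0 : (0 < 2 ^ k)%N by rewrite expn_gt0.
have km : (k <= 2 ^ k)%N by rewrite ltnW // ltn_expl.
rewrite /expm; set m := (2 ^ k)%N in m0 km *.
have mp : 0 < (m%:R : R) by rewrite ltr0n.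
set P := 1%:M + m%:R^-1 *: A; set Q := 1%:M + m%:R^-1 *: B.
set S := 1%:M + m%:R^-1 *: (A + B).
have sP : P^T = P by rewrite linearD linearZ /= trmx1 sA.
have sQ : Q^T = Q by rewrite linearD linearZ /= trmx1 sB.
have mi : `|m%:R^-1 : R| = m%:R^-1 by rewrite ger0_norm // invr_ge0 ltW.
have oZ (X : 'M[R]_n) K : opb X K -> opb (m%:R^-1 *: X) (m%:R^-1 * K).
  by rewrite -{2}mi; exact: opbZ.
have oP : opb P (expR (a / m%:R)).
  apply: opbW (expR_ge1Dx _) _; apply: opbD; first exact: opb1.
  by rewrite mulrC; exact: oZ.
have oQ : opb Q (expR (b / m%:R)).
  apply: opbW (expR_ge1Dx _) _; apply: opbD; first exact: opb1.
  by rewrite mulrC; exact: oZ.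
have oPQ : opb (P *m Q) (expR ((a + b) / m%:R)).
  by rewrite mulrDl expRD; exact: opbM.
have oS : opb S (expR ((a + b) / m%:R)).
  apply: opbW (expR_ge1Dx _) _; apply: opbD; first exact: opb1.
  by rewrite mulrC; apply: oZ; exact: opbD.
have oD : opb (S - P *m Q) (m%:R^-1 * (m%:R^-1 * (a * b))).
  have -> : S - P *m Q = - (m%:R^-1 *: (m%:R^-1 *: (A *m B))).
    rewrite /S /P /Q mulmxDl !mulmxDr mul1mx mulmx1 mul1mx -scalemxAr -!scalemxAl scalerDr.
    by set W := A *m B; apply/matrixP => i j; rewrite !mxE; ring.
  by apply: opbN; exact: oZ (oZ _ _ (opbM oA oB)).
have [m' em] : exists m', m = m'.+1 by exists m.-1; rewrite prednK.
have oE := opb_expB m' oS oPQ oD; rewrite -em in oE.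
have := opb_trace oE; rewrite linearB /= ler_norml => /andP[_].
rewrite lerBlDr => h.
apply: le_trans h _; rewrite addrC; apply: lerD.
  by have := tr_mul_pow2 k sP sQ.
have -> : n%:R * (m%:R * (m%:R^-1 * (m%:R^-1 * (a * b))) * expR ((a + b) / m%:R) ^+ m') =
  m%:R^-1 * (n%:R * (a * b * expR ((a + b) / m%:R) ^+ m')).
  by field; rewrite gt_eqF.
rewrite mulrC ler_pdivrMr //; apply: le_trans (_ : c <= _).
  rewrite /c ler_wpM2l ?ler0n // ler_wpM2l ?mulr_ge0 //.
  rewrite -expRM_natl ler_expR mulrCA ler_piMr ?addr_ge0 //.
  by rewrite ler_pdivrMr // mul1r em ler_nat.
rewrite -ler_pdivrMl // mulrC; apply: le_trans hk0 _.
by rewrite ler_nat (leq_trans k0k).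
Qed.

Definition psd A := forall x : 'cV[R]_n, 0 <= frob x (A *m x).

(** By cyclicity the trace is the sum of the quadratic forms of [A] at the columns of [S]. *)
Lemma trace_mul_psd (S : 'M[R]_n) A : psd A -> 0 <= \tr (S *m S^T *m A).
Proof.
move=> pA; rewrite -mulmxA mxtrace_mulC /mxtrace; apply: sumr_ge0 => i _.
have := pA (col i S); rewrite /frob /mxtrace big_ord1.
by rewrite colE trmx_mul !mulmxA -colE mxE trmx_delta -!mulmxA -rowE mxE !mulmxA.
Qed.

End TracePowers.

(** * Scalar exponential bounds and the replacement of one random edge *)

Section ExpBounds.
Context {R : realType}.

(** From 1 - y/2 <= exp(-y/2) one gets exp y <= (1 - y/2)^(-2). The threshold 1/3 keeps 1 - 3y
    nonnegative in the comparison of polynomials that remains. *)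
Lemma expR_leD_sqr (y : R) : `|y| <= 3^-1 -> expR y <= 1 + y + y ^+ 2.
Proof.
rewrite ler_norml => /andP[y1 y2].
have h : expR y * (1 - y / 2) ^+ 2 <= 1.
  have -> : expR y = expR (y / 2) ^+ 2.
    by rewrite -expRM_natl mulrC divfK // pnatr_eq0.
  rewrite -exprMn exprn_ile1 ?mulr_ge0 ?expR_ge0 //; first lra.
  apply: le_trans (_ : expR (y / 2) * expR (- (y / 2)) <= _).
    by rewrite ler_wpM2l ?expR_ge0 // expR_ge1Dx.
  by rewrite expRxMexpNx_1.
have p : 0 < (1 - y / 2) ^+ 2 by rewrite exprn_gt0 //; lra.
rewrite -(ler_pM2r p); apply: le_trans h _.
have -> : (1 + y + y ^+ 2) * (1 - y / 2) ^+ 2 = 1 + y ^+ 2 * ((1 - 3 * y) + y ^+ 2) / 4.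
  by field.
rewrite lerDl divr_ge0 // mulr_ge0 ?sqr_ge0 // addr_ge0 ?sqr_ge0 //; lra.
Qed.

Lemma bernoulli_mgf (q y : R) : 0 <= q <= 1 -> `|y| <= 3^-1 ->
  q * expR ((1 - q) * y) + (1 - q) * expR (- q * y) <= expR (q * y ^+ 2).
Proof.
move=> /andP[q0 q1] hy.
have -> : (1 - q) * y = y + (- q * y) by ring.
rewrite expRD.
have -> : q * (expR y * expR (- q * y)) + (1 - q) * expR (- q * y) =
  expR (- q * y) * (1 + q * (expR y - 1)) by ring.
apply: le_trans (_ : expR (- q * y) * expR (q * (expR y - 1)) <= _).
  by rewrite ler_wpM2l ?expR_ge0 // expR_ge1Dx.
rewrite -expRD ler_expR.
have -> : - q * y + q * (expR y - 1) = q * (expR y - 1 - y) by ring.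
by rewrite ler_wpM2l //; have := expR_leD_sqr hy; lra.
Qed.

End ExpBounds.

Section OneStep.
Context {R : realType} {n : nat} (N : 'M[R]_n).
Hypotheses (symN : N^T = N) (N3 : N *m N *m N = N).

(** As N^3 = N, the eigenvalues of [N] are among 1, -1 and 0; [f a b] is the function of [N] taking
    the values a, b and 1 there. This is why products and powers act on a and b separately. *)
Let f (a b : R) : 'M[R]_n :=
  1%:M + (((a + b) / 2 - 1) *: (N *m N) + ((a - b) / 2) *: N).

Let fM a b a' b' : f a b *m f a' b' = f (a * a') (b * b').
Proof.
rewrite /f !(mulmxDl, mulmxDr) !(mul1mx, mulmx1) -!scalemxAr -!scalemxAl.
rewrite !mulmxA !N3; move: (N *m N) => N2.
by apply/matrixP => i j; rewrite !mxE; field.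
Qed.

Let fX a b m : f a b ^+ m = f (a ^+ m) (b ^+ m).
Proof.
elim: m => [|m IH]; last by rewrite !exprS IH -fM.
by rewrite !expr0 /f (_ : (1 + 1) / 2 - 1 = 0 :> R) ?subrr ?mul0r ?scale0r ?addr0 //; field.
Qed.

Let expmf k (z c : R) : expm k (z *: N - c *: (N *m N)) =
  f ((1 + (z - c) / (2 ^ k)%:R) ^+ (2 ^ k)) ((1 + (- z - c) / (2 ^ k)%:R) ^+ (2 ^ k)).
Proof.
rewrite -fX /expm /f; congr (_ ^+ _); move: (N *m N) => N2.
by apply/matrixP => i j; rewrite !mxE; field; rewrite pnatr_eq0 expn_eq0.
Qed.

(** (N^2 + N)/2 and (N^2 - N)/2 are the spectral projections of [N] for 1 and -1, and 1 - f a b is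
    their combination with weights 1 - a and 1 - b. *)
Let psd_1f a b : a <= 1 -> b <= 1 -> psd (1%:M - f a b).
Proof.
move=> a1 b1 x; rewrite /f.
have -> : 1%:M - (1%:M + (((a + b) / 2 - 1) *: (N *m N) + ((a - b) / 2) *: N)) =
   (1 - a) *: (2^-1 *: (N *m N + N)) + (1 - b) *: (2^-1 *: (N *m N - N)).
  by move: (N *m N) => N2; apply/matrixP => i j; rewrite !mxE; field.
set y := N *m x.
have sN (u v : 'cV[R]_n) : frob (N *m u) v = frob u (N *m v) by rewrite frob_mull symN.
have N3x : N *m (N *m (N *m x)) = N *m x by rewrite !mulmxA N3.
have e1 : frob x (N *m y) = sqn y by rewrite /sqn /y sN.
have e2 : sqn (N *m y) = sqn y by rewrite /sqn sN /y N3x -sN.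
have e3 : frob y (N *m y) = frob x y by rewrite /y sN N3x.
have hp := sqn_ge0 (N *m y + y); have hm := sqn_ge0 (N *m y - y).
move: hp hm; rewrite !sqnD sqnN frobNr e2 (frobC _ y) e3 => hp hm.
rewrite mulmxDl -!scalemxAl !mulmxDl mulNmx -!mulmxA -/y.
rewrite !(frobDr, frobZr, frobNr) e1.
apply: addr_ge0; apply: mulr_ge0; rewrite ?subr_ge0 //; lra.
Qed.

(** The proxy c N^2, with c = q y^2, is moved into the deterministic part, which leaves the two
    increments z N - c N^2. Golden-Thompson splits them off, and the average of their exponentials
    is [f] at two numbers that [bernoulli_mgf] bounds by 1, hence below the identity in the psd
    order. *)
Lemma one_step (H : 'M[R]_n) (q y : R) : H^T = H -> 0 <= q <= 1 -> `|y| <= 3^-1 ->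
  forall eta : R, 0 < eta -> exists k0, forall k, (k0 <= k)%N ->
    q * \tr (expm k (H + ((1 - q) * y) *: N)) + (1 - q) * \tr (expm k (H + (- q * y) *: N))
    <= \tr (expm k (H + (q * y ^+ 2) *: (N *m N))) + eta.
Proof.
move=> sH q01 hy eta eta0; have /andP[q0 q1] := q01.
set c := q * y ^+ 2; set A := H + c *: (N *m N).
have sN2 : (N *m N)^T = N *m N by rewrite trmx_mul symN.
have sA : A^T = A by rewrite linearD linearZ /= sN2 sH.
have sB z : (z *: N - c *: (N *m N))^T = z *: N - c *: (N *m N).
  by rewrite linearB !linearZ /= sN2 symN.
have eB z : H + z *: N = A + (z *: N - c *: (N *m N)).
  by rewrite /A; move: (N *m N) => N2; apply/matrixP => i j; rewrite !mxE; ring.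
have [k1 h1] := golden_thompson sA (sB ((1 - q) * y)) eta0.
have [k2 h2] := golden_thompson sA (sB (- q * y)) eta0.
exists (maxn (maxn k1 k2) 1) => k; rewrite !geq_max => /andP[/andP[kk1 kk2] k1'].
rewrite !eB.
pose B1 := ((1 - q) * y) *: N - c *: (N *m N).
pose B0 := (- q * y) *: N - c *: (N *m N).
rewrite -/B1 -/B0.
have {}h1 : \tr (expm k (A + B1)) <= \tr (expm k A *m expm k B1) + eta by exact: h1.
have {}h2 : \tr (expm k (A + B0)) <= \tr (expm k A *m expm k B0) + eta by exact: h2.
apply: le_trans (_ : q * (\tr (expm k A *m expm k B1) + eta) +
                     (1 - q) * (\tr (expm k A *m expm k B0) + eta) <= _).
  by apply: lerD; rewrite ler_wpM2l // subr_ge0.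
set t1 := \tr (_ *m expm k B1); set t0 := \tr (_ *m expm k B0).
have -> : q * (t1 + eta) + (1 - q) * (t0 + eta) = (q * t1 + (1 - q) * t0) + eta by ring.
rewrite lerD2r /t1 /t0.
(* [a 1] and [a (-1)] are the values of the averaged factor on the eigenspaces of [N] for 1 and
   -1. *)
set a := fun s : R => q * (1 + (s * ((1 - q) * y) - c) / (2 ^ k)%:R) ^+ (2 ^ k) +
              (1 - q) * (1 + (s * (- q * y) - c) / (2 ^ k)%:R) ^+ (2 ^ k).
have hQ : q *: expm k B1 + (1 - q) *: expm k B0 = f (a 1) (a (-1)).
  rewrite !expmf /a !mul1r !mulN1r /f; move: (N *m N) => N2.
  by apply/matrixP => i j; rewrite !mxE; field.
have ha s : s ^+ 2 = 1 -> a s <= 1.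
  move=> s2; have hs : `|s * y| <= 3^-1.
    by rewrite normrM (_ : `|s| = 1) ?mul1r //; apply/eqP; rewrite -sqr_norm_eq1 s2.
  have m1 : (1 : R) <= (2 ^ k)%:R by rewrite ler1n expn_gt0.
  have c0 : 0 <= c by rewrite mulr_ge0 ?sqr_ge0.
  (* With |z| <= 1/3 this gives z - c >= -1 >= -2^k, the range in which [ler_expR_pow] applies. *)
  have c1 : c <= 9^-1.
    rewrite /c -[9^-1]mul1r ler_pM ?sqr_ge0 //.
    rewrite -real_normK ?num_real // (_ : 9^-1 = 3^-1 ^+ 2); last by field.
    by rewrite lerXn2r ?nnegrE.
  have bd z : `|z| <= 3^-1 -> (1 + (z - c) / (2 ^ k)%:R) ^+ (2 ^ k) <= expR z * expR (- c).
    move=> hz; rewrite -expRD; apply: ler_expR_pow; first by rewrite expn_gt0.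
    by move: hz; rewrite ler_norml => /andP[? ?]; lra.
  have hb t : 0 <= t <= 1 -> `|t * (s * y)| <= 3^-1.
    move=> /andP[t0' t1']; rewrite normrM ger0_norm // -[3^-1]mul1r.
    by rewrite ler_pM.
  have b1 := bd (s * ((1 - q) * y)); have b0 := bd (s * (- q * y)).
  apply: le_trans (_ : (q * expR ((1 - q) * (s * y)) + (1 - q) * expR (- q * (s * y))) * expR (- c) <= _).
    rewrite mulrDl -!mulrA; apply: lerD; rewrite ler_wpM2l // ?subr_ge0 //.
      by rewrite mulrCA; apply: bd; apply: hb; rewrite subr_ge0 q1 gerBl.
    by rewrite mulrCA; apply: bd; rewrite mulNr normrN; exact: hb.
  apply: le_trans (_ : expR (q * (s * y) ^+ 2) * expR (- c) <= _).
    by rewrite ler_wpM2r ?expR_ge0 // bernoulli_mgf.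
  by rewrite -expRD exprMn s2 mul1r subrr expR0.
have e : q * \tr (expm k A *m expm k B1) + (1 - q) * \tr (expm k A *m expm k B0) =
   \tr (expm k A *m f (a 1) (a (-1))).
  by rewrite -hQ mulmxDr -!scalemxAr linearD !linearZ.
rewrite e -subr_ge0 -{1}(mulmx1 (expm k A)) -linearB -mulmxBr.
(* For k >= 1 [expm k A] is S S^T with S symmetric, the form that [trace_mul_psd] takes; this is why
   k was made positive. *)
case: k k1' @a hQ ha @t1 @t0 e kk1 kk2 {h1 h2} => // k _ a hQ ha _ _ _ _ _.
rewrite expm_sqr; set S := _ ^+ _.
have {2}-> : S = S^T by rewrite trmx_exp linearD linearZ /= trmx1 sA.
by apply: trace_mul_psd; apply: psd_1f; apply: ha; rewrite ?expr1n // sqrrN expr1n.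
Qed.

End OneStep.

(** * Chernoff bounds for independent edges *)

Section BernoulliProduct.
Context {R : realType} {I : finType} (q : I -> R).
Hypothesis q01 : forall e, 0 <= q e <= 1.
Implicit Types (a : {ffun I -> bool}) (e : I).

Definition bern_wt e (b : bool) : R := if b then q e else 1 - q e.

Definition cfg_wt a : R := \prod_e bern_wt e (a e).

Definition cfg_ex (F : {ffun I -> bool} -> R) : R := \sum_a cfg_wt a * F a.

Definition cfg_upd a e b : {ffun I -> bool} := [ffun i => if i == e then b else a i].

Lemma bern_wt_ge0 e b : 0 <= bern_wt e b.
Proof. by have /andP[q0 q1] := q01 e; rewrite /bern_wt; case: b; rewrite ?subr_ge0. Qed.

Lemma cfg_wt_ge0 a : 0 <= cfg_wt a.
Proof. by apply: prodr_ge0 => e _; exact: bern_wt_ge0. Qed.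

Lemma cfg_ex_prod (G : I -> bool -> R) :
  cfg_ex (fun a => \prod_e G e (a e)) = \prod_e (q e * G e true + (1 - q e) * G e false).
Proof.
rewrite /cfg_ex.
rewrite (eq_bigr (fun a : {ffun I -> bool} => \prod_e (bern_wt e (a e) * G e (a e)))); last first.
  by move=> a _; rewrite /cfg_wt big_split.
rewrite -(bigA_distr_bigA (fun e b => bern_wt e b * G e b)).
by apply: eq_bigr => e _; rewrite big_bool.
Qed.

Lemma sum_cfg_wt : \sum_a cfg_wt a = 1.
Proof.
apply: etrans (etrans (cfg_ex_prod (fun _ _ => 1)) _).
  by apply: eq_bigr => a _; rewrite big1 ?mulr1.
by rewrite big1 // => e _; rewrite !mulr1 addrC subrK.
Qed.

Lemma cfg_exD F G : cfg_ex (fun a => F a + G a) = cfg_ex F + cfg_ex G.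
Proof. by rewrite /cfg_ex -big_split; apply: eq_bigr => a _; rewrite mulrDr. Qed.

Lemma cfg_exZ c F : cfg_ex (fun a => c * F a) = c * cfg_ex F.
Proof. by rewrite /cfg_ex mulr_sumr; apply: eq_bigr => a _; rewrite mulrCA. Qed.

Lemma cfg_markov (B : {ffun I -> bool} -> bool) F t :
  (forall a, 0 <= F a) -> (forall a, B a -> t <= F a) ->
  (\sum_(a | B a) cfg_wt a) * t <= cfg_ex F.
Proof.
move=> F0 Ft; rewrite mulr_suml /cfg_ex [leRHS](bigID B) /= -[leLHS]addr0.
apply: lerD.
  by apply: ler_sum => a Ba; rewrite ler_wpM2l ?cfg_wt_ge0 ?Ft.
by apply: sumr_ge0 => a _; rewrite mulr_ge0 ?cfg_wt_ge0.
Qed.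

Lemma sum_cfg_split e (h : {ffun I -> bool} -> R) :
  \sum_a h a = \sum_(a : {ffun I -> bool} | a e) (h a + h (cfg_upd a e false)).
Proof.
rewrite (bigID (fun a : {ffun I -> bool} => a e)) big_split /=; congr (_ + _).
rewrite (reindex_onto (fun a => cfg_upd a e false) (fun a => cfg_upd a e true)) /=.
  apply: eq_bigl => a; rewrite ffunE eqxx /=.
  apply/eqP/idP => [<-|ae]; first by rewrite ffunE eqxx.
  by apply/ffunP => i; rewrite !ffunE; case: eqVneq => [->|//]; rewrite ae.
move=> a ae; apply/ffunP => i; rewrite !ffunE; case: eqVneq => [->|//].
by apply/esym/negbTE.
Qed.

(** Conditioning on the coordinate e, without leaving the full cube: once the value at e is
    overwritten, [F] no longer depends on [a e], so averaging over all configurations averages over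
    the other coordinates. *)
Lemma cfg_ex_resample e F :
  cfg_ex F = q e * cfg_ex (fun a => F (cfg_upd a e true)) +
             (1 - q e) * cfg_ex (fun a => F (cfg_upd a e false)).
Proof.
rewrite -!cfg_exZ -cfg_exD /cfg_ex !(sum_cfg_split e); apply: eq_bigr => a ae.
have u1 : cfg_upd a e true = a.
  by apply/ffunP => i; rewrite ffunE; case: eqVneq => // ->.
have u2 : cfg_upd (cfg_upd a e false) e true = a.
  by apply/ffunP => i; rewrite !ffunE; case: eqVneq => // ->.
have u3 : cfg_upd (cfg_upd a e false) e false = cfg_upd a e false.
  by apply/ffunP => i; rewrite !ffunE; case: eqVneq => // ->.
have wtE (a' : {ffun I -> bool}) :
    cfg_wt a' = bern_wt e (a' e) * \prod_(i | i != e) bern_wt i (a' i).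
  by rewrite /cfg_wt (bigD1 e).
have r : \prod_(i | i != e) bern_wt i (cfg_upd a e false i) =
    \prod_(i | i != e) bern_wt i (a i).
  by apply: eq_bigr => i /negPf ie; rewrite ffunE ie.
by rewrite u1 u2 u3 !wtE r ffunE eqxx ae /bern_wt; ring.
Qed.

Lemma scalar_chernoff (y : I -> R) : (forall e, `|y e| <= 3^-1) ->
  cfg_ex (fun a => expR (\sum_e ((a e)%:R - q e) * y e)) <= expR (\sum_e q e * y e ^+ 2).
Proof.
move=> hy.
have h := cfg_ex_prod (fun e (b : bool) => expR ((b%:R - q e) * y e)).
have ea (a : {ffun I -> bool}) : expR (\sum_e ((a e)%:R - q e) * y e) = \prod_e expR (((a e)%:R - q e) * y e) :> R.
  by rewrite expR_sum.
rewrite /cfg_ex; under eq_bigr do rewrite ea.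
move: h; rewrite /cfg_ex => ->.
rewrite expR_sum; apply: ler_prod => e _.
have /andP[q0 q1] := q01 e.
rewrite addr_ge0 ?mulr_ge0 ?expR_ge0 ?subr_ge0 //=.
by rewrite sub0r; exact: bernoulli_mgf.
Qed.

Section Matrix.
Context {n : nat} (N : I -> 'M[R]_n).
Hypotheses (symN : forall e, (N e)^T = N e) (N3 : forall e, N e *m N e *m N e = N e).

(** [H] is quantified inside because resampling the head edge shifts it by one of two multiples of
    [N e]. In both cases the induction hypothesis turns the tail into its proxy, then [one_step]
    treats the head; each spends eta / 2. Since [l] has no repetition, resampling the head leaves
    the tail alone. *)
Lemma tr_expm_sum (y : I -> R) (l : seq I) : (forall e, `|y e| <= 3^-1) -> uniq l ->
  forall H : 'M[R]_n, H^T = H -> forall eta, 0 < eta ->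
  exists k0, forall k, (k0 <= k)%N ->
    cfg_ex (fun a => \tr (expm k (H + \sum_(e <- l) (((a e)%:R - q e) * y e) *: N e)))
    <= \tr (expm k (H + \sum_(e <- l) (q e * y e ^+ 2) *: (N e *m N e))) + eta.
Proof.
move=> hy; elim: l => [|e l IH] /= ul H sH eta eta0.
  exists 0%N => k _; rewrite /cfg_ex !big_nil.
  under eq_bigr do rewrite big_nil.
  by rewrite -mulr_suml sum_cfg_wt mul1r lerDl ltW.
move: ul => /andP[el ul]; have /andP[q0 q1] := q01 e.
have sHN z : (H + z *: N e)^T = H + z *: N e by rewrite linearD linearZ /= symN sH.
have e20 : 0 < eta / 2 by rewrite divr_gt0.
have [k1 h1] := IH ul _ (sHN ((1 - q e) * y e)) _ e20.
have [k2 h2] := IH ul _ (sHN (- q e * y e)) _ e20.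
pose C := \sum_(e <- l) (q e * y e ^+ 2) *: (N e *m N e).
have sHC : (H + C)^T = H + C.
  rewrite linearD /= sH /C linear_sum /=; congr (_ + _); apply: eq_bigr => i _.
  by rewrite linearZ /= trmx_mul symN.
have [k3 h3] := one_step (symN e) (N3 e) sHC (q01 e) (hy e) e20.
exists (maxn k1 (maxn k2 k3)) => k; rewrite !geq_max => /and3P[kk1 kk2 kk3].
pose G b := fun a : {ffun I -> bool} => \tr (expm k ((H + ((b%:R - q e) * y e) *: N e) +
   \sum_(i <- l) (((a i)%:R - q i) * y i) *: N i)).
have red b (a : {ffun I -> bool}) : \tr (expm k (H + \sum_(i <- e :: l)
     (((cfg_upd a e b i)%:R - q i) * y i) *: N i)) = G b a.
  congr (\tr (expm _ _)); rewrite big_cons addrA ffunE eqxx; congr (_ + _).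
  apply: eq_big_seq => i il; rewrite ffunE; case: eqVneq => // ie.
  by rewrite -ie il in el.
rewrite [leLHS](_ : _ = q e * cfg_ex (G true) + (1 - q e) * cfg_ex (G false)); last first.
  rewrite [LHS](cfg_ex_resample e).
  by congr (_ * _ + _ * _); apply: eq_bigr => a _; rewrite red.
rewrite /G sub0r big_cons.
have {}h1 := h1 k kk1; have {}h2 := h2 k kk2; have {}h3 := h3 k kk3.
apply: le_trans (lerD (ler_wpM2l q0 h1) (ler_wpM2l _ h2)) _; first by rewrite subr_ge0.
have ec z : H + z *: N e + C = H + C + z *: N e by rewrite addrAC.
rewrite -/C in h1 h2 *; rewrite !ec.
set t1 := \tr _ in h3 *; set t0 := \tr (expm k (H + C + (- q e * y e) *: N e)) in h3 *.
have -> : H + ((q e * y e ^+ 2) *: (N e *m N e) + C) = H + C + (q e * y e ^+ 2) *: (N e *m N e).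
  by rewrite [_ *: _ + C]addrC addrA.
set t2 := \tr _ in h3 *.
have -> : q e * (t1 + eta / 2) + (1 - q e) * (t0 + eta / 2) =
  (q e * t1 + (1 - q e) * t0) + eta / 2 by ring.
by move: h3; lra.
Qed.

(** Induction by squaring: for a unit vector, x^T Z^2 x = |Z x|^2 >= (x^T Z x)^2 by
    Cauchy-Schwarz. *)
Lemma frob_pow2_ge k (S : 'M[R]_n) (x : 'cV[R]_n) (c : R) : S^T = S -> sqn x = 1 ->
  0 <= c -> c <= frob x (S *m x) -> c ^+ (2 ^ k) <= frob x ((S ^+ (2 ^ k)) *m x).
Proof.
move=> sS x1 c0 h; elim: k => [|k IH]; first by rewrite expn0 !expr1.
rewrite expnSr !exprM; set Z := S ^+ (2 ^ k).
have sZ : Z^T = Z by rewrite trmx_exp sS.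
have -> : frob x (Z ^+ 2 *m x) = sqn (Z *m x).
  by rewrite /sqn frob_mull sZ mulmxA.
apply: le_trans (_ : frob x (Z *m x) ^+ 2 <= _).
  by rewrite lerXn2r ?nnegrE ?exprn_ge0 // (le_trans _ IH) // exprn_ge0.
by have := frob_CS x (Z *m x); rewrite x1 mul1r.
Qed.

(** The finite counterpart of tr(exp X) >= exp(lambda_max), without eigenvalues: the trace is the
    squared Frobenius norm of a symmetric square root, which dominates the squared length of the
    image of x. *)
Lemma tr_expm_ge k (X : 'M[R]_n) (x : 'cV[R]_n) (u : R) : X^T = X -> sqn x = 1 ->
  (0 < k)%N -> 0 <= u -> u <= frob x (X *m x) ->
  (1 + u / (2 ^ k)%:R) ^+ (2 ^ k) <= \tr (expm k X).
Proof.
move=> sX x1 + u0 ux; case: k => // k _.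
rewrite expm_sqr; set S := 1%:M + _.
have sS : S^T = S by rewrite linearD linearZ /= trmx1 sX.
have sSk : (S ^+ (2 ^ k))^T = S ^+ (2 ^ k) by rewrite trmx_exp sS.
have -> : \tr (S ^+ (2 ^ k) *m S ^+ (2 ^ k)) = sqn (S ^+ (2 ^ k)).
  by rewrite /sqn /frob sSk.
have m0 : 0 < (2 ^ k.+1)%:R :> R by rewrite ltr0n expn_gt0.
apply: le_trans (_ : sqn (S ^+ (2 ^ k) *m x) <= _).
  rewrite /sqn frob_mull sSk mulmxA -[S ^+ (2 ^ k) *m S ^+ _]/(_ * _) -expr2 -exprM -expnSr.
  apply: frob_pow2_ge => //; first by rewrite addr_ge0 // divr_ge0 // ltW.
  rewrite /S mulmxDl mul1mx frobDr -/(sqn x) x1 -scalemxAl frobZr lerD2l mulrC.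
  by rewrite ler_wpM2l // invr_ge0 ltW.
have [s0 h] := opb_sqn (S ^+ (2 ^ k)).
by have := h x; rewrite x1 mulr1 sqr_sqrtr ?sqn_ge0.
Qed.

(** With t = z/m one has 1 + t >= exp(t/(1 + t)) >= exp(t - t^2), so the m-th power loses only
    exp(-z^2/m) >= 1 - 1/4. *)
Lemma expR_pow_ge (z : R) m : 0 <= z -> (0 < m)%N -> 4 * z ^+ 2 <= m%:R ->
  expR z * (3 / 4) <= (1 + z / m%:R) ^+ m.
Proof.
move=> z0 m0 hm; have mp : 0 < (m%:R : R) by rewrite ltr0n.
set t := z / m%:R; have t0 : 0 <= t by rewrite divr_ge0 // ltW.
have h : expR (t - t ^+ 2) <= 1 + t.
  apply: le_trans (_ : expR (t / (1 + t)) <= _).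
    rewrite ler_expR ler_pdivlMr; last by lra.
    have -> : (t - t ^+ 2) * (1 + t) = t - t ^+ 3 by ring.
    by rewrite lerBlDr lerDl exprn_ge0.
  have := expR_ge1Dx (- (t / (1 + t))); rewrite expRN.
  have -> : 1 + - (t / (1 + t)) = (1 + t)^-1 by field; lra.
  by rewrite lef_pV2 // posrE ?expR_gt0 //; lra.
apply: le_trans (_ : expR (t - t ^+ 2) ^+ m <= _); last first.
  by rewrite lerXn2r ?nnegrE ?expR_ge0 // (le_trans _ h) ?expR_ge0.
rewrite -expRM_natl; have -> : m%:R * (t - t ^+ 2) = z - z ^+ 2 / m%:R.
  by rewrite /t; field; rewrite gt_eqF.
rewrite expRD ler_wpM2l ?expR_ge0 //.
apply: le_trans (expR_ge1Dx _).
have : z ^+ 2 / m%:R <= 4^-1 by rewrite ler_pdivrMr //; lra.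
lra.
Qed.

(** Markov's inequality for the trace of [expm]. Taking eta = V/2 bounds its mean by (3/2) V, a bad
    configuration makes it at least (3/4) exp(theta u), and the ratio of the two constants is the
    final factor 2. *)
Lemma matrix_chernoff (w : I -> R) (dg : 'I_n -> R) (v u theta : R)
    (Bad : {ffun I -> bool} -> bool) : 0 <= u -> 0 <= theta ->
  \sum_e (q e * w e ^+ 2) *: (N e *m N e) = diag_mx (\row_i dg i) ->
  (forall i, 0 <= dg i <= v) ->
  (forall e, `|theta * w e| <= 3^-1) ->
  (forall a, Bad a -> exists2 x : 'cV[R]_n, sqn x = 1 &
     u <= frob x ((\sum_e (((a e)%:R - q e) * w e) *: N e) *m x)) ->
  \sum_(a | Bad a) cfg_wt a <= n%:R * expR (theta ^+ 2 * v - theta * u) * 2.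
Proof.
move=> u0 th0 hdg dgv hw bad.
have [n0|n0] := posnP n.
  rewrite big1 ?n0 ?mul0r // => a /bad [x]; rewrite /sqn frobE big1 => [/eqP|i _].
    by rewrite eq_sym oner_eq0.
  by exfalso; move: i; rewrite n0 => -[].
have np : 0 < (n%:R : R) by rewrite ltr0n.
set V := n%:R * expR (theta ^+ 2 * v).
have V0 : 0 < V by rewrite mulr_gt0 ?expR_gt0.
have s0 : (0 : 'M[R]_n)^T = 0 by rewrite linear0.
have V20 : 0 < V / 2 by rewrite divr_gt0.
have [k0 hk0] := tr_expm_sum hw (index_enum_uniq I) s0 V20.
set z := theta * u; have z0 : 0 <= z by exact: mulr_ge0.
have [k1 hk1] : exists k1 : nat, 4 * z ^+ 2 <= k1%:R.
  by exists (Num.truncn (4 * z ^+ 2)).+1; apply: ltW; exact: Num.Theory.truncnS_gt.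
pose k := maxn (maxn k0 k1) 1.
have kk0 : (k0 <= k)%N by rewrite /k !leq_max leqnn.
have kk1 : (k1 <= k)%N by rewrite /k !leq_max leqnn orbT.
have k'1 : (0 < k)%N by rewrite /k !leq_max orbT.
have {hk0} := hk0 k kk0; rewrite add0r.
have mp : 0 < (2 ^ k)%:R :> R by rewrite ltr0n expn_gt0.
have -> : \sum_e (q e * (theta * w e) ^+ 2) *: (N e *m N e) =
    diag_mx (\row_i (theta ^+ 2 * dg i)).
  have -> : \row_i (theta ^+ 2 * dg i) = theta ^+ 2 *: \row_i dg i.
    by apply/rowP => i; rewrite !mxE.
  rewrite linearZ /= -hdg scaler_sumr; apply: eq_bigr => e _; rewrite scalerA.
  by congr (_ *: _); ring.
have trC : \tr (expm k (diag_mx (\row_i (theta ^+ 2 * dg i)))) <= V.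
  have -> : expm k (diag_mx (\row_i (theta ^+ 2 * dg i))) =
     diag_mx (\row_i ((1 + theta ^+ 2 * dg i / (2 ^ k)%:R) ^+ (2 ^ k))).
    rewrite /expm; set r := \row_i (theta ^+ 2 * _).
    have -> : 1%:M + (2 ^ k)%:R^-1 *: diag_mx r =
        diag_mx (\row_i (1 + theta ^+ 2 * dg i / (2 ^ k)%:R)).
      apply/matrixP => i j; rewrite !mxE; case: eqVneq => _ //=.
        by rewrite mulr1n [_ * (_ * _)]mulrC.
      by rewrite !mulr0n mulr0 addr0.
    move: ((2 ^ k)%:R : R) => c; elim: (2 ^ k)%N => [|m IH].
      rewrite expr0; apply/matrixP => i j; rewrite !mxE expr0.
      by case: eqVneq.
    rewrite exprS IH -[_ * _]/(_ *m _) mulmx_diag; congr diag_mx; apply/rowP => i.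
    by rewrite !mxE -exprS.
  rewrite mxtrace_diag /V; have -> : n%:R * expR (theta ^+ 2 * v) =
     \sum_(i < n) expR (theta ^+ 2 * v) by rewrite sumr_const card_ord mulr_natl.
  apply: ler_sum => i _; rewrite mxE; have /andP[d0 dv] := dgv i.
  have t20 : 0 <= theta ^+ 2 * dg i by rewrite mulr_ge0 ?sqr_ge0.
  apply: le_trans (ler_expR_pow _ _) _; rewrite ?expn_gt0 //.
    by apply: le_trans t20; rewrite oppr_le0 ltW.
  by rewrite ler_expR ler_wpM2l ?sqr_ge0.
move=> hex.
have hE a : \sum_e (((a e)%:R - q e) * (theta * w e)) *: N e =
     theta *: \sum_e (((a e)%:R - q e) * w e) *: N e.
  by rewrite scaler_sumr; apply: eq_bigr => e _; rewrite scalerA mulrCA.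
have symX (a : {ffun I -> bool}) : (\sum_e (((a e)%:R - q e) * (theta * w e)) *: N e)^T =
     \sum_e (((a e)%:R - q e) * (theta * w e)) *: N e.
  by rewrite linear_sum; apply: eq_bigr => e _; rewrite linearZ /= symN.
have Fge0 (X : 'M[R]_n) : X^T = X -> 0 <= \tr (expm k X).
  move=> sX; move: k'1; case: k {kk0 kk1 mp trC hex} => // k' _.
  rewrite expm_sqr; set S := _ ^+ _.
  have {2}-> : S = S^T by rewrite trmx_exp linearD linearZ /= trmx1 sX.
  exact: tr_sqr_ge0.
have hB (a : {ffun I -> bool}) : Bad a -> expR z * (3 / 4) <=
    \tr (expm k (\sum_e (((a e)%:R - q e) * (theta * w e)) *: N e)).
  move=> /bad [x x1 hx].
  have mk0 : (0 < 2 ^ k)%N by rewrite expn_gt0.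
  apply: le_trans (expR_pow_ge z0 mk0 _) _.
    apply: le_trans hk1 _; rewrite ler_nat (leq_trans kk1) //.
    by rewrite ltnW // ltn_expl.
  apply: (tr_expm_ge _ x1) => //.
  by rewrite hE -scalemxAl frobZr ler_wpM2l.
have := cfg_markov (fun a => Fge0 _ (symX a)) hB.
have -> : cfg_ex (fun a => \tr (expm k (\sum_e (((a e)%:R - q e) * (theta * w e)) *: N e))) =
  cfg_ex (fun a => \tr (expm k (0 + \sum_e (((a e)%:R - q e) * (theta * w e)) *: N e))).
  by apply: eq_bigr => a _; rewrite add0r.
move=> /le_trans /(_ hex).
set W := \sum_(_ | _) _ => hW.
have {}hW : W * (expR z * (3 / 4)) <= V * (3 / 2) by move: hW trC; lra.
rewrite expRD expRN mulrA -/V -(ler_pM2r (_ : 0 < expR z * (3 / 4))); last first.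
  by rewrite mulr_gt0 ?expR_gt0.
apply: le_trans hW _; rewrite le_eqVlt; apply/orP; left; apply/eqP; rewrite -/z.
by field; rewrite gt_eqF // expR_gt0.
Qed.

End Matrix.

End BernoulliProduct.

(** * Concentration of the normalized adjacency matrix *)

Section NormLap.
Context {R : realType} {n : nat}.
Implicit Types (A : 'M[R]_n).

Lemma norm_lapE A i j :
  norm_lap A i j = (Num.sqrt (degs A i))^-1 * A i j * (Num.sqrt (degs A j))^-1.
Proof.
by rewrite /norm_lap mul_mx_diag mxE mul_diag_mx !mxE.
Qed.

Lemma norm_lap_sym A : A^T = A -> (norm_lap A)^T = norm_lap A.
Proof.
move=> sA; apply/matrixP => i j; have e : A j i = A i j by rewrite -{1}sA mxE.
by rewrite mxE !norm_lapE e; ring.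
Qed.

Lemma opb_diag (d : 'I_n -> R) K : 0 <= K -> (forall i, `|d i| <= K) ->
  opb (diag_mx (\row_i d i)) K.
Proof.
move=> K0 hd; split=> // x; rewrite mul_diag_mx !sqnE mulr_sumr; apply: ler_sum => i _.
rewrite !big_ord1 !mxE exprMn ler_wpM2r ?sqr_ge0 //.
by rewrite -(@real_normK _ (d i)) ?num_real // lerXn2r ?nnegrE.
Qed.

(* The weighted Cauchy-Schwarz inequality for the weights A i j / deg i. *)
Lemma norm_lap_opb A : A^T = A -> (forall i j, 0 <= A i j) -> opb (norm_lap A) 1.
Proof.
move=> sA A0; split=> // x; rewrite expr1n mul1r.
have d0 i : 0 <= degs A i by apply: sumr_ge0 => j _.
have A_0 i j : degs A i = 0 -> A i j = 0.
  move=> /eqP; rewrite psumr_eq0 // => /allP /(_ j (mem_index_enum j)) /=.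
  by move/eqP.
have step i : sqn (row i (norm_lap A *m x)) <= \sum_j A i j * ((degs A j)^-1 * x j 0 ^+ 2).
  pose u := \col_j (Num.sqrt (A i j) * (Num.sqrt (degs A i))^-1).
  pose v := \col_j (Num.sqrt (A i j) * (Num.sqrt (degs A j))^-1 * x j 0).
  have -> : sqn (row i (norm_lap A *m x)) = frob u v ^+ 2.
    rewrite sqnE !big_ord1 mxE mxE frobE; congr (_ ^+ 2); apply: eq_bigr => j _.
    by rewrite big_ord1 [u _ _]mxE [v _ _]mxE norm_lapE -{1}(sqr_sqrtr (A0 i j)); ring.
  apply: le_trans (frob_CS _ _) _.
  have -> : sqn v = \sum_j A i j * ((degs A j)^-1 * x j 0 ^+ 2).
    rewrite sqnE; apply: eq_bigr => j _; rewrite big_ord1 mxE !exprMn exprVn !sqr_sqrtr //.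
    by ring.
  rewrite ler_piMl //.
    by apply: sumr_ge0 => j _; apply: mulr_ge0 => //; apply: mulr_ge0; rewrite ?invr_ge0 ?sqr_ge0.
  rewrite sqnE (eq_bigr (fun j => A i j * (degs A i)^-1)); last first.
    by move=> j _; rewrite big_ord1 mxE !exprMn exprVn !sqr_sqrtr.
  rewrite -mulr_suml; have [->|di] := eqVneq (degs A i) 0; first by rewrite invr0 mulr0.
  by rewrite divff.
have -> : sqn (norm_lap A *m x) = \sum_i sqn (row i (norm_lap A *m x)).
  by rewrite sqnE; apply: eq_bigr => i _; rewrite sqnE !big_ord1 [in RHS]mxE.
apply: le_trans (ler_sum _ (fun i _ => step i)) _.
rewrite exchange_big sqnE; apply: ler_sum => j _ /=.
rewrite big_ord1 -mulr_suml (_ : \sum_(i < n) A i j = degs A j); last first.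
  by apply: eq_bigr => i _; rewrite -{1}sA mxE.
have [->|dj] := eqVneq (degs A j) 0; first by rewrite mul0r sqr_ge0.
by rewrite mulrA divff // mul1r.
Qed.

(** Let F be the diagonal matrix of the ratios f = sqrt(deg A / deg B). Normalizing A by the degrees
    of B gives F (norm_lap A) F, so the difference is X - (F (norm_lap A) F - norm_lap A). Since f^2
    >= 1 - u >= 3/5 > 4/9, f + 1 >= 5/3 and |f - 1| <= (3/5) u; expanding F = 1 + F1 yields the
    constants. *)
Lemma norm_lap_perturb A B (u : R) : A^T = A -> (forall i j, 0 <= A i j) ->
  (forall i, 0 < degs B i) -> 0 <= u -> u <= 2 / 5 ->
  (forall i, `|degs A i - degs B i| <= u * degs B i) ->
  opb (\matrix_(i, j) ((A i j - B i j) *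
     ((Num.sqrt (degs B i))^-1 * (Num.sqrt (degs B j))^-1))) u ->
  opb (norm_lap A - norm_lap B) (u + (6 / 5 * u + 9 / 25 * u ^+ 2)).
Proof.
move=> sA A0 B0 u0 u1 hd hX.
set X := \matrix_(i, j) _ in hX.
pose f i := Num.sqrt (degs A i) / Num.sqrt (degs B i).
have dA i : 0 < degs A i.
  move: (hd i); rewrite ler_norml => /andP[h _]; have := B0 i => b0.
  have : u * degs B i <= 2 / 5 * degs B i by rewrite ler_wpM2r // ltW.
  by lra.
have sq i : 0 < Num.sqrt (degs B i) by rewrite sqrtr_gt0.
have sa i : 0 < Num.sqrt (degs A i) by rewrite sqrtr_gt0.
have hf i : `|f i - 1| <= 3 / 5 * u.
  have f0 : 0 < f i by rewrite divr_gt0.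
  have f2 : f i ^+ 2 = degs A i / degs B i.
    by rewrite exprMn exprVn !sqr_sqrtr // ltW.
  have h : `|f i ^+ 2 - 1| <= u.
    have -> : f i ^+ 2 - 1 = (degs A i - degs B i) / degs B i.
      by rewrite f2 mulrBl divff // gt_eqF.
    by rewrite normrM [`|_^-1|]gtr0_norm ?invr_gt0 // ler_pdivrMr.
  have f1 : 2 / 3 <= f i.
    rewrite leNgt; apply/negP => lt.
    have : f i ^+ 2 < 4 / 9.
      by rewrite (_ : 4 / 9 = (2 / 3) ^+ 2); [rewrite ltrXn2r // ltW|field].
    by move: h; rewrite ler_norml => /andP[? ?]; lra.
  have : `|f i ^+ 2 - 1| = `|f i - 1| * (f i + 1).
    by rewrite subr_sqr_1 normrM [`|f i + 1|]gtr0_norm // addr_gt0.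
  move=> e; rewrite e in h.
  have : `|f i - 1| * (5 / 3) <= `|f i - 1| * (f i + 1) by rewrite ler_wpM2l //; lra.
  by lra.
pose F := diag_mx (\row_i f i); pose F1 := diag_mx (\row_i (f i - 1)).
have eF : F = F1 + 1%:M.
  apply/matrixP => i j; rewrite !mxE; case: eqVneq => _; rewrite ?mulr0n ?addr0 //.
  by rewrite !mulr1n subrK.
have e0 : 0 <= 3 / 5 * u by rewrite mulr_ge0.
have oF1 : opb F1 (3 / 5 * u) by exact: opb_diag.
have oF : opb F (3 / 5 * u + 1) by rewrite eF; apply: opbD => //; exact: opb1.
have oL := norm_lap_opb sA A0.
have -> : norm_lap A - norm_lap B =
    X - (F1 *m norm_lap A *m F + norm_lap A *m F1).
  have -> : F1 *m norm_lap A *m F + norm_lap A *m F1 = F *m norm_lap A *m F - norm_lap A.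
    rewrite eF !(mulmxDl, mulmxDr) !(mulmx1, mul1mx).
    move: (F1 *m norm_lap A *m F1) (F1 *m norm_lap A) (norm_lap A *m F1) (norm_lap A) => W U V Z.
    by apply/matrixP => i j; rewrite !mxE; ring.
  have := norm_lapE A; have := norm_lapE B.
  move: (norm_lap A) (norm_lap B) => La Lb eB eA.
  apply/matrixP => i j; rewrite /F mul_mx_diag mul_diag_mx !mxE eA eB /f.
  field; rewrite !gt_eqF //.
have -> : u + (6 / 5 * u + 9 / 25 * u ^+ 2) =
   u + (3 / 5 * u * 1 * (3 / 5 * u + 1) + 1 * (3 / 5 * u)) by field.
apply: opbD => //; apply: opbN; apply: opbD; last exact: opbM.
by apply: opbM => //; exact: opbM.
Qed.

End NormLap.

(** * Matrices of single edges *)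

Section Edges.
Context {R : realType} {n : nat}.

(** Edges are indexed by all ordered pairs. An unordered edge is represented by its increasing pair,
    and [edge_mx] vanishes at a strictly decreasing one. *)
Definition ordpair (i j : 'I_n) : 'I_n * 'I_n := if (i <= j)%N then (i, j) else (j, i).

Lemma ordpairC i j : ordpair i j = ordpair j i.
Proof.
by rewrite /ordpair; case: (ltngtP i j) => // /val_inj ->.
Qed.

Lemma ordpair_le i j : ((ordpair i j).1 <= (ordpair i j).2)%N.
Proof. by rewrite /ordpair; case: ifP => //= /negbT; rewrite -ltnNge => /ltnW. Qed.

Lemma ordpair_injl i j k : ordpair i j = ordpair k j -> i = k.
Proof.
rewrite /ordpair; case: ifP => ij; case: ifP => kj [] // e1 e2; first by subst.
by subst.
Qed.

Lemma ordpair_inj i j k : ordpair i j = ordpair i k -> j = k.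
Proof. by rewrite ![ordpair i _]ordpairC; exact: ordpair_injl. Qed.

Definition edge_mx (e : 'I_n * 'I_n) : 'M[R]_n := \matrix_(i, j) (ordpair i j == e)%:R.

Lemma edge_mx_sym e : (edge_mx e)^T = edge_mx e.
Proof. by apply/matrixP => i j; rewrite !mxE ordpairC. Qed.

Lemma edge_mx_sqr e :
  edge_mx e *m edge_mx e = diag_mx (\row_i \sum_j (ordpair i j == e)%:R).
Proof.
apply/matrixP => i k; rewrite !mxE; case: eqVneq => [->|ik].
  by rewrite mulr1n; apply: eq_bigr => j _; rewrite !mxE ordpairC -natrM mulnb andbb.
rewrite mulr0n big1 // => j _; rewrite !mxE -natrM mulnb.
case: eqP => //= e1; case: eqP => // e2; exfalso.
by move/eqP: ik; apply; apply: (@ordpair_injl _ j); rewrite e1 -e2 ordpairC.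
Qed.

Lemma edge_deg01 (e : 'I_n * 'I_n) i j : ordpair i j = e ->
  \sum_k (ordpair i k == e)%:R = 1 :> R.
Proof.
move=> ije; rewrite (bigD1 j) //= ije eqxx big1 ?addr0 // => k kj.
case: eqP => // ike; exfalso; move/eqP: kj; apply.
by apply: (@ordpair_inj i); rewrite ike.
Qed.

(** At an increasing pair [edge_mx e] exchanges the two endpoints, or fixes the endpoint of a loop,
    and kills the other basis vectors; its square is the projection onto the endpoints. *)
Lemma edge_mx3 e : edge_mx e *m edge_mx e *m edge_mx e = edge_mx e.
Proof.
rewrite edge_mx_sqr mul_diag_mx; apply/matrixP => i j; rewrite !mxE.
case: eqP => [ije|_]; last by rewrite mulr0.
by rewrite (edge_deg01 ije) mul1r.
Qed.

Lemma sum_edge_mx (c : 'I_n * 'I_n -> R) i j : (\sum_e c e *: edge_mx e) i j = c (ordpair i j).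
Proof.
rewrite summxE (bigD1 (ordpair i j)) //= !mxE eqxx mulr1 big1 ?addr0 // => e ne.
by rewrite !mxE eq_sym (negPf ne) mulr0.
Qed.

Lemma sum_edge_deg (c : 'I_n * 'I_n -> R) i :
  \sum_e c e * \sum_j (ordpair i j == e)%:R = \sum_j c (ordpair i j).
Proof.
under eq_bigr do rewrite mulr_sumr.
rewrite exchange_big /=; apply: eq_bigr => j _.
rewrite (bigD1 (ordpair i j)) //= eqxx mulr1 big1 ?addr0 // => e ne.
by rewrite eq_sym (negPf ne) mulr0.
Qed.

Lemma edge_deg_sqr (e : 'I_n * 'I_n) i :
  (\sum_j (ordpair i j == e)%:R) ^+ 2 = \sum_j (ordpair i j == e)%:R :> R.
Proof.
have [[j /eqP je]|h] := pselect (exists j, ordpair i j == e).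
  by rewrite (edge_deg01 je) expr1n.
rewrite big1 ?expr0n // => j _; case: eqP => // je.
by exfalso; apply: h; exists j; apply/eqP.
Qed.

Lemma sum_edge_mx_sqr (c : 'I_n * 'I_n -> R) :
  \sum_e c e *: (edge_mx e *m edge_mx e) = diag_mx (\row_i \sum_j c (ordpair i j)).
Proof.
under eq_bigr do rewrite edge_mx_sqr -linearZ.
rewrite -linear_sum; congr diag_mx; apply/rowP => i; rewrite summxE mxE -sum_edge_deg.
by apply: eq_bigr => e _; rewrite !mxE.
Qed.

End Edges.

(** * Degree and spectral tails of the random graph *)

Section RandomGraph.
Context {R : realType} {n : nat} (p : 'I_n -> 'I_n -> R) (delta L : R).
Hypotheses (psym : forall i j, p i j = p j i) (p01 : forall i j, 0 <= p i j <= 1).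
Hypotheses (delta0 : 0 < delta) (hdelta : forall i, delta <= \sum_j p i j).
Hypotheses (L0 : 0 < L) (hL : 27 * L < delta).

(** Probability 0 at strictly decreasing pairs concentrates the product weight on configurations
    that describe each graph once. *)
Definition edge_prob (e : 'I_n * 'I_n) : R := if (e.1 <= e.2)%N then p e.1 e.2 else 0.

Definition cfg_adj (a : {ffun 'I_n * 'I_n -> bool}) : 'M[R]_n :=
  \matrix_(i, j) (a (ordpair i j))%:R.

Let P0 : 'M[R]_n := \matrix_(i, j) p i j.

(** Chosen so that u^2 delta = 4 L: the optimized Chernoff exponent u^2 delta / 4 is then exactly
    L. *)
Let u := 2 * Num.sqrt (L / delta).

Lemma edge_prob01 e : 0 <= edge_prob e <= 1.
Proof. by rewrite /edge_prob; case: ifP => // _; rewrite lexx ler01. Qed.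

Lemma edge_prob_ordpair i j : edge_prob (ordpair i j) = p i j.
Proof. by rewrite /edge_prob ordpair_le /ordpair; case: leqP => //= _; exact: psym. Qed.

Let u2 : u ^+ 2 * delta = 4 * L.
Proof.
rewrite exprMn sqr_sqrtr ?divr_ge0 // ?ltW //.
by field; rewrite gt_eqF.
Qed.

Let u0 : 0 <= u. Proof. by rewrite mulr_ge0 ?sqrtr_ge0. Qed.

(** The condition 27 L < delta enters here: u^2 = 4 L / delta < 4/27 < (2/5)^2. *)
Let u1 : u <= 2 / 5.
Proof.
have h : u ^+ 2 <= (2 / 5) ^+ 2.
  by rewrite -(ler_pM2r delta0) u2; have := hL; have := delta0; lra.
by move: h; rewrite ler_pXn2r // nnegrE.
Qed.

(** The sign [sg] covers both tails. With parameter u/2 the moment generating function is at most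
    exp(u^2 d / 4) and the threshold is exp(u^2 d / 2), which leaves exp(- u^2 d / 4) <= exp(-
    L). *)
Lemma deg_tail (i : 'I_n) (sg : R) : `|sg| = 1 ->
  \sum_(a : {ffun 'I_n * 'I_n -> bool} | u * \sum_j p i j < sg * \sum_j ((a (ordpair i j))%:R - p i j)) cfg_wt edge_prob a
  <= expR (- L).
Proof.
move=> sg1; set d := \sum_j p i j.
have dd : delta <= d by exact: hdelta.
have d0 : 0 <= d by apply: le_trans dd; exact: ltW.
pose h (e : 'I_n * 'I_n) : R := \sum_j (ordpair i j == e)%:R.
have h1 e : `|h e| <= 1.
  rewrite ger0_norm ?sumr_ge0 //.
  have he : h e ^+ 2 = h e by exact: edge_deg_sqr.
  have : h e * (h e - 1) = 0 by rewrite mulrBr mulr1 -expr2 he subrr.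
  by move/eqP; rewrite mulf_eq0 subr_eq0 => /orP[] /eqP ->; rewrite ?ler01.
pose y e := u / 2 * (sg * h e).
have hy e : `|y e| <= 3^-1.
  rewrite normrM [`|sg * _|]normrM sg1 mul1r ger0_norm ?divr_ge0 //.
  have : u / 2 * `|h e| <= u / 2 * 1 by rewrite ler_wpM2l // divr_ge0.
  by have := u1; lra.
have := scalar_chernoff edge_prob01 hy.
have -> : \sum_e edge_prob e * y e ^+ 2 = u ^+ 2 * d / 4.
  have -> : u ^+ 2 * d / 4 = u ^+ 2 / 4 * \sum_j edge_prob (ordpair i j).
    rewrite mulrAC; congr (_ * _); apply: eq_bigr => j _.
    by rewrite edge_prob_ordpair.
  rewrite -sum_edge_deg mulr_sumr; apply: eq_bigr => e _.
  rewrite -edge_deg_sqr -/(h e) /y.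
  have sg2 : sg ^+ 2 = 1 by rewrite -real_normK ?num_real // sg1 expr1n.
  by rewrite !exprMn sg2; field.
move=> hex.
pose B (a : {ffun 'I_n * 'I_n -> bool}) := u * d < sg * \sum_j ((a (ordpair i j))%:R - p i j).
have hB (a : {ffun 'I_n * 'I_n -> bool}) : B a ->
    expR (u ^+ 2 * d / 2) <= expR (\sum_e ((a e)%:R - edge_prob e) * y e).
  move=> /ltW Ba; rewrite ler_expR.
  have -> : \sum_e ((a e)%:R - edge_prob e) * y e =
     u / 2 * (sg * \sum_j ((a (ordpair i j))%:R - p i j)).
    rewrite [\sum_j _](_ : _ = \sum_j ((a (ordpair i j))%:R - edge_prob (ordpair i j))); last first.
      by apply: eq_bigr => j _; rewrite edge_prob_ordpair.
    rewrite -(sum_edge_deg (fun e => (a e)%:R - edge_prob e)) !mulr_sumr.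
    by apply: eq_bigr => e _; rewrite -/(h e) /y; ring.
  have -> : u ^+ 2 * d / 2 = u / 2 * (u * d) by field.
  by rewrite ler_wpM2l // divr_ge0.
have := cfg_markov edge_prob01 (fun a => expR_ge0 _) hB.
move=> /le_trans /(_ hex) hW.
rewrite -(ler_pM2r (expR_gt0 (u ^+ 2 * d / 2))); apply: le_trans hW _.
rewrite -expRD ler_expR.
have : u ^+ 2 * delta <= u ^+ 2 * d by rewrite ler_wpM2l ?sqr_ge0.
by rewrite u2; lra.
Qed.

Definition good_cfg (a : {ffun 'I_n * 'I_n -> bool}) :=
  (forall i, `|degs (cfg_adj a) i - degs P0 i| <= u * degs P0 i) /\
  opb (\matrix_(i, j) ((cfg_adj a i j - P0 i j) *
     ((Num.sqrt (degs P0 i))^-1 * (Num.sqrt (degs P0 j))^-1))) u.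

Let degP i : degs P0 i = \sum_j p i j.
Proof. by apply: eq_bigr => j _; rewrite mxE. Qed.

(** [matrix_chernoff] with theta = u delta / 2 and v = 1 / delta, for which theta^2 v - theta u = -
    L. The proxy is diagonal with entries sum_j p_ij / (d_i d_j) <= 1 / delta, and theta times a
    weight is at most u / 2 <= 1/5 in absolute value. *)
Lemma opb_tail (sg : R) : `|sg| = 1 ->
  \sum_(a : {ffun 'I_n * 'I_n -> bool} | `[< exists2 x : 'cV[R]_n, sqn x = 1 & u <= sg * frob x
      ((\matrix_(i, j) ((cfg_adj a i j - P0 i j) *
     ((Num.sqrt (degs P0 i))^-1 * (Num.sqrt (degs P0 j))^-1))) *m x) >])
    cfg_wt edge_prob a <= n%:R * expR (- L) * 2.
Proof.
move=> sg1.
have dd i : delta <= degs P0 i by rewrite degP.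
have sd i : Num.sqrt delta <= Num.sqrt (degs P0 i) by rewrite ler_wsqrtr.
have sd0 : 0 < Num.sqrt delta by rewrite sqrtr_gt0.
have sdi i : 0 < Num.sqrt (degs P0 i) by exact: lt_le_trans (sd i).
pose w (e : 'I_n * 'I_n) := sg * ((Num.sqrt (degs P0 e.1))^-1 * (Num.sqrt (degs P0 e.2))^-1).
have wo i j : w (ordpair i j) = sg * ((Num.sqrt (degs P0 i))^-1 * (Num.sqrt (degs P0 j))^-1).
  by rewrite /w /ordpair; case: ifP => //= _; rewrite [_^-1 * _]mulrC.
have -> : - L = (u * delta / 2) ^+ 2 * delta^-1 - u * delta / 2 * u.
  have -> : (u * delta / 2) ^+ 2 * delta^-1 - u * delta / 2 * u = - (u ^+ 2 * delta / 4).
    by field; rewrite gt_eqF.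
  by rewrite u2; field.
have sg2 : sg ^+ 2 = 1 by rewrite -real_normK ?num_real // sg1 expr1n.
apply: (@matrix_chernoff _ _ _ edge_prob01 _ _ (@edge_mx_sym _ _) (@edge_mx3 _ _) w
   (fun i => \sum_j edge_prob (ordpair i j) * w (ordpair i j) ^+ 2)) => //.
- by rewrite !mulr_ge0 // ltW.
- exact: sum_edge_mx_sqr.
- move=> i; apply/andP; split.
    apply: sumr_ge0 => j _; rewrite mulr_ge0 ?sqr_ge0 //.
    by have /andP[] := edge_prob01 (ordpair i j).
  apply: le_trans (_ : \sum_j p i j * (degs P0 i)^-1 * delta^-1 <= _); last first.
    by rewrite -!mulr_suml -degP divff ?mul1r // gt_eqF // (lt_le_trans delta0).
  apply: ler_sum => j _; rewrite edge_prob_ordpair wo.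
  have /andP[pij _] := p01 i j.
  rewrite exprMn sg2 mul1r exprMn !exprVn !sqr_sqrtr ?(le_trans (ltW delta0)) // -mulrA.
  rewrite ler_wpM2l // ler_wpM2l ?invr_ge0 ?(le_trans (ltW delta0)) //.
  by rewrite lef_pV2 // posrE // (lt_le_trans delta0).
- move=> e; rewrite normrM ger0_norm ?mulr_ge0 ?(ltW delta0) //.
  rewrite /w normrM sg1 mul1r ger0_norm ?mulr_ge0 ?invr_ge0 ?sqrtr_ge0 //.
  apply: le_trans (_ : u * delta / 2 * ((Num.sqrt delta)^-1 * (Num.sqrt delta)^-1) <= _).
    rewrite ler_wpM2l ?mulr_ge0 ?(ltW delta0) //.
    by rewrite ler_pM ?invr_ge0 ?sqrtr_ge0 // lef_pV2 ?posrE.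
  rewrite -invfM -expr2 sqr_sqrtr ?(ltW delta0) //.
  have -> : u * delta / 2 / delta = u / 2 by field; rewrite gt_eqF.
  by have := u1; lra.
move=> a /asboolP [x x1 hx]; exists x => //.
apply: le_trans hx _; rewrite -frobZr scalemxAl le_eqVlt; apply/orP; left; apply/eqP.
congr (frob x (_ *m x)); apply/matrixP => i j.
rewrite [RHS]sum_edge_mx edge_prob_ordpair wo !mxE.
ring.
Qed.

(** Union bound: n degree tails for each sign contribute 2n, and the matrix tail, 2n for each sign,
    contributes 4n. Outside these events [opb_sym] turns the bounds on quadratic forms of unit
    vectors into a norm bound. *)
Lemma good_cfg_prob :
  \sum_(a : {ffun 'I_n * 'I_n -> bool} | ~~ `[< good_cfg a >]) cfg_wt edge_prob a <= 6 * n%:R * expR (- L).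
Proof.
pose Bd (sg : R) i (a : {ffun 'I_n * 'I_n -> bool}) :=
  u * \sum_j p i j < sg * \sum_j ((a (ordpair i j))%:R - p i j).
pose Bm (sg : R) (a : {ffun 'I_n * 'I_n -> bool}) :=
  `[< exists2 x : 'cV[R]_n, sqn x = 1 & u <= sg * frob x
      ((\matrix_(i, j) ((cfg_adj a i j - P0 i j) *
     ((Num.sqrt (degs P0 i))^-1 * (Num.sqrt (degs P0 j))^-1))) *m x) >].
have cov (a : {ffun 'I_n * 'I_n -> bool}) : ~~ `[< good_cfg a >] ->
  [|| [exists i, Bd 1 i a], [exists i, Bd (-1) i a], Bm 1 a | Bm (-1) a].
  apply: contraNT => /norP[/existsPn h1 /norP[/existsPn h2 /norP[h3 h4]]].
  apply/asboolP; split.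
    move=> i; have := h1 i; have := h2 i; rewrite /Bd -!leNgt mul1r mulN1r sumrB => k2 k1.
    rewrite degP; have -> : degs (cfg_adj a) i = \sum_j (a (ordpair i j))%:R.
      by apply: eq_bigr => j _; rewrite mxE.
    by rewrite ler_norml; apply/andP; split; lra.
  rewrite /Bm in h3 h4; set X := \matrix_(i, j) _ in h3 h4 *.
  apply: opb_sym => //.
    apply/matrixP => i j; rewrite !mxE ordpairC psym.
    by rewrite [_^-1 * _^-1]mulrC.
  move=> x; have [->|x0] := eqVneq x 0.
    by rewrite mulmx0 /sqn /frob mulmx0 linear0 normr0 mulr0.
  have sx : 0 < sqn x by rewrite lt_neqAle sqn_ge0 eq_sym sqn_eq0 x0.
  set s := Num.sqrt (sqn x); have s0 : 0 < s by rewrite sqrtr_gt0.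
  have s2 : s ^+ 2 = sqn x by rewrite sqr_sqrtr // ltW.
  have n1 : sqn (s^-1 *: x) = 1 by rewrite sqnZ exprVn s2 mulVf // gt_eqF.
  have ef : frob x (X *m x) = sqn x * frob (s^-1 *: x) (X *m (s^-1 *: x)).
    by rewrite -scalemxAr frobZl frobZr -s2; field; rewrite gt_eqF.
  rewrite ef normrM (gtr0_norm sx) mulrC ler_pM2r // ler_norml; apply/andP; split.
    rewrite leNgt; apply/negP => lt; move/negP: h4; apply; apply/asboolP; refine (ex_intro2 _ _ (s^-1 *: x) n1 _).
    by rewrite mulN1r; apply: ltW; rewrite ltrNr.
  rewrite leNgt; apply/negP => lt; move/negP: h3; apply; apply/asboolP; refine (ex_intro2 _ _ (s^-1 *: x) n1 _).
  by rewrite mul1r ltW.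
have wt0 a := cfg_wt_ge0 edge_prob01 a.
have sumU (B B1 B2 : pred {ffun 'I_n * 'I_n -> bool}) : (forall a, B a -> B1 a || B2 a) ->
  \sum_(a : {ffun 'I_n * 'I_n -> bool} | B a) cfg_wt edge_prob a <=
  \sum_(a : {ffun 'I_n * 'I_n -> bool} | B1 a) cfg_wt edge_prob a + \sum_(a : {ffun 'I_n * 'I_n -> bool} | B2 a) cfg_wt edge_prob a.
  move=> h; rewrite !(big_mkcond B) (big_mkcond B1) (big_mkcond B2) -big_split /=.
  apply: ler_sum => a _; have := wt0 a; have := h a.
  by case: (B a); case: (B1 a); case: (B2 a) => //= h' w0; rewrite ?addr0 ?add0r ?addr_ge0 ?lerDl //; have := h' isT.
have sumE (sg : R) : `|sg| = 1 ->
   \sum_(a : {ffun 'I_n * 'I_n -> bool} | [exists i, Bd sg i a]) cfg_wt edge_prob a <= n%:R * expR (- L).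
  move=> sg1; have -> : n%:R * expR (- L) = \sum_(i < n) expR (- L).
    by rewrite sumr_const card_ord mulr_natl.
  apply: le_trans (ler_sum _ (fun i _ => deg_tail i sg1)).
  under [leRHS]eq_bigr do rewrite big_mkcond.
  rewrite exchange_big /= big_mkcond; apply: ler_sum => a _; case: ifP => [/existsP[i hi]|_].
    rewrite (bigD1 i) //= ifT // lerDl.
    by apply: sumr_ge0 => j _; case: ifP.
  by apply: sumr_ge0 => j _; case: ifP.
apply: le_trans (sumU _ _ _ cov) _.
have -> : 6 * n%:R * expR (- L) = n%:R * expR (- L) + (n%:R * expR (- L) +
   (n%:R * expR (- L) * 2 + n%:R * expR (- L) * 2)) by ring.
apply: lerD; first by apply: sumE; rewrite normr1.
apply: le_trans (sumU _ _ _ (fun a h => h)) _.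
apply: lerD; first by apply: sumE; rewrite normrN1.
apply: le_trans (sumU _ _ _ (fun a h => h)) _.
by apply: lerD; apply: opb_tail; rewrite ?normr1 ?normrN1.
Qed.

Lemma good_cfg_lap a : good_cfg a ->
  opb (norm_lap (cfg_adj a)) 1 /\
  opb (norm_lap (cfg_adj a) - norm_lap P0) (3 * Num.sqrt (3 * L / delta)).
Proof.
move=> [hd hX].
have sA : (cfg_adj a)^T = cfg_adj a.
  by apply/matrixP => i j; rewrite !mxE ordpairC.
have A0 i j : 0 <= cfg_adj a i j by rewrite mxE.
have dP i : 0 < degs P0 i by rewrite degP (lt_le_trans delta0).
split; first exact: norm_lap_opb.
apply: opbW (norm_lap_perturb sA A0 dP u0 u1 hd hX).
have Ld : 0 <= L / delta by rewrite divr_ge0 // ltW.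
have r0 := sqrtr_ge0 (L / delta).
have -> : 3 * L / delta = 3 * (L / delta) by rewrite mulrA.
rewrite sqrtrM // mulrA.
(* As u <= 2/5, u + (6/5) u + (9/25) u^2 <= (5/2) u; afterwards 5 <= 3 sqrt 3, that is 25 <= 27. *)
apply: le_trans (_ : 5 / 2 * u <= _).
  have : u * u <= 2 / 5 * u by rewrite ler_wpM2r.
  by have := u0; rewrite expr2; lra.
have -> : 5 / 2 * u = 5 * Num.sqrt (L / delta) by rewrite /u; field.
rewrite ler_wpM2r //.
have h : (5 : R) ^+ 2 <= (3 * Num.sqrt 3) ^+ 2 by rewrite exprMn sqr_sqrtr //; lra.
by move: h; rewrite ler_pXn2r // nnegrE // mulr_ge0 // sqrtr_ge0.
Qed.

End RandomGraph.

(** * Perturbation of eigenvalues *)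

Lemma char_poly_similar (K : comNzRingType) (n : nat) (P Q D : 'M[K]_n) :
  Q *m P = 1%:M -> char_poly (P *m D *m Q) = char_poly D.
Proof.
move=> QP; have PQ : P *m Q = 1%:M by apply: mulmx1C.
rewrite /char_poly /char_poly_mx !map_mxM /=.
have QP' : map_mx polyC Q *m map_mx polyC P = 1%:M by rewrite -map_mxM QP map_mx1.
have PQ' : map_mx polyC P *m map_mx polyC Q = 1%:M by rewrite -map_mxM PQ map_mx1.
have -> : 'X%:M - map_mx polyC P *m map_mx polyC D *m map_mx polyC Q =
   map_mx polyC P *m ('X%:M - map_mx polyC D) *m map_mx polyC Q.
  by rewrite mulmxBr mulmxBl scalar_mxC -(mulmxA 'X%:M) PQ' mulmx1.
by rewrite !det_mulmx mulrC mulrA -det_mulmx QP' det1 mul1r.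
Qed.

Section Spectral.
Context {R : realType} {n : nat}.
Local Open Scope sesquilinear_scope.
Local Open Scope complex_scope.
Implicit Types (A B : 'M[R]_n) (a b : 'I_n -> R).

Local Notation cmx := (map_mx (real_complex R)).

(** The eigenvalues are real while the orthonormal eigenbasis, the rows of U, is taken over R[i]. *)
Definition spectral_form A a := exists2 U : 'M[R[i]]_n, U \is unitarymx &
  cmx A = U ^t* *m diag_mx (\row_i (a i)%:C) *m U.

Lemma spectral_form_exists A : A^T = A -> exists a, spectral_form A a.
Proof.
move=> sA.
have hA : cmx A \is hermsymmx.
  apply: realsym_hermsym.
    by apply/is_hermitianmxP; rewrite expr0 scale1r map_mx_id // map_trmx sA.
  by apply/mxOverP => i j; rewrite mxE; apply/complex_realP; exists (A i j).
have /orthomx_spectralP eA := hermitian_normalmx hA.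
have /mxOverP rA := hermitian_spectral_diag_real hA.
exists (fun i => complex.Re (spectral_diag (cmx A) 0 i)).
exists (spectralmx (cmx A)); first exact: spectral_unitarymx.
apply: etrans eA _; rewrite invmx_unitary ?spectral_unitarymx //.
congr (_ *m _ *m _); congr diag_mx; by apply/rowP => i; rewrite mxE RRe_real.
Qed.

Lemma spectral_form_perm A a (f : 'I_n -> 'I_n) : injective f ->
  spectral_form A a -> spectral_form A (a \o f).
Proof.
move=> fi [U uU eA]; exists (rowsub f U).
  apply/unitarymxP; have /unitarymxP uU' := uU.
  apply/matrixP => i j; have /matrixP /(_ (f i) (f j)) := uU'.
  by rewrite !mxE (inj_eq fi) => <-; apply: eq_bigr => k _; rewrite !mxE.
rewrite eA; apply/matrixP => i j; rewrite !mxE (reindex_inj fi).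
apply: eq_bigr => k _; rewrite !mul_mx_diag !mxE //.
Qed.

Lemma spectral_form_sorted A : A^T = A -> exists2 a, spectral_form A a &
  forall i j : 'I_n, (i <= j)%N -> `|a j| <= `|a i|.
Proof.
move=> sA; have [a ha] := spectral_form_exists sA.
pose r (i j : 'I_n) := `|a j| <= `|a i|.
pose s := sort r (enum 'I_n).
have ss : size s = n by rewrite size_sort size_enum_ord.
have us : uniq s by rewrite sort_uniq enum_uniq.
have rtr : transitive r by move=> y x z /= h1 h2; exact: le_trans h2 h1.
have rtot : total r by move=> x y; rewrite /r; exact: le_total.
have rrefl : reflexive r by move=> x; rewrite /r.
pose f (i : 'I_n) := nth i s i.
have fE (i j : 'I_n) : f i = nth j s i by apply: set_nth_default; rewrite ss.
have fi : injective f.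
  move=> i j; rewrite (fE i j) /f => /eqP; rewrite nth_uniq ?ss // => /eqP.
  exact: val_inj.
exists (a \o f); first exact: spectral_form_perm.
move=> i j ij; rewrite /= (fE i j).
apply: (sorted_leq_nth rtr rrefl); rewrite ?inE ?ss //.
exact: sort_sorted.
Qed.

Lemma spectral_form_char_poly A a : spectral_form A a ->
  char_poly A = \prod_(i < n) ('X - (a i)%:P).
Proof.
move=> [U uU eA]; apply: (@map_poly_inj _ _ (real_complex R)).
rewrite map_char_poly /= eA char_poly_similar; last by apply/unitarymxP.
rewrite char_poly_trig ?diag_mx_is_trig // rmorph_prod; apply: eq_bigr => i _.
by rewrite !mxE eqxx mulr1n rmorphB /= map_polyX map_polyC.
Qed.

(** Only moduli are determined, since an ordering by modulus may list x and -x either way. The two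
    lists of moduli are sorted and are permutations of each other, hence equal. *)
Lemma spectral_form_abs_uniq A a (mu : 'I_n -> R) : spectral_form A a ->
  char_poly A = \prod_(i < n) ('X - (mu i)%:P) ->
  (forall i j : 'I_n, (i <= j)%N -> `|a j| <= `|a i|) ->
  (forall i j : 'I_n, (i <= j)%N -> `|mu j| <= `|mu i|) ->
  forall i, `|a i| = `|mu i|.
Proof.
move=> /spectral_form_char_poly -> e sa smu.
have pe : perm_eq (map (fun i => `|a i|) (enum 'I_n)) (map (fun i => `|mu i|) (enum 'I_n)).
  rewrite (map_comp (fun x : R => `|x|) a) (map_comp (fun x : R => `|x|) mu).
  by apply/perm_map/prod_XsubC_eq; rewrite !big_map.
have srt (m : 'I_n -> R) : (forall i j : 'I_n, (i <= j)%N -> `|m j| <= `|m i|) ->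
   sorted (fun x y : R => y <= x) (map (fun i => `|m i|) (enum 'I_n)).
  move=> sm; rewrite sorted_map; apply: (@sub_sorted _ (relpre val leq)).
    by move=> i j; exact: sm.
  by rewrite -sorted_map val_enum_ord iota_sorted.
have := @sorted_eq _ (fun x y : R => y <= x) _ _ _ _ (srt a sa) (srt mu smu) pe.
move=> /(_ (fun y x z h1 h2 => le_trans h2 h1)) h i.
have {}h := h (fun x y h' => le_anti (etrans (andbC _ _) h')).
have : nth 0 (map (fun i => `|a i|) (enum 'I_n)) i = nth 0 (map (fun i => `|mu i|) (enum 'I_n)) i.
  by rewrite h.
rewrite (nth_map i 0 (fun i => `|a i|)) ?size_enum_ord //.
by rewrite (nth_map i 0 (fun i => `|mu i|)) ?size_enum_ord // !nth_ord_enum.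
Qed.

Lemma spectral_form_trace A a m : spectral_form A a -> \tr (A ^+ m) = \sum_i a i ^+ m.
Proof.
move=> [U uU eA]; apply: (@complexI R).
have /unitarymxP uU' := uU.
have -> : (\tr (A ^+ m))%:C = \tr (cmx A ^+ m).
  have -> : cmx A ^+ m = cmx (A ^+ m).
    elim: m => [|m IH]; first by rewrite !expr0 map_mx1.
    by rewrite !exprS IH -![_ * _]/(_ *m _) map_mxM.
  by rewrite /mxtrace rmorph_sum; apply: eq_bigr => i _; rewrite mxE.
rewrite eA -mulmxA tr_mulX_C -mulmxA uU' mulmx1.
have -> : diag_mx (\row_i (a i)%:C) ^+ m = diag_mx (\row_i ((a i) ^+ m)%:C).
  elim: m => [|m IH].
    rewrite expr0; apply/matrixP => i j; rewrite !mxE expr0.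
    by case: (i == j).
  rewrite exprS IH -[_ * _]/(_ *m _) mulmx_diag; congr diag_mx; apply/rowP => i.
  by rewrite !mxE exprS rmorphM.
by rewrite mxtrace_diag rmorph_sum; apply: eq_bigr => i _; rewrite mxE.
Qed.

(** If [a i] were nonzero, so would be every [a j] with j <= i; then [pid_mx i.+1] would factor
    through the diagonal matrix, whose rank is at most k <= i. *)
Lemma spectral_form_rank A a k : spectral_form A a -> (\rank A <= k)%N ->
  (forall i j : 'I_n, (i <= j)%N -> `|a j| <= `|a i|) ->
  forall i : 'I_n, (k <= i)%N -> a i = 0.
Proof.
move=> [U uU eA] rk sa i ki; apply/eqP; apply: contraT => ai.
have /unitarymxP uU' := uU.
pose D : 'M[R[i]]_n := diag_mx (\row_j (a j)%:C).
have eD : D = U *m cmx A *m U ^t*.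
  by rewrite eA !mulmxA uU' mul1mx -mulmxA uU' mulmx1.
have rD : (\rank D <= \rank A)%N.
  rewrite -(mxrank_map (real_complex R) A) eD.
  by apply: leq_trans (mxrankM_maxl _ _) (mxrankM_maxr _ _).
have e : (pid_mx i.+1 : 'M[R[i]]_n) =
    (pid_mx i.+1 : 'M[R[i]]_n) *m diag_mx (\row_j ((a j)^-1)%:C) *m D.
  rewrite -mulmxA mulmx_diag mul_mx_diag; apply/matrixP => j l; rewrite !mxE.
  case: eqVneq => [jl|]; last by rewrite mul0r.
  case: ltnP => [ji|]; last by rewrite andbF mul0r.
  rewrite andbT mul1r -rmorphM /= mulVf //.
  have lj : l = j by apply: val_inj.
  rewrite lj; apply/eqP => aj; move: ai; rewrite -normr_le0.
  apply/negP; rewrite negbK.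
  by apply: le_trans (sa j i _) _; [rewrite -ltnS|rewrite aj normr0].
have : (i.+1 <= k)%N.
  apply: leq_trans rk; apply: leq_trans rD.
  rewrite -[i.+1](@rank_pid_mx R[i] n n) // e; exact: mxrankM_maxr.
by rewrite ltnNge ki.
Qed.

(** Real and imaginary parts as two rows: this lets [opb], a statement on real vectors, act on
    complex combinations of eigenvectors without changing lengths. *)
Definition realify (x : 'rV[R[i]]_n) : 'M[R]_(2, n) :=
  \matrix_(i, j) (if i == 0 then complex.Re (x 0 j) else complex.Im (x 0 j)).

Lemma realify_mul x A : realify (x *m cmx A) = realify x *m A.
Proof.
apply/matrixP => i j; rewrite !mxE.
case: ifP => i0; rewrite raddf_sum; apply: eq_bigr => l _; rewrite !mxE i0.
  by case: (x 0 l) => u v /=; rewrite mulr0 subr0.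
by case: (x 0 l) => u v /=; rewrite mulr0 add0r.
Qed.

Lemma sqn_realify x : (sqn (realify x))%:C = (x *m x ^t*) 0 0.
Proof.
rewrite sqnE big_ord_recl big_ord1 -big_split /= rmorph_sum mxE; apply: eq_bigr => j _.
by rewrite !mxE /= add_Re2_Im2 normCK.
Qed.

Lemma sqn_realify_unitary (y : 'rV[R[i]]_n) (U : 'M[R[i]]_n) : U \is unitarymx ->
  sqn (realify (y *m U)) = \sum_j (complex.Re `|y 0 j|) ^+ 2.
Proof.
move=> /unitarymxP uU; apply: (@complexI R); rewrite sqn_realify.
rewrite trmx_mul map_mxM mulmxA -[_ *m U *m _]mulmxA uU mulmx1 mxE rmorph_sum.
apply: eq_bigr => j _; by rewrite !mxE -normCK rmorphXn.
Qed.

Lemma opb_rows m A K (X : 'M[R]_(m, n)) : A^T = A -> opb A K ->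
  sqn (X *m A) <= K ^+ 2 * sqn X.
Proof.
move=> sA [K0 hA].
have e p (Y : 'M[R]_(p, n)) : sqn Y = \sum_i sqn (row i Y)^T.
  rewrite sqnE; apply: eq_bigr => i _; rewrite sqn_trmx sqnE big_ord1.
  by apply: eq_bigr => j _; rewrite mxE.
rewrite !e mulr_sumr; apply: ler_sum => i _.
by rewrite row_mul trmx_mul sA.
Qed.

(* The span of the leading i+1 eigenvectors of A meets the span of the
   trailing n-i eigenvectors of B. *)
Lemma weyl A B a b (M : R) : B^T = B -> A^T = A -> spectral_form A a -> spectral_form B b ->
  (forall i j : 'I_n, (i <= j)%N -> `|a j| <= `|a i|) ->
  (forall i j : 'I_n, (i <= j)%N -> `|b j| <= `|b i|) ->
  opb (A - B) M -> forall i, `|a i| <= `|b i| + M.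
Proof.
move=> sB sA [U uU eA] [V uV eB] sa sb hM i.
have M0 := opb_ge0 hM.
(* The dimensions i + 1 and n - i add up to n + 1, which forces a common nonzero vector x. *)
pose J : 'M[R[i]]_n := pid_mx i.+1 *m U; pose L : 'M[R[i]]_n := copid_mx i *m V.
have rJ : \rank J = i.+1.
  have fU : row_free U by rewrite row_free_unit; exact: unitarymx_unit.
  by rewrite (mxrankMfree _ fU) rank_pid_mx.
have rL : \rank L = (n - i)%N.
  have fV : row_free V by rewrite row_free_unit; exact: unitarymx_unit.
  by rewrite (mxrankMfree _ fV) rank_copid_mx // ltnW.
have : (0 < \rank (J :&: L)%MS)%N.
  have := mxrank_sum_cap J L; rewrite rJ rL addSn subnKC ?(ltnW (ltn_ord i)) // => h.
  have h2 := rank_leq_col (J + L)%MS.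
  by rewrite lt0n; apply/eqP => h0; move: h2; rewrite -(addn0 (\rank _)) -h0 h ltnn.
rewrite lt0n mxrank_eq0 => /rowV0Pn [x xJL x0].
have [/submxP[c xc] /submxP[d xd]] : (x <= J)%MS /\ (x <= L)%MS.
  by move: xJL; rewrite sub_capmx => /andP[].
pose y := c *m (pid_mx i.+1 : 'M[R[i]]_n); pose z := d *m (copid_mx i : 'M[R[i]]_n).
have xy : x = y *m U by rewrite xc mulmxA.
have xz : x = z *m V by rewrite xd mulmxA.
have uU' := unitarymxP uU; have uV' := unitarymxP uV.
have xA : x *m cmx A = (y *m diag_mx (\row_i (a i)%:C)) *m U.
  by rewrite xy eA !mulmxA -[_ *m U *m _]mulmxA uU' mulmx1.
have xB : x *m cmx B = (z *m diag_mx (\row_i (b i)%:C)) *m V.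
  by rewrite xz eB !mulmxA -[_ *m V *m _]mulmxA uV' mulmx1.
(* For this x, |a i| |x| <= |x A| <= |x B| + |x (A - B)| <= (|b i| + M) |x|. *)
set X := realify x.
have sX : 0 < sqn X.
  rewrite lt_neqAle sqn_ge0 andbT eq_sym; apply: contra x0 => /eqP X0.
  apply/eqP/rowP => j; have /matrixP h : X = 0 by apply/eqP; rewrite -sqn_eq0 X0.
  have := h 0 j; have := h 1 j; rewrite !mxE /= => h1 h2.
  by apply/eqP; rewrite eq_complex h1 h2 /= eqxx.
have nRe (u v : R[i]) : complex.Re `|u * v| = complex.Re `|u| * complex.Re `|v|.
  by rewrite normrM !normc_def /= mulr0 subr0.
have nR (t : R) : complex.Re `|t%:C| = `|t|.
  by rewrite normc_def /= expr0n addr0 sqrtr_sqr.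
have eXA : X *m A = realify ((y *m diag_mx (\row_i (a i)%:C)) *m U).
  by rewrite -xA realify_mul.
have eXB : X *m B = realify ((z *m diag_mx (\row_i (b i)%:C)) *m V).
  by rewrite -xB realify_mul.
have hA : `|a i| ^+ 2 * sqn X <= sqn (X *m A).
  rewrite eXA (sqn_realify_unitary _ uU) /X xy (sqn_realify_unitary _ uU) mulr_sumr.
  apply: ler_sum => j _; rewrite mul_mx_diag !mxE nRe nR exprMn mulrC.
  case: (ltnP j i.+1) => ji.
    rewrite ler_wpM2l ?sqr_ge0 // lerXn2r ?nnegrE //.
    by apply: sa; rewrite -ltnS.
  suff -> : \sum_(j0 < n) c 0 j0 * (pid_mx i.+1 : 'M[R[i]]_n) j0 j = 0.
    by rewrite normr0 /= expr0n /= !mul0r.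
  rewrite big1 // => l _; rewrite mxE; case: eqVneq => [->|]; last by rewrite mulr0.
  by rewrite ltnNge ji mulr0.
have hB : sqn (X *m B) <= `|b i| ^+ 2 * sqn X.
  rewrite eXB (sqn_realify_unitary _ uV) /X xz (sqn_realify_unitary _ uV) mulr_sumr.
  apply: ler_sum => j _; rewrite mul_mx_diag !mxE nRe nR exprMn mulrC.
  case: (leqP i j) => ij.
    by rewrite ler_wpM2r ?sqr_ge0 // lerXn2r ?nnegrE //; exact: sb.
  suff -> : \sum_(j0 < n) d 0 j0 * (copid_mx i : 'M[R[i]]_n) j0 j = 0.
    by rewrite normr0 /= expr0n /= !mulr0.
  rewrite big1 // => l _; rewrite !mxE; case: eqVneq => [->|lj].
    by rewrite eqxx ij subrr mulr0.
  have -> : (l == j :> nat) = false by apply/negbTE.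
  by rewrite subrr mulr0.
have hD : sqn (X *m (A - B)) <= M ^+ 2 * sqn X.
  by apply: opb_rows => //; rewrite linearB /= sA sB.
have eX : sqn X = Num.sqrt (sqn X) ^+ 2 by rewrite sqr_sqrtr // ltW.
have s0 : 0 < Num.sqrt (sqn X) by rewrite sqrtr_gt0.
have {}hB : sqn (X *m B) <= (`|b i| * Num.sqrt (sqn X)) ^+ 2 by rewrite exprMn -eX.
have {}hD : sqn (X *m (A - B)) <= (M * Num.sqrt (sqn X)) ^+ 2 by rewrite exprMn -eX.
have := frob_le _ _ hB hD => /(_ (mulr_ge0 (normr_ge0 _) (ltW s0)) (mulr_ge0 M0 (ltW s0))).
rewrite ler_norml => /andP[_ hBD].
have eAB : X *m A = X *m B + X *m (A - B) by rewrite -mulmxDr addrC subrK.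
have {}hA : (`|a i| * Num.sqrt (sqn X)) ^+ 2 <= ((`|b i| + M) * Num.sqrt (sqn X)) ^+ 2.
  rewrite exprMn -eX; apply: le_trans hA _; rewrite eAB sqnD mulr2n.
  apply: le_trans (lerD (lerD hB (lerD hBD hBD)) hD) _.
  by rewrite le_eqVlt; apply/orP; left; apply/eqP; ring.
move: hA; rewrite ler_pXn2r // ?nnegrE ?mulr_ge0 ?addr_ge0 ?(ltW s0) //.
by rewrite ler_pM2r.
Qed.

Lemma trace_pow_bound A B (mu : 'I_n -> R) (M : R) k T : (1 <= k <= n)%N ->
  A^T = A -> B^T = B -> opb A 1 -> opb (A - B) M -> (\rank B <= k)%N ->
  char_poly B = \prod_(i < n) ('X - (mu i)%:P) ->
  (forall i j : 'I_n, (i <= j)%N -> `|mu j| <= `|mu i|) ->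
  \tr (A ^+ (2 * T)) <=
    1 + \sum_(i < n | (1 <= i < k)%N) (Num.min 1 (`|mu i| + M)) ^+ (2 * T)
      + (n - k)%:R * M ^+ (2 * T).
Proof.
move=> /andP[k1 kn] sA sB A1 hM rB eB smu.
have [a ha sa] := spectral_form_sorted sA; have [b hb sb] := spectral_form_sorted sB.
have bmu := spectral_form_abs_uniq hb eB sb smu.
have s0 : (0 : 'M[R]_n)^T = 0 by rewrite linear0.
(* Weyl's inequality against the zero matrix turns ||A|| <= 1 into a bound 1 on every eigenvalue of
   [A]. *)
have h0 : spectral_form 0 (fun=> 0).
  exists 1%:M; first by apply/unitarymxP; rewrite trmx1 map_mx1 mulmx1.
  rewrite mulmx1 (_ : diag_mx _ = 0) ?mulmx0 ?map_mx0 //.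
  by apply/matrixP => i j; rewrite !mxE mul0rn.
have A10 : opb (A - 0) 1 by rewrite subr0.
have a1 i : `|a i| <= 1.
  by have := weyl s0 sA ha h0 sa (fun i j _ => lexx _) A10 i; rewrite normr0 add0r.
have aM i : `|a i| <= `|mu i| + M by rewrite -bmu; exact: (weyl sB sA ha hb sa sb hM).
have M0 := opb_ge0 hM.
(* Beyond the rank the eigenvalues of [B] vanish, so these eigenvalues of [A] are pure
   perturbation. *)
have aM' (i : 'I_n) : (k <= i)%N -> `|a i| <= M.
  move=> ki; have := weyl sB sA ha hb sa sb hM i.
  by rewrite (spectral_form_rank hb rB sb ki) normr0 add0r.
have ev i : a i ^+ (2 * T) = `|a i| ^+ (2 * T).
  by rewrite !exprM real_normK ?num_real.
rewrite (spectral_form_trace _ ha).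
rewrite (bigID (fun i : 'I_n => (i < k)%N)) /=; apply: lerD.
  have n0 : (0 < n)%N by apply: leq_trans kn.
  rewrite (bigD1 (Ordinal n0)) //=; apply: lerD.
    by rewrite ev exprn_ile1.
  rewrite (eq_bigl (fun i : 'I_n => (1 <= i < k)%N)); last first.
    by move=> i; rewrite andbC lt0n.
  apply: ler_sum => i _; rewrite ev lerXn2r ?nnegrE ?le_min ?ler01 ?addr_ge0 //.
  by rewrite a1 aM.
apply: le_trans (_ : \sum_(i < n | ~~ (i < k)%N) M ^+ (2 * T) <= _).
  by apply: ler_sum => i; rewrite -leqNgt => ki; rewrite ev lerXn2r ?nnegrE ?aM'.
rewrite -(big_mkord (fun i => ~~ (i < k)%N) (fun=> M ^+ (2 * T))).
rewrite (big_cat_nat (leq0n k) kn) /= big_nat_cond big_pred0 ?add0r; last first.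
  by move=> i; case: (i < k)%N; rewrite ?andbF.
rewrite big_nat_cond (eq_bigl (fun i => (k <= i < n)%N && true)); last first.
  by move=> i; rewrite -leqNgt; case: (k <= i)%N; rewrite ?andbT ?andbF.
by rewrite -big_nat_cond sumr_const_nat mulr_natl.
Qed.

End Spectral.

(** * Moment generating functions of squared sub-Gaussian variables *)

Section Moments.
Context {R : realType} {d : measure_display} {Omega : measurableType d}.
Variable P : probability Omega R.
Implicit Types (y Z : Omega -> R).
Local Open Scope ereal_scope.

Lemma integral_prob_cst (r : R) : \int[P]_w r%:E = r%:E.
Proof. by rewrite (integral_cst P measurableT r%:E) [X in _ * X]probability_setT mule1. Qed.

(** The term p = 2k of the supremum, raised to the power 2k. An infinite moment would make that term
    infinite. *)
Lemma psi2_moment y (kappa : R) k : (0 < k)%N -> psi2norm P y <= kappa%:E ->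
  \int[P]_w ((y w ^+ 2) ^+ k)%:E <= ((((2 * k)%:R * kappa ^+ 2) ^+ k)%R)%:E.
Proof.
move=> k0 hk; set p : R := (2 * k)%:R%R.
have p1 : (1 <= p)%R by rewrite ler1n muln_gt0.
have p0 : (0 < p)%R by apply: lt_le_trans p1.
have eI : \int[P]_w ((y w ^+ 2) ^+ k)%:E = \int[P]_w (`|y w| `^ p)%:E.
  apply: eq_integral => w _; congr EFin.
  by rewrite powR_mulrn // exprM real_normK ?num_real.
rewrite eI.
have h : (p `^ (- 2^-1))%:E * poweR (\int[P]_w (`|y w| `^ p)%:E) p^-1 <= kappa%:E.
  by apply: le_trans hk; apply: ereal_sup_ubound; exists p.
have I0 : 0 <= \int[P]_w (`|y w| `^ p)%:E.
  by apply: integral_ge0 => w _; rewrite lee_fin powR_ge0.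
have q0 : (0 < p `^ (- 2^-1))%R by rewrite powR_gt0.
move: (\int[P]_w _) I0 h => [r| |] //; last first.
  move=> _; rewrite poweRyr ?invr_eq0 ?gt_eqF // mulry gtr0_sg // mul1e.
  by rewrite leye_eq.
rewrite lee_fin poweR_EFin -EFinM !lee_fin => r0 h.
have hr : (r `^ p^-1 <= Num.sqrt p * kappa)%R.
  rewrite -(ler_pM2l q0); apply: le_trans h _.
  by rewrite mulrA powRN powR12_sqrt ?(ltW p0) // mulVf ?mul1r // gt_eqF // sqrtr_gt0.
have -> : r = ((r `^ p^-1) `^ p)%R.
  by rewrite -powRrM mulVf ?gt_eqF // powRr1.
apply: le_trans (_ : (Num.sqrt p * kappa) `^ p <= _)%R.
  apply: ge0_ler_powR; rewrite ?nnegrE ?powR_ge0 ?(ltW p0) //.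
  by apply: le_trans hr; exact: powR_ge0.
rewrite /p powR_mulrn; last by apply: le_trans hr; exact: powR_ge0.
by rewrite exprM [((Num.sqrt _ * _) ^+ 2)%R]exprMn sqr_sqrtr ?ler0n.
Qed.

Lemma expR_nneseries (z : R) : (0 <= z)%R ->
  (expR z)%:E = \sum_(0 <= k <oo) (z ^+ k / k`!%:R)%:E.
Proof.
move=> z0; rewrite /expR -EFin_lim; last exact: is_cvg_series_exp_coeff.
by congr (limn _); apply/funext => n /=; rewrite /series /= -sumEFin.
Qed.

(** k^k / k! is one term of the power series of exp k. *)
Lemma expn_le_fact (k : nat) : (k%:R ^+ k / k`!%:R <= expR 1 ^+ k :> R)%R.
Proof.
rewrite -expRM_natl mulr1; case: k => [|k]; first by rewrite expr0 fact0 divr1 expR0.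
apply: le_trans (expR_ge1Dxn k (ler0n _ _)).
by rewrite lerDr.
Qed.

(** Integrate the power series termwise. With kappa the psi_2 norm and g = c0/(4e), the moments (2k
    kappa^2)^k and k^k / k! <= e^k bound the k-th term by (2 g e kappa^2 / v)^k = (c0 kappa^2 /
    (2v))^k <= 2^(-k); the rate g is chosen for this, and the sum is 2. *)
Lemma psi2_exp_moment y (c0 v : R) : measurable_fun setT y -> (0 < c0)%R -> (0 < v)%R ->
  psi2norm P y < +oo -> c0%:E * psi2norm P y * psi2norm P y <= v%:E ->
  \int[P]_w (expR (c0 / (4 * expR 1) * (y w ^+ 2 / v)))%:E <= 2%:E.
Proof.
move=> my c00 v0 yfin hv.
have ps0 : 0 <= psi2norm P y.
  apply: le_trans (_ : (1 `^ (- 2^-1))%:E * poweR (\int[P]_w (`|y w| `^ 1)%:E) 1^-1 <= _).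
    by rewrite mule_ge0 ?lee_fin ?powR_ge0 // poweR_ge0.
  by apply: ereal_sup_ubound; exists 1%R => //=.
have [kappa ek k0] : exists2 kappa : R, psi2norm P y = kappa%:E & (0 <= kappa)%R.
  exists (fine (psi2norm P y)); last exact: fine_ge0.
  by rewrite fineK // ge0_fin_numE.
rewrite ek -!EFinM lee_fin in hv.
set g : R := (c0 / (4 * expR 1))%R.
have g0 : (0 < g)%R by rewrite divr_gt0 // mulr_gt0 // expR_gt0.
have z0 w : (0 <= g * (y w ^+ 2 / v))%R.
  by rewrite mulr_ge0 ?(ltW g0) // divr_ge0 ?sqr_ge0 // ltW.
under eq_integral do rewrite expR_nneseries //.
rewrite integral_nneseries //; last 2 first.
- move=> n; apply/measurable_EFinP; apply: measurable_funM; last exact: measurable_cst.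
  apply: measurable_funX; apply: measurable_funM; first exact: measurable_cst.
  apply: measurable_funM; last exact: measurable_cst.
  exact: measurable_funX.
- by move=> n w _; rewrite lee_fin divr_ge0 // exprn_ge0.
have term k : \int[P]_w ((g * (y w ^+ 2 / v)) ^+ k / k`!%:R)%:E <= ((2^-1 ^+ k)%R)%:E.
  have e w : (((g * (y w ^+ 2 / v)) ^+ k / k`!%:R)%:E =
     ((g / v) ^+ k / k`!%:R)%:E * ((y w ^+ 2) ^+ k)%:E).
    rewrite -EFinM; congr EFin.
    have -> : (g * (y w ^+ 2 / v) = g / v * y w ^+ 2)%R by ring.
    by rewrite [((g / v * _) ^+ k)%R]exprMn mulrAC.
  under eq_integral do rewrite e.
  have c_ge0 : (0 <= (g / v) ^+ k / k`!%:R)%R.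
    by rewrite divr_ge0 // exprn_ge0 // divr_ge0 ?ltW.
  rewrite ge0_integralZl_EFin //; last 2 first.
  - by move=> w _; rewrite lee_fin exprn_ge0 // sqr_ge0.
  - by apply/measurable_EFinP; do 2!apply: measurable_funX.
  have [->|kp] := posnP k.
    under eq_integral do rewrite expr0.
    by rewrite integral_prob_cst mule1 lee_fin !expr0 fact0 divr1.
  apply: le_trans (lee_pmul _ _ (lexx _) (psi2_moment kp _)) _; rewrite ?lee_fin //.
    by apply: integral_ge0 => w _; rewrite lee_fin exprn_ge0 // sqr_ge0.
    by rewrite ek.
  have -> : ((g / v) ^+ k / k`!%:R * ((2 * k)%:R * kappa ^+ 2) ^+ k =
      (2 * g * kappa ^+ 2 / v) ^+ k * (k%:R ^+ k / k`!%:R))%R.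
    rewrite natrM.
    have -> : (2 * g * kappa ^+ 2 / v = (g / v) * (2 * kappa ^+ 2))%R by ring.
    have -> : (2 * k%:R * kappa ^+ 2 = 2 * kappa ^+ 2 * k%:R :> R)%R by ring.
    by rewrite [((_ * k%:R) ^+ k)%R]exprMn [((g / v * _) ^+ k)%R]exprMn; ring.
  have b0 : (0 <= 2 * g * kappa ^+ 2 / v)%R.
    by rewrite divr_ge0 ?(ltW v0) // !mulr_ge0 ?sqr_ge0 // ltW.
  apply: le_trans (ler_wpM2l (exprn_ge0 _ b0) (expn_le_fact k)) _.
  rewrite -exprMn; apply: lerXn2r; rewrite ?nnegrE //.
    by rewrite mulr_ge0 // expR_ge0.
  have -> : (2 * g * kappa ^+ 2 / v * expR 1 = c0 * kappa * kappa / v / 2)%R.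
    by rewrite /g; field; rewrite !gt_eqF ?expR_gt0.
  by rewrite ler_pdivrMr // mulVf // ler_pdivrMr // mul1r.
apply: le_trans (lee_nneseries _ (fun k _ => term k)) _.
  move=> k _ _; apply: integral_ge0 => w _.
  by rewrite lee_fin divr_ge0 // exprn_ge0.
apply: lime_le.
  by apply: is_cvg_nneseries => k _ _; rewrite lee_fin exprn_ge0 // invr_ge0.
apply: nearW => n; rewrite sumEFin lee_fin.
suff -> : (\sum_(0 <= i < n) 2^-1 ^+ i = 2 - 2 * 2^-1 ^+ n :> R)%R.
  by rewrite gerBl mulr_ge0 // exprn_ge0 // invr_ge0.
elim: n => [|n IH]; first by rewrite big_geq // expr0 mulr1 subrr.
by rewrite big_nat_recr //= IH exprSr; field.
Qed.

(** For x >= 0, exp x <= 1 + x exp x is applied twice. For x < 0, exp x <= 1/(1 - x) already gives 1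
    + x + x^2. *)
Lemma expR_le_quadratic (x : R) : (expR x <= 1 + x + x ^+ 2 * expR `|x|)%R.
Proof.
have [x0|x0] := leP 0%R x.
  rewrite ger0_norm //.
  have h : (expR x <= 1 + x * expR x)%R.
    have := expR_ge1Dx (- x)%R => h.
    have : ((1 - x) * expR x <= expR (- x) * expR x)%R by rewrite ler_wpM2r ?expR_ge0.
    rewrite -expRD addNr expR0 mulrBl mul1r; lra.
  have : (x * expR x <= x * (1 + x * expR x))%R by rewrite ler_wpM2l.
  by rewrite mulrDr mulr1 mulrA -expr2; lra.
rewrite ltr0_norm //.
have t0 : (0 < - x)%R by rewrite oppr_gt0.
have h : (expR x <= 1 + x + x ^+ 2)%R.
  have e : (expR x * expR (- x) = 1)%R by rewrite -expRD subrr expR0.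
  have h1 := expR_ge1Dx (- x)%R.
  have h2 : (expR x * (1 - x) <= 1)%R.
    by apply: le_trans (_ : expR x * expR (- x) <= 1)%R; [rewrite ler_wpM2l ?expR_ge0|rewrite e].
  have p : (0 < 1 - x)%R by lra.
  rewrite -(ler_pM2r p); apply: le_trans h2 _.
  have -> : ((1 + x + x ^+ 2) * (1 - x) = 1 + x ^+ 2 * - x)%R by ring.
  by rewrite lerDl; apply: mulr_ge0; [exact: sqr_ge0|exact: ltW].
apply: le_trans h _; rewrite lerD2l ler_peMr ?sqr_ge0 //.
by rewrite -expR0 ler_expR ltW.
Qed.

(** Centering removes the linear term of [expR_le_quadratic]. With t = eta |Z|, half of the exponent
    t absorbs the square through t^2 <= 8 exp(t/2), the source of the 8, and the other half absorbs
    exp(|l Z|), as |l| <= eta/2. *)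
Lemma subexp_mgf Z (eta K l : R) : measurable_fun setT Z -> (0 < eta)%R ->
  P.-integrable setT (EFin \o Z) -> \int[P]_w (Z w)%:E = 0 ->
  \int[P]_w (expR (eta * `|Z w|))%:E <= K%:E -> (`|l| <= eta / 2)%R ->
  \int[P]_w (expR (l * Z w))%:E <= (expR (8 * K / eta ^+ 2 * l ^+ 2))%:E.
Proof.
move=> mZ eta0 iZ Z0 hK hl.
pose b : R := (8 / eta ^+ 2 * l ^+ 2)%R.
have b0 : (0 <= b)%R by rewrite mulr_ge0 ?sqr_ge0 // divr_ge0 // sqr_ge0.
pose G w : R := expR (eta * `|Z w|)%R.
have mG : measurable_fun setT G.
  rewrite /G; apply: measurableT_comp; first exact: measurable_expR.
  apply: measurable_funM; first exact: measurable_cst.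
  apply: measurableT_comp => //; exact: normr_measurable.
have pt w : (expR (l * Z w) <= 1 + l * Z w + b * G w)%R.
  apply: le_trans (expR_le_quadratic _) _; rewrite lerD2l /b /G.
  set t := (eta * `|Z w|)%R.
  have t0 : (0 <= t)%R by rewrite mulr_ge0 // ltW.
  have ht : (`|l * Z w| <= t / 2)%R.
    by rewrite normrM /t mulrAC ler_wpM2r.
  have t2 : (t ^+ 2 <= 8 * expR (t / 2))%R.
    have := @expR_ge1Dxn R (t / 2) 1 => /(_ (divr_ge0 t0 (ler0n _ 2))).
    have -> : ((2`!)%:R = 2 :> R)%R by [].
    have -> : ((t / 2) ^+ 2 / 2 = t ^+ 2 / 8 :> R)%R by field.
    lra.
  have -> : ((l * Z w) ^+ 2 = l ^+ 2 / eta ^+ 2 * t ^+ 2)%R.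
    by rewrite /t !exprMn real_normK ?num_real //; field; rewrite gt_eqF.
  have -> : (8 / eta ^+ 2 * l ^+ 2 * expR t = l ^+ 2 / eta ^+ 2 * (8 * expR (t / 2) * expR (t / 2)))%R.
    have -> : (expR t = expR (t / 2) * expR (t / 2))%R.
      by rewrite -expRD; congr expR; field.
    ring.
  rewrite -(mulrA (l ^+ 2 / eta ^+ 2)%R) ler_wpM2l // ?divr_ge0 ?sqr_ge0 //.
  by rewrite ler_pM ?sqr_ge0 ?expR_ge0 // ler_expR.
have GK : \int[P]_w (G w)%:E <= K%:E by [].
have G0 w : (0 <= G w)%R by exact: expR_ge0.
have K0 : (0 <= K)%R.
  by rewrite -lee_fin; apply: le_trans GK; apply: integral_ge0 => w _; rewrite lee_fin.
have iG : P.-integrable setT (EFin \o G).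
  apply/integrableP; split; first exact/measurable_EFinP.
  rewrite (eq_integral (fun w => (G w)%:E)); last by move=> w _ /=; rewrite ger0_norm.
  by apply: le_lt_trans GK _; rewrite ltry.
have i1 : P.-integrable setT (fun=> 1%:E : \bar R).
  exact: finite_measure_integrable_cst.
have ilZ : P.-integrable setT (EFin \o (fun w => l * Z w)%R).
  have := integrableZl measurableT l iZ.
  by apply: eq_integrable.
have ibG : P.-integrable setT (EFin \o (fun w => b * G w)%R).
  have := integrableZl measurableT b iG.
  by apply: eq_integrable.
apply: le_trans (_ : \int[P]_w (1%:E + (l * Z w)%:E + (b * G w)%:E) <= _).
  apply: ge0_le_integral => //.
  - apply/measurable_EFinP; apply: measurableT_comp; first exact: measurable_expR.
    by apply: measurable_funM => //; exact: measurable_cst.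
  - apply: emeasurable_funD; last exact: (measurable_int _ ibG).
    by apply: emeasurable_funD => //; exact: (measurable_int _ ilZ).
  - by move=> w _; rewrite -!EFinD lee_fin pt.
rewrite integralD //; last exact: (integrableD measurableT i1 ilZ).
rewrite integralD // integral_prob_cst.
have -> : \int[P]_w (l * Z w)%:E = 0.
  under eq_integral do rewrite EFinM.
  by rewrite integralZl // Z0 mule0.
have -> : \int[P]_w (b * G w)%:E = b%:E * \int[P]_w (G w)%:E.
  under eq_integral do rewrite EFinM.
  by rewrite integralZl.
rewrite adde0; apply: le_trans (_ : (1 + b * K)%:E <= _).
  by rewrite EFinD; apply: leeD2l; rewrite (EFinM b K); apply: lee_wpmul2l; rewrite ?lee_fin.
rewrite lee_fin; apply: le_trans (expR_ge1Dx _) _.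
by rewrite le_eqVlt; apply/orP; left; apply/eqP; congr expR; rewrite /b; ring.
Qed.

End Moments.

(** * Integrals of products of independent functions *)

Section Independence.
Context {R : realType} {d : measure_display} {Omega : measurableType d}.
Variable P : probability Omega R.
Local Open Scope ereal_scope.
Import HBNNSimple.

Lemma g_sigma_sub (G : set (set Omega)) : G `<=` measurable -> <<s G >> `<=` measurable.
Proof. by move=> GM; apply: smallest_sub => //; exact: sigma_algebra_measurable. Qed.

Lemma g_sigma_measurable_fun (G : set (set Omega)) (f : g_sigma_algebraType G -> R) :
  G `<=` measurable -> measurable_fun setT f -> measurable_fun setT (f : Omega -> R).
Proof. by move=> GM mf _ B mB; apply: (g_sigma_sub GM); exact: mf. Qed.

Lemma integral_nnsfun_mul (G : set (set Omega)) (g : {nnsfun g_sigma_algebraType G >-> R})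
    (h : Omega -> R) : G `<=` measurable -> measurable_fun setT h -> (forall w, 0 <= h w)%R ->
  \int[P]_w (g w * h w)%:E =
  \sum_(y \in range g) (y%:E * \int[P]_(w in g @^-1` [set y]) (h w)%:E).
Proof.
move=> GM mh h0.
have mg y : measurable (g @^-1` [set y] : set Omega).
  by apply: (g_sigma_sub GM); exact: (measurable_funPTI g (measurable_set1 y)).
transitivity (\int[P]_w \sum_(y \in range g) (y%:E * (\1_(g @^-1` [set y]) w)%:E * (h w)%:E)).
  apply: eq_integral => w _; rewrite EFinM [in LHS]fimfunE -fsumEFin //.
  rewrite ge0_mule_fsuml; last by move=> y; exact: nnfun_muleindic_ge0.
  by apply: eq_fsbigr => y _; rewrite EFinM.
rewrite ge0_integral_fsum //; last 2 first.
- move=> y; apply: emeasurable_funM; last exact/measurable_EFinP.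
  by apply/measurable_EFinP; apply: measurable_funM => //; exact: measurable_indic.
- by move=> y w _; rewrite mule_ge0 ?lee_fin //; exact: nnfun_muleindic_ge0.
apply: eq_fsbigr => y; rewrite inE => -[w0 _ <-].
under eq_integral do rewrite -muleA.
rewrite ge0_integralZl_EFin //; last 2 first.
- by move=> w _; rewrite mule_ge0 ?lee_fin.
- apply: emeasurable_funM; apply/measurable_EFinP => //; exact: measurable_indic.
congr (_ * _); rewrite [RHS]integral_mkcond; apply: eq_integral => w _.
by rewrite epatch_indic /= muleC.
Qed.

(* Approximate f from below by simple functions. *)
Lemma integral_mul_indep (G : set (set Omega)) (f : g_sigma_algebraType G -> R)
    (h : Omega -> R) (c : R) :
  G `<=` measurable -> measurable_fun setT f -> (forall w, 0 <= f w)%R ->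
  measurable_fun setT h -> (forall w, 0 <= h w)%R -> (0 <= c)%R ->
  (forall E, <<s G >> E -> \int[P]_(w in E) (h w)%:E = c%:E * P E) ->
  \int[P]_w (f w * h w)%:E = c%:E * \int[P]_w (f w)%:E.
Proof.
move=> GM mf f0 mh h0 c0 hE.
have mfE : measurable_fun setT (EFin \o f) by exact/measurable_EFinP.
pose a := nnsfun_approx measurableT mfE.
have fE0 (w : g_sigma_algebraType G) : setT w -> 0 <= (EFin \o f) w by rewrite lee_fin.
have acv w : EFin \o a^~ w @ \oo --> (f w)%:E.
  exact: (@cvg_nnsfun_approx _ _ _ _ measurableT _ mfE fE0 w).
have am n : measurable_fun setT (a n : Omega -> R).
  by apply: g_sigma_measurable_fun => //; exact: measurable_funP.
have nda w : {homo (a^~ w) : m n / (m <= n)%N >-> (m <= n)%R}.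
  by move=> m n mn; exact: (lefP _ _ (nd_nnsfun_approx measurableT mfE mn) w).
have lim_int (k : Omega -> R) : measurable_fun setT k -> (forall w, 0 <= k w)%R ->
  \int[P]_w (f w * k w)%:E = limn (fun n => \int[P]_w (a n w * k w)%:E).
  move=> mk k0; rewrite -monotone_convergence //.
  - apply: eq_integral => w _; apply/esym/cvg_lim => //.
    rewrite EFinM; under eq_fun do rewrite EFinM.
    by apply: cvgeZr => //; exact: acv.
  - by move=> n; apply/measurable_EFinP; apply: measurable_funM.
  - by move=> n w _; rewrite lee_fin mulr_ge0.
  - by move=> w _ m n mn; rewrite lee_fin ler_wpM2r // nda.
have e1 : \int[P]_w (f w)%:E = \int[P]_w (f w * 1)%:E.
  by apply: eq_integral => w _; rewrite mulr1.
have m1 : measurable_fun setT (fun _ : Omega => 1%R : R) by exact: measurable_cst.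
have e2 := lim_int _ m1 (fun=> ler01).
rewrite e1 e2 (lim_int _ mh h0).
have step n : \int[P]_w (a n w * h w)%:E = c%:E * \int[P]_w (a n w * 1)%:E.
  rewrite (integral_nnsfun_mul _ GM mh h0) (integral_nnsfun_mul _ GM m1 (fun=> ler01)).
  have mn y : <<s G >> (a n @^-1` [set y]).
    exact: (measurable_funPTI (a n) (measurable_set1 y)).
  rewrite ge0_mule_fsumr; last first.
    move=> y; have [y0|y0] := leP 0%R y.
      by rewrite mule_ge0 ?lee_fin //; apply: integral_ge0 => w _; rewrite lee_fin.
    (* A negative level is never attained, because [a n] is nonnegative. *)
    rewrite (_ : a n @^-1` [set y] = set0) ?integral_set0 ?mule0 //.
    apply/seteqP; split => w //= e; move: y0; rewrite -e ltNge => /negP; apply.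
    exact: fun_ge0.
  apply: eq_fsbigr => y _; rewrite hE // muleCA; congr (_ * (_ * _)).
  by rewrite (integral_cst P (g_sigma_sub GM (mn y)) 1%:E) mul1e.
under eq_fun do rewrite step.
apply/cvg_lim => //; apply: cvgeZl => //.
apply: ereal_nondecreasing_is_cvgn => m n mn; apply: ge0_le_integral => //.
- by move=> w _; rewrite lee_fin mulr_ge0.
- by apply/measurable_EFinP; exact: measurable_funM.
- by apply/measurable_EFinP; exact: measurable_funM.
- by move=> w _; rewrite lee_fin ler_wpM2r // nda.
Qed.

(* Indicators are replaced by general functions one factor at a time. *)
Lemma integral_prod_indep (I : finType) (G : I -> set (set Omega))
    (f : forall i, g_sigma_algebraType (G i) -> R) (e : I -> R) :
  (forall i, G i `<=` measurable) -> (forall i, measurable_fun setT (f i)) ->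
  (forall i w, 0 <= f i w)%R ->
  mutual_indep P predT (fun i => <<s G i >>) ->
  (forall i, \int[P]_w (f i w)%:E = (e i)%:E) ->
  \int[P]_w (\prod_i f i w)%:E = (\prod_i e i)%:E.
Proof.
move=> GM mf f0 ind fe.
have meas i (phi : g_sigma_algebraType (G i) -> R) : measurable_fun setT phi ->
    measurable_fun setT (phi : Omega -> R) by exact: g_sigma_measurable_fun.
(* [l] lists the indices whose factor may be arbitrary; the others carry indicators. For empty [l]
   this is the independence hypothesis. To add j, replace its factor by the indicator of any E in
   [<<s G j >>]: the induction hypothesis then gives exactly what [integral_mul_indep] asks of the
   remaining product. *)
suff gen (l : seq I) : forall (phi : forall i, g_sigma_algebraType (G i) -> R) (c : I -> R),
   (forall i, measurable_fun setT (phi i)) -> (forall i w, 0 <= phi i w)%R ->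
   (forall i, i \notin l -> exists2 E, <<s G i >> E & phi i = \1_E) ->
   (forall i, \int[P]_w (phi i w)%:E = (c i)%:E) ->
   \int[P]_w (\prod_i phi i w)%:E = (\prod_i c i)%:E.
  apply: (gen (index_enum I) f e) => // i.
  by rewrite mem_index_enum.
elim: l => [|j l IH] phi c mphi phi0 hphi hc.
  have /choice [E hE] : forall i, exists E, <<s G i >> E /\ phi i = \1_E.
    by move=> i; have [E ? ?] := hphi i isT; exists E.
  have mE i : measurable (E i) by apply: (g_sigma_sub (GM i)); case: (hE i).
  transitivity (P (\big[setI/setT]_(i in [set: I]%SET) E i)).
    have mI : measurable (\big[setI/setT]_(i in [set: I]%SET) E i).
      by apply: big_ind => //; exact: measurableI.
    rewrite -[X in _ = P X]setIT -integral_indic //.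
    apply: eq_integral => w _; congr EFin.
    rewrite (eq_bigr (fun i => \1_(E i) w)); last by move=> i _; have [_ ->] := hE i.
    have -> : \big[setI/setT]_(i in [set: I]%SET) E i = \big[setI/setT]_i E i.
      by apply: eq_bigl => i; rewrite finset.in_setT.
    elim: (index_enum I) => [|i s IHs]; first by rewrite !big_nil indicT.
    by rewrite !big_cons IHs indicI.
  rewrite ind; last 2 first.
  - by apply/fintype.subsetP => i.
  - by move=> i _; case: (hE i).
  transitivity (\prod_i P (E i)); first by apply: eq_bigl => i; rewrite finset.in_setT.
  rewrite -prodEFin; apply: eq_bigr => i _; rewrite -hc -[X in P X = _]setIT -integral_indic //.
  by apply: eq_integral => w _; have [_ ->] := hE i.
pose h (w : Omega) := (\prod_(i | i != j) phi i w)%R.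
have h0 w : (0 <= h w)%R by apply: prodr_ge0 => i _.
have mh : measurable_fun setT h.
  rewrite /h (_ : (fun _ => _) = fun w => (\prod_(i <- [seq i <- index_enum I | i != j]) phi i w)%R).
    by apply: measurable_prod => i _; exact: meas.
  by apply/funext => w; rewrite big_filter.
have c0 i : (0 <= c i)%R.
  by rewrite -lee_fin -hc; apply: integral_ge0 => w _; rewrite lee_fin.
pose k := (\prod_(i | i != j) c i)%R.
have k0 : (0 <= k)%R by apply: prodr_ge0 => i _.
have hE E : <<s G j >> E -> \int[P]_(w in E) (h w)%:E = k%:E * P E.
  move=> GE; have mE := g_sigma_sub (GM j) GE.
  pose phi' i : g_sigma_algebraType (G i) -> R :=
    if i == j then \1_E else phi i.
  pose c' i := if i == j then fine (P E) else c i.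
  have Pf : (fine (P E))%:E = P E by rewrite fineK // fin_num_measure.
  have ec : (\prod_i c' i = fine (P E) * k)%R.
    rewrite (bigD1 j) //= /c' eqxx; congr (_ * _)%R.
    by apply: eq_bigr => i /negPf ->.
  have ep w : (\prod_i phi' i w = \1_E w * h w)%R.
    rewrite (bigD1 j) //= /phi' eqxx; congr (_ * _)%R.
    by apply: eq_bigr => i /negPf ->.
  have := IH phi' c'; rewrite ec EFinM Pf muleC => <-.
  - rewrite integral_mkcond; apply: eq_integral => w _.
    by rewrite epatch_indic /= -EFinM ep mulrC.
  - move=> i; rewrite /phi'; case: eqVneq => [->|//].
    exact: measurable_indic.
  - by move=> i w; rewrite /phi'; case: eqVneq.
  - move=> i il; rewrite /phi'; case: eqVneq => [->|ij]; first by exists E.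
    by apply: hphi; rewrite inE negb_or ij.
  - move=> i; rewrite /phi' /c'; case: eqVneq => [_|//].
    by rewrite integral_indic // setIT.
transitivity (\int[P]_w (phi j w * h w)%:E).
  by apply: eq_integral => w _; rewrite (bigD1 j).
rewrite (@integral_mul_indep (G j) (phi j) h k) // hc -EFinM; congr EFin.
by rewrite [RHS](bigD1 j) //= mulrC.
Qed.

End Independence.

(** * Deviation of empirical averages *)

Section ConvexExp.
Context {R : realType}.

(** A tangent line inequality in the variable u^2. With h = u - v the claim is 1 + h + h^2/(2v) <=
    exp h; the bound v >= 2, source of the shift 4 below, makes the left side at most (1 + h/2)^2 <=
    exp h. When 1 + h/2 < 0, u >= 2 makes the left side nonpositive. *)
Lemma expR_sqrt_tangent (u v : R) : 2 <= u -> 2 <= v ->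
  expR v * (1 + (u ^+ 2 - v ^+ 2) / (2 * v)) <= expR u.
Proof.
move=> u2 v2; have v0 : 0 < v by lra.
have -> : u = v + (u - v) by ring.
set h := u - v; rewrite expRD ler_wpM2l ?expR_ge0 //.
have -> : ((v + h) ^+ 2 - v ^+ 2) / (2 * v) = h + h ^+ 2 / (2 * v).
  by field; rewrite gt_eqF.
have hv : h ^+ 2 / (2 * v) <= h ^+ 2 / 4.
  rewrite ler_wpM2l ?sqr_ge0 // lef_pV2 ?posrE //; last by rewrite mulr_gt0.
  by lra.
have [h1|h1] := leP 0 (1 + h / 2).
  apply: le_trans (_ : (1 + h / 2) ^+ 2 <= _).
    by move: hv; rewrite expr2; lra.
  have -> : expR h = expR (h / 2) ^+ 2.
    by rewrite -expRM_natl; congr expR; field.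
  by rewrite lerXn2r ?nnegrE ?expR_ge0 ?expR_ge1Dx.
apply: le_trans (expR_ge0 _).
have hu : 2 - h <= v by rewrite /h; lra.
have : h ^+ 2 / (2 * v) <= h ^+ 2 / (2 * (2 - h)).
  rewrite ler_wpM2l ?sqr_ge0 // lef_pV2 ?posrE ?mulr_gt0 //; first by lra.
  by lra.
have : h ^+ 2 / (2 * (2 - h)) <= - (1 + h).
  rewrite ler_pdivrMr ?mulr_gt0 //; last by lra.
  by nra.
lra.
Qed.

(* t |-> exp (sqrt (4 + t)) is convex, although t |-> exp (sqrt t) is not. *)
Lemma expR_sqrt_jensen (Q : finType) (w x : Q -> R) : (forall q, 0 <= w q) ->
  \sum_q w q = 1 -> (forall q, 0 <= x q) ->
  expR (Num.sqrt (4 + \sum_q w q * x q)) <= \sum_q w q * expR (Num.sqrt (4 + x q)).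
Proof.
move=> w0 w1 x0; set m := \sum_q w q * x q.
have s2 (t : R) : 0 <= t -> 2 <= Num.sqrt (4 + t).
  move=> t0; rewrite -[2](@ger0_norm R) // -sqrtr_sqr ler_wsqrtr //.
  by rewrite expr2; lra.
have m0 : 0 <= m by apply: sumr_ge0 => q _; rewrite mulr_ge0.
set v := Num.sqrt (4 + m).
have v2 : v ^+ 2 = 4 + m by rewrite sqr_sqrtr // addr_ge0.
apply: le_trans (_ : \sum_q w q * (expR v * (1 + (x q - m) / (2 * v))) <= _).
  have -> : \sum_q w q * (expR v * (1 + (x q - m) / (2 * v))) =
     expR v * (\sum_q w q) + expR v / (2 * v) * (\sum_q w q * x q - m * \sum_q w q).
    rewrite mulr_sumr mulr_sumr -sumrB mulr_sumr -big_split /=; apply: eq_bigr => q _.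
    have := s2 _ m0; rewrite -/v => v2'.
    by field; lra.
  by rewrite w1 -/m !mulr1 subrr mulr0 addr0.
apply: ler_sum => q _; rewrite ler_wpM2l //.
have := expR_sqrt_tangent (s2 _ (x0 q)) (s2 _ m0); rewrite -/v v2 sqr_sqrtr ?addr_ge0 //.
by rewrite opprD addrACA subrr add0r.
Qed.

Lemma expR_sqrt_le (t : R) :
  expR (Num.sqrt (4 + t ^+ 2)) <= expR 2 * (expR t + expR (- t)).
Proof.
apply: le_trans (_ : expR (2 + `|t|) <= _).
  rewrite ler_expR -[2 + `|t|](@ger0_norm R) ?addr_ge0 // -sqrtr_sqr ler_wsqrtr //.
  rewrite sqrrD -[`|t| ^+ 2]normrX (ger0_norm (sqr_ge0 t)).
  have := normr_ge0 t; rewrite expr2 mulr2n; lra.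
rewrite expRD ler_wpM2l ?expR_ge0 //.
have [t0|t0] := leP 0 t; first by rewrite ger0_norm // lerDl expR_ge0.
by rewrite ltr0_norm // lerDr expR_ge0.
Qed.

End ConvexExp.

Section Deviation.
Context {R : realType} {d : measure_display} {Omega : measurableType d}.
Variable P : probability Omega R.
Local Open Scope ereal_scope.

(** The term 8K comes from [subexp_mgf]. The 12 makes the constant times eta^2 at least 12, so that
    the Chernoff parameter of [deviation] stays in the admissible range. *)
Definition dev_const (eta K : R) : R := ((8 * K + 12) / eta ^+ 2)%R.

Lemma average_mgf (s : nat) (G : 'I_s -> set (set Omega))
    (Z : forall i, g_sigma_algebraType (G i) -> R) (eta K l : R) :
  (0 < s)%N -> (forall i, G i `<=` measurable) ->
  mutual_indep P predT (fun i => <<s G i >>) ->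
  (forall i, measurable_fun setT (Z i)) -> (0 < eta)%R -> (0 <= K)%R ->
  (forall i, P.-integrable setT (EFin \o (Z i : Omega -> R))) ->
  (forall i, \int[P]_w (Z i w)%:E = 0) ->
  (forall i, \int[P]_w (expR (eta * `|Z i w|))%:E <= K%:E) ->
  (`|l / s%:R| <= eta / 2)%R ->
  \int[P]_w (expR (l * (s%:R^-1 * \sum_i Z i w)))%:E <=
    (expR (dev_const eta K * l ^+ 2 / s%:R))%:E.
Proof.
move=> s0 GM ind mZ eta0 K0 iZ Z0 hK hl.
have sp : (0 < s%:R :> R)%R by rewrite ltr0n.
pose f i (w : g_sigma_algebraType (G i)) : R := expR (l / s%:R * Z i w).
have mf i : measurable_fun setT (f i).
  rewrite /f; apply: measurableT_comp; first exact: measurable_expR.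
  by apply: measurable_funM => //; exact: measurable_cst.
pose b := (8 * K / eta ^+ 2 * (l / s%:R) ^+ 2)%R.
have bd i : \int[P]_w (f i w)%:E <= (expR b)%:E.
  by apply: subexp_mgf => //; exact: g_sigma_measurable_fun.
have f0 i w : (0 <= f i w)%R by exact: expR_ge0.
have I0 i : 0 <= \int[P]_w (f i w)%:E by apply: integral_ge0 => w _; rewrite lee_fin.
pose e i := fine (\int[P]_w (f i w)%:E).
have he i : \int[P]_w (f i w)%:E = (e i)%:E.
  by rewrite fineK // ge0_fin_numE //; apply: le_lt_trans (bd i) _; rewrite ltry.
have -> : \int[P]_w (expR (l * (s%:R^-1 * \sum_i Z i w)))%:E = \int[P]_w (\prod_i f i w)%:E.
  apply: eq_integral => w _; congr EFin; rewrite /f -expR_sum; congr expR.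
  by rewrite mulrA mulr_sumr.
rewrite (integral_prod_indep GM mf f0 ind he) lee_fin.
apply: le_trans (_ : \prod_(i < s) expR b <= _)%R.
  apply: ler_prod => i _; rewrite -!lee_fin -he I0 /=.
  exact: bd.
rewrite prodr_const card_ord -expRM_natl ler_expR /b /dev_const.
have -> : (s%:R * (8 * K / eta ^+ 2 * (l / s%:R) ^+ 2) = 8 * K / eta ^+ 2 * (l ^+ 2 / s%:R))%R.
  by field; rewrite !gt_eqF.
rewrite -[(_ * l ^+ 2 / _)%R]mulrA ler_wpM2r //.
  by rewrite divr_ge0 ?sqr_ge0 // ltW.
by rewrite ler_wpM2r ?invr_ge0 ?sqr_ge0 // lerDl.
Qed.

Lemma deviation (Q : finType) (s : nat) (G : 'I_s -> set (set Omega))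
    (Z : forall i, Q -> g_sigma_algebraType (G i) -> R) (eta K : R) (wt : Q -> R) :
  (4 <= s)%N -> (forall i, G i `<=` measurable) ->
  mutual_indep P predT (fun i => <<s G i >>) ->
  (forall i q, measurable_fun setT (Z i q)) -> (0 < eta)%R -> (0 <= K)%R ->
  (forall i q, P.-integrable setT (EFin \o (Z i q : Omega -> R))) ->
  (forall i q, \int[P]_w (Z i q w)%:E = 0) ->
  (forall i q, \int[P]_w (expR (eta * `|Z i q w|))%:E <= K%:E) ->
  (forall q, 0 <= wt q)%R ->
  P [set w | ((\sum_q wt q) * (12 * dev_const eta K * (ln s%:R / s%:R)) <
              \sum_q wt q * (s%:R^-1 * \sum_i Z i q w) ^+ 2)%R] <= (2 / s%:R)%:E.
Proof.
move=> s4 GM ind mZ eta0 K0 iZ Z0 hK wt0.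
have s0 : (0 < s)%N by apply: leq_trans s4.
have sp : (0 < s%:R :> R)%R by rewrite ltr0n.
set W := (\sum_q wt q)%R; set k := dev_const eta K.
pose D q w := (s%:R^-1 * \sum_i Z i q w)%R.
have mD q : measurable_fun setT (D q).
  apply: measurable_funM; first exact: measurable_cst.
  by apply: measurable_sum => i; exact: g_sigma_measurable_fun.
set Ev := [set w | _].
have mEv : measurable Ev.
  rewrite -[Ev]setTI.
  have -> : Ev = (fun w => W * (12 * k * (ln s%:R / s%:R)) < \sum_q wt q * D q w ^+ 2)%R @^-1` [set true].
    by apply/seteqP; split.
  apply: measurable_fun_ltr => //.
  apply: measurable_sum => q; apply: measurable_funM; first exact: measurable_cst.
  exact: measurable_funX.
have W0 : (0 <= W)%R by apply: sumr_ge0.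
(* The weights are normalized by W below. If W = 0 they all vanish and the strict inequality
   defining [Ev] fails. *)
have [W00|Wn0] := eqVneq W 0%R.
  rewrite (_ : Ev = set0) ?measure0 ?lee_fin ?divr_ge0 //.
  apply/seteqP; split => w //=; rewrite /Ev /= W00 mul0r big1 ?ltxx // => q _.
  have -> : wt q = 0%R.
    apply/eqP; move/eqP: W00; rewrite psumr_eq0 // => /allP /(_ q (mem_index_enum q)).
    by [].
  by rewrite mul0r.
have Wp : (0 < W)%R by rewrite lt_neqAle eq_sym Wn0.
have k12 : (12 <= k * eta ^+ 2)%R.
  by rewrite /k /dev_const divfK ?gt_eqF ?exprn_gt0 // lerDr mulr_ge0.
have k0 : (0 < k)%R.
  by rewrite /k /dev_const divr_gt0 ?exprn_gt0 // ltr_wpDl ?mulr_ge0.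
have ln0 : (0 < ln s%:R :> R)%R by rewrite ln_gt0 // ltr1n (leq_trans _ s4).
have lns : (ln s%:R <= s%:R :> R)%R.
  by apply: ltW; exact: ln_sublinear.
(* t is the threshold for the root of the normalized weighted sum, and l = s t / (2k) minimizes k
   l^2 / s - l t. Then l t = 6 ln s and k l^2 / s = 3 ln s, so Markov's inequality gives 2 e^2
   s^(-3) <= 2/s. *)
pose t := Num.sqrt (12 * k * (ln s%:R / s%:R)).
have t2 : (t ^+ 2 = 12 * k * (ln s%:R / s%:R))%R.
  rewrite sqr_sqrtr //; apply: mulr_ge0; first by rewrite mulr_ge0 // ltW.
  by rewrite divr_ge0 // ltW.
have t0 : (0 <= t)%R by exact: sqrtr_ge0.
pose l := (s%:R * t / (2 * k))%R.
have l0 : (0 <= l)%R.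
  have k20 : (0 < 2 * k)%R by rewrite mulr_gt0.
  by rewrite /l; apply: divr_ge0; [apply: mulr_ge0|exact: ltW].
have hl : (`|l / s%:R| <= eta / 2)%R.
  have ls0 : (0 <= l / s%:R)%R by apply: divr_ge0 => //; exact: ltW.
  rewrite (ger0_norm ls0).
  have -> : (l / s%:R = t / k / 2)%R by rewrite /l; field; rewrite !gt_eqF.
  rewrite ler_wpM2r // ler_pdivrMr //.
  have : (t ^+ 2 <= (eta * k) ^+ 2)%R.
    rewrite t2 exprMn; apply: le_trans (_ : 12 * k <= _)%R.
      by apply: ler_piMr; [rewrite mulr_ge0 // ltW|rewrite ler_pdivrMr // mul1r].
    have -> : (eta ^+ 2 * k ^+ 2 = k * eta ^+ 2 * k)%R by ring.
    by rewrite ler_wpM2r // ltW.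
  have ek0 : (0 <= eta * k)%R by rewrite mulr_ge0 // ltW.
  by rewrite ler_pXn2r // nnegrE.
have pEv : P Ev = (fine (P Ev))%:E by rewrite fineK // fin_num_measure.
pose B := expR (k * l ^+ 2 / s%:R).
pose H w := (\sum_q wt q / W * (expR 2 * (expR (l * D q w) + expR (- l * D q w))))%R.
have pt w : Ev w -> (expR (l * t) <= H w)%R.
  rewrite /Ev /= => hw.
  apply: le_trans (_ : \sum_q wt q / W * expR (Num.sqrt (4 + (l * D q w) ^+ 2)) <= _)%R; last first.
    apply: ler_sum => q _; rewrite ler_wpM2l ?divr_ge0 // mulNr.
    exact: expR_sqrt_le.
  have w1 : (\sum_q wt q / W = 1)%R by rewrite -mulr_suml divff.
  have wW q : (0 <= wt q / W)%R by rewrite divr_ge0.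
  apply: le_trans (expR_sqrt_jensen wW w1 (fun q => sqr_ge0 (l * D q w))).
  have -> : (l * t = Num.sqrt ((l * t) ^+ 2))%R by rewrite sqrtr_sqr ger0_norm // mulr_ge0.
  rewrite ler_expR ler_wsqrtr //.
  have -> : (\sum_q wt q / W * (l * D q w) ^+ 2 = l ^+ 2 * ((\sum_q wt q * D q w ^+ 2) / W))%R.
    rewrite mulr_suml mulr_sumr; apply: eq_bigr => q _.
    by rewrite exprMn; ring.
  rewrite exprMn; apply: le_trans (_ : l ^+ 2 * ((\sum_q wt q * D q w ^+ 2) / W) <= _)%R.
    by rewrite ler_wpM2l ?sqr_ge0 // ler_pdivlMr // t2 mulrC ltW.
  by rewrite lerDr.
have mexp (c : R) q : measurable_fun setT (fun w => expR (c * D q w)).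
  apply: measurableT_comp; first exact: measurable_expR.
  by apply: measurable_funM => //; exact: measurable_cst.
have mH2 q : measurable_fun setT (fun w => expR (l * D q w) + expR (- l * D q w))%R.
  exact: measurable_funD.
have mterm q : measurable_fun setT
    (fun w => wt q / W * (expR 2 * (expR (l * D q w) + expR (- l * D q w))))%R.
  by do 2!(apply: measurable_funM; first exact: measurable_cst).
have H20 q w : (0 <= expR (l * D q w) + expR (- l * D q w))%R by rewrite addr_ge0 ?expR_ge0.
have mH : measurable_fun setT H by apply: measurable_sum.
have H0 w : (0 <= H w)%R.
  by apply: sumr_ge0 => q _; rewrite !mulr_ge0 ?expR_ge0 ?invr_ge0.
have intH : \int[P]_w (H w)%:E <= (expR 2 * (B + B))%:E.
  rewrite /H; under eq_integral do rewrite -sumEFin.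
  rewrite ge0_integral_sum //; last 2 first.
  - by move=> q; exact/measurable_EFinP.
  - by move=> q w _; rewrite lee_fin !mulr_ge0 ?expR_ge0 ?invr_ge0.
  have -> : (expR 2 * (B + B) = \sum_q wt q / W * (expR 2 * (B + B)))%R.
    by rewrite -!mulr_suml divff // mul1r.
  rewrite -sumEFin; apply: lee_sum => q _.
  under eq_integral do rewrite mulrA EFinM.
  have c0 : (0 <= wt q / W * expR 2)%R by rewrite !mulr_ge0 ?invr_ge0 ?expR_ge0.
  rewrite ge0_integralZl_EFin //; last exact/measurable_EFinP.
  rewrite mulrA (EFinM _ (B + B)) lee_wpmul2l ?lee_fin //.
  under eq_integral do rewrite EFinD.
  rewrite ge0_integralD //; try exact/measurable_EFinP;
    try by move=> w _; rewrite lee_fin expR_ge0.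
  rewrite EFinD; apply: leeD.
    have h1 := average_mgf s0 GM ind (fun i => mZ i q) eta0 K0 (fun i => iZ i q)
      (fun i => Z0 i q) (fun i => hK i q) hl.
    exact h1.
  have := average_mgf (l := - l) s0 GM ind (fun i => mZ i q) eta0 K0 (fun i => iZ i q)
    (fun i => Z0 i q) (fun i => hK i q).
  by rewrite mulNr normrN sqrrN; apply.
have : (expR (l * t))%:E * P Ev <= (expR 2 * (B + B))%:E.
  apply: le_trans intH.
  rewrite -[X in P X]setTI setIC -integral_indic // -ge0_integralZl_EFin ?expR_ge0 //; last first.
    by apply/measurable_EFinP; exact: measurable_indic.
  apply: ge0_le_integral => //.
  - apply: emeasurable_funM; first exact: measurable_cst.
    by apply/measurable_EFinP; exact: measurable_indic.
  - exact/measurable_EFinP.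
  - move=> w _; rewrite -EFinM lee_fin indicE.
    have [|nEw] := boolP (w \in Ev); first by rewrite inE mulr1 => /pt.
    by rewrite mulr0.
rewrite pEv -EFinM !lee_fin => hP.
(* Needed for ln s >= 1, which is where s >= 4 is used; exp(1/2) <= 1/(1 - 1/2) = 2. *)
have e4 : (expR 1 <= 4 :> R)%R.
  have h := expR_ge1Dx (- 2^-1 : R)%R.
  have h2 : (expR 1 = expR 2^-1 ^+ 2 :> R)%R.
    by rewrite -expRM_natl divff ?pnatr_eq0.
  have h3 : (expR (- 2^-1) * expR 2^-1 = 1 :> R)%R by rewrite mulrC expRxMexpNx_1.
  have h4 : (expR 2^-1 <= 2 :> R)%R.
    have := expR_ge0 (2^-1 : R)%R; nra.
  rewrite h2; have := expR_ge0 (2^-1 : R)%R; nra.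
have ln1 : (1 <= ln s%:R :> R)%R.
  by rewrite -ler_expR lnK ?posrE //; apply: le_trans e4 _; rewrite ler_nat.
rewrite -(ler_pM2l (expR_gt0 (l * t))); apply: le_trans hP _.
have el : (l * t = 6 * ln s%:R)%R.
  by rewrite /l mulrAC -(mulrA s%:R) -expr2 t2; field; rewrite !gt_eqF.
have eB : (k * l ^+ 2 / s%:R = 3 * ln s%:R)%R.
  have -> : (l ^+ 2 = l * t * (s%:R / (2 * k)))%R by rewrite /l; field; rewrite !gt_eqF.
  by rewrite el; field; rewrite !gt_eqF.
rewrite /B eB el.
have -> : (expR (6 * ln s%:R) * (2 / s%:R) = 2 * expR (5 * ln s%:R) :> R)%R.
  have -> : (6 * ln s%:R = 5 * ln s%:R + ln s%:R :> R)%R by ring.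
  by rewrite expRD lnK ?posrE //; field; rewrite gt_eqF.
have -> : (expR 2 * (expR (3 * ln s%:R) + expR (3 * ln s%:R)) = 2 * expR (2 + 3 * ln s%:R) :> R)%R.
  by rewrite (expRD 2%R); ring.
by rewrite ler_wpM2l // ler_expR; lra.
Qed.

End Deviation.

(** * Empirical mean and second moments of the signals *)

Section SampleDeviation.
Context {R : realType} {d : measure_display} {Omega : measurableType d}.
Variable P : probability Omega R.
Local Open Scope ereal_scope.

Lemma integral_affine (f : Omega -> R) (m c b : R) :
  P.-integrable setT (EFin \o f) -> \int[P]_w (f w)%:E = m%:E ->
  P.-integrable setT (EFin \o (fun w => c * f w + b)%R) /\
  \int[P]_w (c * f w + b)%:E = (c * m + b)%:E.
Proof.
move=> fi fm.
have ic : P.-integrable setT (EFin \o (fun w => c * f w)%R).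
  have := integrableZl measurableT c fi.
  by apply: eq_integrable.
have ib : P.-integrable setT (fun=> b%:E) by exact: finite_measure_integrable_cst.
split.
  by have := integrableD measurableT ic ib; apply: eq_integrable.
transitivity (\int[P]_w ((EFin \o (fun w => c * f w)%R) w + b%:E)).
  by apply: eq_integral.
rewrite integralD // integral_prob_cst EFinD; congr (_ + _).
rewrite /comp; under eq_integral do rewrite EFinM.
by rewrite integralZl // fm -EFinM.
Qed.

Definition subg_rate (c0 : R) : R := (c0 / (4 * expR 1))%R.

Definition sample_const (c0 : R) : R :=
  (12 * dev_const (subg_rate c0) (2 * expR (subg_rate c0)))%R.

Lemma subg_rate_gt0 c0 : (0 < c0)%R -> (0 < subg_rate c0)%R.
Proof. by move=> c00; rewrite divr_gt0 // mulr_gt0 // expR_gt0. Qed.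

Lemma sample_const_ge0 c0 : (0 <= sample_const c0)%R.
Proof.
rewrite /sample_const /dev_const; apply: mulr_ge0 => //; apply: divr_ge0; last exact: sqr_ge0.
by apply: addr_ge0 => //; do 2!apply: mulr_ge0 => //; exact: expR_ge0.
Qed.

Variables (n s : nat) (G : 'I_s -> set (set Omega)).
Variables (y : forall i, 'I_n -> g_sigma_algebraType (G i) -> R) (S : 'I_n -> 'I_n -> R) (c0 : R).
Arguments y : clear implicits.
Hypotheses (c00 : (0 < c0)%R) (s4 : (4 <= s)%N) (GM : forall i, G i `<=` measurable).
Hypothesis ind : mutual_indep P predT (fun i => <<s G i >>).
Hypothesis my : forall i j, measurable_fun setT (y i j).
Hypothesis iy : forall i j, P.-integrable setT (EFin \o (y i j : Omega -> R)).
Hypothesis y0 : forall i j, \int[P]_w (y i j w)%:E = 0.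
Hypothesis iyy : forall i j l,
  P.-integrable setT (EFin \o (fun w : Omega => y i j w * y i l w)%R).
Hypothesis yS : forall i j l, \int[P]_w (y i j w * y i l w)%:E = (S j l)%:E.
Hypothesis yfin : forall i j, psi2norm P (y i j) < +oo.
Hypothesis ypsi : forall i j, c0%:E * psi2norm P (y i j) * psi2norm P (y i j) <= (S j j)%:E.
Hypothesis S0 : forall j, (0 <= S j j)%R.
Hypothesis y00 : forall j, S j j = 0%R -> forall i w, y i j w = 0%R.
Hypothesis SCS : forall j l, (`|S j l| <= Num.sqrt (S j j) * Num.sqrt (S l l))%R.

Let g := subg_rate c0.
Let sd j := Num.sqrt (S j j).
(** Entries scaled to unit variance. Where [S j j = 0] the quotient by 0 is 0, and [y00] keeps sd *
    a = y true there. *)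
Let a i j (w : g_sigma_algebraType (G i)) : R := (y i j w / sd j)%R.
Arguments a : clear implicits.

Let g0 : (0 < g)%R. Proof. exact: subg_rate_gt0. Qed.

Let sd0 j : (0 <= sd j)%R. Proof. exact: sqrtr_ge0. Qed.

Let sda i j w : (sd j * a i j w = y i j w)%R.
Proof.
rewrite /a; have [e|e] := eqVneq (sd j) 0%R; last by field.
rewrite e mul0r y00 //; apply/eqP; rewrite eq_le S0 andbT.
by move/eqP: e; rewrite sqrtr_eq0.
Qed.

Let mya i j : measurable_fun setT (a i j).
Proof. by apply: measurable_funM; [exact: my|exact: measurable_cst]. Qed.

Let myO i j : measurable_fun setT (y i j : Omega -> R).
Proof. exact: g_sigma_measurable_fun. Qed.

Let maO i j : measurable_fun setT (a i j : Omega -> R).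
Proof. exact: g_sigma_measurable_fun. Qed.

Let a_exp i j : \int[P]_w (expR (g * a i j w ^+ 2))%:E <= 2%:E.
Proof.
have [e|e] := eqVneq (S j j) 0%R.
  rewrite (eq_integral (fun=> 1%:E)) ?integral_prob_cst ?lee_fin ?ler1n // => w _.
  by rewrite /a y00 // mul0r expr0n mulr0 expR0.
have Sp : (0 < S j j)%R by rewrite lt_neqAle eq_sym e S0.
have := psi2_exp_moment (myO i j) c00 Sp (yfin i j) (ypsi i j).
apply: le_trans; rewrite le_eqVlt; apply/orP; left; apply/eqP.
apply: eq_integral => w _; congr (expR (_ * _))%:E.
by rewrite /a exprMn exprVn sqr_sqrtr.
Qed.

Let aexp_meas i j : measurable_fun setT (fun w : Omega => expR (g * a i j w ^+ 2)).
Proof.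
apply: measurableT_comp; first exact: measurable_expR.
by apply: measurable_funM; [exact: measurable_cst|exact: measurable_funX].
Qed.

Let norm_exp_meas (f : Omega -> R) : measurable_fun setT f ->
  measurable_fun setT (fun w => (expR (g * `|f w|))%:E).
Proof.
move=> mf; apply/measurable_EFinP; apply: measurableT_comp; first exact: measurable_expR.
apply: measurable_funM; first exact: measurable_cst.
by apply: measurableT_comp => //; exact: normr_measurable.
Qed.

Let K := (2 * expR g)%R.

Let K0 : (0 <= K)%R. Proof. by rewrite mulr_ge0 // expR_ge0. Qed.

(** Controls the sample mean that [sample_cov] subtracts. From |a| <= 1 + a^2 the normalized entries
    satisfy E exp(g |a|) <= 2 exp g = K, and the weights [S j j] undo the scaling. *)
Lemma sample_mean_dev :
  P [set w | ((\sum_j S j j) * (sample_const c0 * (ln s%:R / s%:R)) <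
              \sum_j (s%:R^-1 * \sum_i y i j w) ^+ 2)%R] <= (2 / s%:R)%:E.
Proof.
have az i j : P.-integrable setT (EFin \o (a i j : Omega -> R)) /\ \int[P]_w (a i j w)%:E = 0.
  have [h1 h2] := @integral_affine (y i j) 0 (sd j)^-1 0 (iy i j) (y0 i j).
  split; first by move: h1; apply: eq_integrable => // w _ /=; rewrite addr0 mulrC.
  transitivity (((sd j)^-1 * 0 + 0)%R%:E); last by rewrite mulr0 addr0.
  by rewrite -h2; apply: eq_integral => w _; rewrite addr0 mulrC.
have aK i j : \int[P]_w (expR (g * `|a i j w|))%:E <= K%:E.
  apply: le_trans (_ : \int[P]_w ((expR g)%:E * (expR (g * a i j w ^+ 2))%:E) <= _).
    apply: ge0_le_integral => //.
    - exact: norm_exp_meas.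
    - by apply: emeasurable_funM; [exact: measurable_cst|exact/measurable_EFinP].
    - move=> w _; rewrite -EFinM lee_fin -expRD ler_expR -{2}[g]mulr1 -mulrDr.
      rewrite ler_wpM2l ?(ltW g0) // -(real_normK (num_real (a i j w))).
      by have := sqr_ge0 (`|a i j w| - 2^-1); rewrite sqrrB; lra.
  rewrite ge0_integralZl_EFin ?expR_ge0 //; last exact/measurable_EFinP.
  by rewrite /K mulrC EFinM lee_wpmul2l // lee_fin expR_ge0.
have := deviation (Q := 'I_n) (Z := a) s4 GM ind mya g0 K0 (fun i j => proj1 (az i j))
  (fun i j => proj2 (az i j)) aK S0.
apply: le_trans; rewrite le_eqVlt; apply/orP; left; apply/eqP; congr (P _).
have e w : (\sum_j S j j * (s%:R^-1 * \sum_i a i j w) ^+ 2 =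
    \sum_j (s%:R^-1 * \sum_i y i j w) ^+ 2)%R.
  apply: eq_bigr => j _; rewrite -{1}(sqr_sqrtr (S0 j)) -exprMn mulrCA mulr_sumr.
  by congr ((_ * _) ^+ 2)%R; apply: eq_bigr => i _; rewrite -sda.
by apply/seteqP; split => w; rewrite /= e.
Qed.

(** The centered product Z = u v - rho has |rho| <= 1, so |Z| <= 1 + (u^2 + v^2)/2; the
    arithmetic-geometric mean inequality for the two exponentials gives the same K. The weights
    [S j j * S l l] sum to the square of the trace. *)
Lemma sample_cov_dev :
  P [set w | ((\sum_j S j j) ^+ 2 * (sample_const c0 * (ln s%:R / s%:R)) <
      \sum_(p : 'I_n * 'I_n) (s%:R^-1 * (\sum_i y i p.1 w * y i p.2 w) - S p.1 p.2) ^+ 2)%R]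
  <= (2 / s%:R)%:E.
Proof.
pose rho j l := (S j l / (sd j * sd l))%R.
pose Z i (p : 'I_n * 'I_n) (w : g_sigma_algebraType (G i)) : R :=
  (a i p.1 w * a i p.2 w - rho p.1 p.2)%R.
have aa i j l w : (a i j w * a i l w = (sd j * sd l)^-1 * (y i j w * y i l w))%R.
  by rewrite /a invfM; ring.
have mZ i p : measurable_fun setT (Z i p).
  by apply: measurable_funB; [exact: measurable_funM|exact: measurable_cst].
have mZO i p : measurable_fun setT (Z i p : Omega -> R) by exact: g_sigma_measurable_fun.
have Zz i p : P.-integrable setT (EFin \o (Z i p : Omega -> R)) /\ \int[P]_w (Z i p w)%:E = 0.
  have [h1 h2] := @integral_affine _ _ (sd p.1 * sd p.2)^-1 (- rho p.1 p.2) (iyy i p.1 p.2)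
    (yS i p.1 p.2).
  split; first by move: h1; apply: eq_integrable => // w _ /=; rewrite /Z aa.
  transitivity (((sd p.1 * sd p.2)^-1 * S p.1 p.2 - rho p.1 p.2)%R%:E); last first.
    by rewrite /rho [(_^-1 * S _ _)%R]mulrC subrr.
  by rewrite -h2; apply: eq_integral => w _; rewrite /Z aa.
have rho1 j l : (`|rho j l| <= 1)%R.
  rewrite normrM normfV (ger0_norm (mulr_ge0 (sd0 j) (sd0 l))).
  have [->|e] := eqVneq (sd j * sd l)%R 0%R; first by rewrite invr0 mulr0.
  rewrite ler_pdivrMr ?mul1r; first exact: SCS.
  by rewrite lt_neqAle eq_sym e mulr_ge0.
have ZK i p : \int[P]_w (expR (g * `|Z i p w|))%:E <= K%:E.
  apply: le_trans (_ : \int[P]_w ((expR g / 2)%:E *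
     ((expR (g * a i p.1 w ^+ 2))%:E + (expR (g * a i p.2 w ^+ 2))%:E)) <= _).
    apply: ge0_le_integral => //.
    - exact: norm_exp_meas.
    - apply: emeasurable_funM; first exact: measurable_cst.
      by apply: emeasurable_funD; exact/measurable_EFinP.
    - move=> w _; rewrite -EFinD -EFinM lee_fin.
      set u := a i p.1 w; set v := a i p.2 w.
      apply: le_trans (_ : expR (g + (g * u ^+ 2 / 2 + g * v ^+ 2 / 2)) <= _)%R.
        rewrite ler_expR.
        have h : (`|Z i p w| <= 1 + (u ^+ 2 / 2 + v ^+ 2 / 2))%R.
          apply: le_trans (ler_normB _ _) _; rewrite addrC; apply: lerD => //.
          rewrite -/u -/v normrM -(real_normK (num_real u)) -(real_normK (num_real v)).
          by have := sqr_ge0 (`|u| - `|v|); rewrite sqrrB; lra.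
        have -> : (g + (g * u ^+ 2 / 2 + g * v ^+ 2 / 2) = g * (1 + (u ^+ 2 / 2 + v ^+ 2 / 2)))%R.
          by ring.
        by rewrite ler_wpM2l // ltW.
      rewrite !expRD -[leRHS]mulrA ler_wpM2l ?expR_ge0 //.
      have eh (t : R) : (expR t = expR (t / 2) ^+ 2)%R.
        by rewrite -expRM_natl; congr expR; field.
      rewrite (eh (g * u ^+ 2)%R) (eh (g * v ^+ 2)%R).
      by have := sqr_ge0 (expR (g * u ^+ 2 / 2) - expR (g * v ^+ 2 / 2)); rewrite sqrrB; lra.
  have e20 : (0 <= expR g / 2)%R by rewrite divr_ge0 // expR_ge0.
  rewrite ge0_integralZl_EFin //; last 2 first.
  - by move=> w _; rewrite adde_ge0 // lee_fin expR_ge0.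
  - by apply: emeasurable_funD; exact/measurable_EFinP.
  rewrite ge0_integralD //; try exact/measurable_EFinP.
  rewrite (_ : K = expR g / 2 * (2 + 2))%R; last by rewrite /K; field.
  by rewrite (EFinM _ (2 + 2)) lee_wpmul2l ?lee_fin // EFinD leeD.
have := deviation (Q := ('I_n * 'I_n)%type) (Z := Z) (wt := fun p => S p.1 p.1 * S p.2 p.2)%R
  s4 GM ind mZ g0 K0 (fun i j => proj1 (Zz i j)) (fun i j => proj2 (Zz i j)) ZK
  (fun p => mulr_ge0 (S0 p.1) (S0 p.2)).
have s0 : (s%:R != 0 :> R)%R by rewrite pnatr_eq0 -lt0n (leq_trans _ s4).
have -> : (\sum_(p : 'I_n * 'I_n) S p.1 p.1 * S p.2 p.2 = (\sum_j S j j) ^+ 2)%R.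
  rewrite expr2 mulr_suml -(pair_bigA _ (fun i j => S i i * S j j)%R) /=.
  by apply: eq_bigr => i _; rewrite mulr_sumr.
have ep w p : (S p.1 p.1 * S p.2 p.2 * (s%:R^-1 * \sum_i Z i p w) ^+ 2 =
    (s%:R^-1 * (\sum_i y i p.1 w * y i p.2 w) - S p.1 p.2) ^+ 2)%R.
  rewrite -{1}(sqr_sqrtr (S0 p.1)) -{1}(sqr_sqrtr (S0 p.2)) -!exprMn -/(sd p.1) -/(sd p.2).
  congr (_ ^+ 2)%R; rewrite mulrCA mulr_sumr.
  rewrite (eq_bigr (fun i => y i p.1 w * y i p.2 w - S p.1 p.2)%R); last first.
    move=> i _; rewrite /Z mulrBr; congr (_ - _)%R.
      by rewrite -(@sda i p.1) -(@sda i p.2); ring.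
    rewrite /rho; have [e|e] := eqVneq (sd p.1 * sd p.2)%R 0%R; last by rewrite mulrC divfK.
    rewrite e mul0r; apply/esym/eqP; rewrite -normr_le0; apply: le_trans (SCS _ _) _.
    by rewrite -/(sd p.1) -/(sd p.2) e.
  by rewrite sumrB sumr_const card_ord -[(S _ _ *+ s)%R]mulr_natl mulrBr mulrA mulVf // mul1r.
apply: le_trans; rewrite le_eqVlt; apply/orP; left; apply/eqP; congr (P _).
have e w := eq_bigr _ (fun p _ => ep w p).
by apply/seteqP; split => w; rewrite /= e.
Qed.

End SampleDeviation.

(** * The sample covariance matrix *)

Section GeneratedSigma.
Context {R : realType} {d : measure_display} {Omega : measurableType d}.

(** The generators of [sigmaRV X], named so that the lemmas on [<<s G >>] apply to [sigmaRV X]. *)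
Definition rvgen (I : finType) (X : Omega -> I -> R) : set (set Omega) :=
  [set X @^-1` [set v | forall i, B i (v i)] |
    B in [set B : I -> set R | forall i, measurable (B i)]].

Lemma big_setIP (T : Type) (I : finType) (D : pred I) (F : I -> set T) w :
  (\big[setI/setT]_(i | D i) F i) w <-> (forall i, D i -> F i w).
Proof.
rewrite -bigcap_seq_cond; split => h i; last by case/andP => _; exact: h.
by move=> Di; apply: h; rewrite /= mem_index_enum.
Qed.

Lemma rvgen_sub (I : finType) (X : Omega -> I -> R) :
  (forall i, measurable_fun setT (fun w => X w i)) -> rvgen X `<=` measurable.
Proof.
move=> mX _ [B mB <-].
have -> : X @^-1` [set v | forall i, B i (v i)] =
    \big[setI/setT]_(i | xpredT i) ((fun w => X w i) @^-1` B i).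
  by apply/seteqP; split => w; rewrite big_setIP /= => h i; [move=> _|]; exact: h.
apply: big_ind => //; first exact: measurableI.
by move=> i _; rewrite -[X in measurable X]setTI; exact: mX.
Qed.

Lemma rvgen_coord (I : finType) (X : Omega -> I -> R) i :
  measurable_fun setT ((fun w => X w i) : g_sigma_algebraType (rvgen X) -> R).
Proof.
move=> _ B mB; rewrite setTI; apply: sub_sigma_algebra.
exists (fun j => if j == i then B else setT).
  by move=> j; case: ifP.
apply/seteqP; split => w /=; first by move=> /(_ i); rewrite eqxx.
by move=> Bi j; case: eqVneq => [->|].
Qed.

End GeneratedSigma.

Section SampleCovariance.
Context {R : realType}.

Lemma sqn_mul_trmx (n : nat) (m : 'cV[R]_n) : sqn (m *m m^T) = sqn m ^+ 2.
Proof.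
rewrite expr2 !sqnE mulr_suml; apply: eq_bigr => i _.
rewrite big_ord1 mulr_sumr; apply: eq_bigr => j _.
by rewrite mxE !big_ord1 mxE exprMn.
Qed.

(** The covariance is the empirical second moment minus m m^T, with m the sample mean. Both parts
    are bounded in Frobenius norm, which for m m^T is |m|^2. *)
Lemma sample_cov_opb (n s : nat) (x : 'I_s -> 'cV[R]_n) (S : 'M[R]_n) (W t2 : R) :
  (0 < s)%N -> 0 <= W -> 0 <= t2 ->
  \sum_(p : 'I_n * 'I_n) (s%:R^-1 * (\sum_i x i p.1 ord0 * x i p.2 ord0) - S p.1 p.2) ^+ 2
    <= W ^+ 2 * t2 ->
  \sum_j (s%:R^-1 * \sum_i x i j ord0) ^+ 2 <= W * t2 ->
  opb (sample_cov x - S) (W * Num.sqrt t2 + W * t2).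
Proof.
move=> s0 W0 t20 hc hm; have sn0 : s%:R != 0 :> R by rewrite pnatr_eq0 -lt0n.
set m := s%:R^-1 *: \sum_i x i.
have -> : sample_cov x - S = (s%:R^-1 *: (\sum_i x i *m (x i)^T) - S) + - (m *m m^T).
  rewrite /sample_cov -/m addrAC; congr (_ - _).
  have sm : \sum_i x i = s%:R *: m by rewrite scalerA divff // scale1r.
  clearbody m.
  have e i : (x i - m) *m (x i - m)^T = x i *m (x i)^T - x i *m m^T - m *m (x i)^T + m *m m^T.
    by rewrite linearB /= mulmxBl !mulmxBr opprB addrA addrAC.
  rewrite (eq_bigr _ (fun i _ => e i)) big_split !sumrB /= -mulmx_suml -mulmx_sumr.
  rewrite -[\sum_i (x i)^T]linear_sum sm linearZ /= -scalemxAl -scalemxAr sumr_const card_ord.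
  rewrite scaler_nat subrK scalerBr -(scaler_nat s (m *m m^T)) scalerA mulVf // scale1r.
  by [].
apply: opbD.
  apply: opbW (opb_sqn _).
  rewrite -[W * _]ger0_norm ?mulr_ge0 ?sqrtr_ge0 // -sqrtr_sqr ler_wsqrtr //.
  rewrite exprMn sqr_sqrtr //; apply: le_trans hc; rewrite sqnE pair_bigA /=.
  rewrite le_eqVlt; apply/orP; left; apply/eqP; apply: eq_bigr => p _.
  rewrite !mxE summxE; congr ((_ * _ - _) ^+ 2); apply: eq_bigr => i _.
  by rewrite mxE big_ord1 mxE; congr (_ * _).
apply: opbN; apply: opbW (opb_sqn _).
rewrite -[W * _]ger0_norm ?mulr_ge0 // -sqrtr_sqr ler_wsqrtr //.
rewrite sqn_mul_trmx.
rewrite lerXn2r ?nnegrE ?sqn_ge0 ?mulr_ge0 //.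
apply: le_trans hm; rewrite sqnE le_eqVlt; apply/orP; left; apply/eqP.
by apply: eq_bigr => j _; rewrite big_ord1 !mxE summxE.
Qed.

Context {d : measure_display} {Omega : measurableType d}.
Variable P : probability Omega R.

Lemma integral_lincomb (I : finType) (c m : I -> R) (f : I -> Omega -> R) :
  (forall i, P.-integrable setT (EFin \o f i)) ->
  (forall i, (\int[P]_w (f i w)%:E = (m i)%:E)%E) ->
  P.-integrable setT (EFin \o (fun w => \sum_i c i * f i w)) /\
  (\int[P]_w (\sum_i c i * f i w)%:E = (\sum_i c i * m i)%:E)%E.
Proof.
move=> fi fm.
have ci i : P.-integrable setT (fun w => (c i)%:E * (f i w)%:E)%E.
  exact: (integrableZl measurableT (c i) (fi i)).
split.
  have := integrable_sum measurableT (index_enum I) (P := xpredT) (fun i _ => ci i).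
  by apply: eq_integrable => // w _; rewrite /= -sumEFin.
transitivity (\int[P]_w (\sum_i (c i)%:E * (f i w)%:E))%E.
  by apply: eq_integral => w _; rewrite -sumEFin.
rewrite integral_sum // -sumEFin; apply: eq_bigr => i _.
by rewrite EFinM -fm -(integralZl measurableT (fi i)).
Qed.

(** [K] is deterministic, later a power of the normalized adjacency matrix of one graph. That F lies
    in the sigma-algebra of the signals is recorded for the use of independence from the graph; 4/s
    is the sum of the two deviation probabilities. *)
Lemma sample_cov_event (c0 : R) (n s : nat) (X0 : 'I_s -> Omega -> 'cV[R]_n) (K : 'M[R]_n) :
  0 < c0 -> (4 <= s)%N ->
  (forall i j, measurable_fun setT (fun w => X0 i w j ord0)) ->
  mutual_indep P predT (fun i => sigmaRV (fun w j => X0 i w j ord0)) ->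
  (forall i j, P.-integrable setT (fun w => (X0 i w j ord0)%:E) /\
               (\int[P]_w (X0 i w j ord0)%:E = 0)%E) ->
  (forall i j l, P.-integrable setT (fun w => (X0 i w j ord0 * X0 i w l ord0)%:E) /\
               (\int[P]_w (X0 i w j ord0 * X0 i w l ord0)%:E = (j == l)%:R%:E)%E) ->
  (forall i (u : 'cV[R]_n), subgaussian P (fun w => (u^T *m X0 i w) ord0 ord0)) ->
  (forall i (u : 'cV[R]_n),
     (c0%:E * psi2norm P (fun w => (u^T *m X0 i w) ord0 ord0)
            * psi2norm P (fun w => (u^T *m X0 i w) ord0 ord0)
      <= \int[P]_w (((u^T *m X0 i w) ord0 ord0) ^+ 2)%:E)%E) ->
  exists F : set Omega, [/\ measurable F,
    sigmaRV (fun w (p : 'I_s * 'I_n) => X0 p.1 w p.2 ord0) F,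
    (1 - 4 / s%:R)%:E <= P F &
    forall w, F w -> opb (sample_cov (fun i => K *m X0 i w) - K *m K^T)
       (\tr (K *m K^T) * (Num.sqrt (sample_const c0 * (ln s%:R / s%:R)) +
                          sample_const c0 * (ln s%:R / s%:R)))]%E.
Proof.
move=> c00 s4 mX ind iX iXX sg psi.
pose G (i : 'I_s) := rvgen (fun w j => X0 i w j ord0).
have GM i : G i `<=` measurable by apply: rvgen_sub => j; exact: mX.
pose GG := rvgen (fun w (p : 'I_s * 'I_n) => X0 p.1 w p.2 ord0).
have GGM : GG `<=` measurable by apply: rvgen_sub => p; exact: mX.
pose S j l := (K *m K^T) j l.
pose y i j (w : Omega) : R := (K *m X0 i w) j ord0.
have yE i j w : y i j w = \sum_l K j l * X0 i w l ord0 by rewrite /y mxE.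
have yu i j : (fun w => ((row j K)^T^T *m X0 i w) ord0 ord0) = y i j.
  by apply/funext => w; rewrite trmxK -row_mul mxE.
have SE j l : S j l = \sum_m K j m * K l m.
  by rewrite /S mxE; apply: eq_bigr => m _; rewrite mxE.
have my i j : measurable_fun setT (y i j : g_sigma_algebraType (G i) -> R).
  rewrite (_ : y i j = fun w => \sum_l K j l * X0 i w l ord0); last exact/funext.
  apply: measurable_sum => l; apply: measurable_funM; first exact: measurable_cst.
  exact: (rvgen_coord (X := fun w j => X0 i w j ord0) l).
have lin1 i j := integral_lincomb (K j) (f := fun l w => X0 i w l ord0) (m := fun=> 0)
  (fun l => proj1 (iX i l)) (fun l => proj2 (iX i l)).
have fy i j : y i j = fun w => \sum_l K j l * X0 i w l ord0 by exact/funext.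
have iy i j : P.-integrable setT (EFin \o y i j) by rewrite fy; exact: proj1 (lin1 i j).
have y0 i j : (\int[P]_w (y i j w)%:E = 0)%E.
  by rewrite fy (proj2 (lin1 i j)) big1 // => l _; rewrite mulr0.
have lin2 i j l := integral_lincomb (I := ('I_n * 'I_n)%type) (fun p => K j p.1 * K l p.2)
  (f := fun p w => X0 i w p.1 ord0 * X0 i w p.2 ord0) (m := fun p => (p.1 == p.2)%:R)
  (fun p => proj1 (iXX i p.1 p.2)) (fun p => proj2 (iXX i p.1 p.2)).
have fyy i j l : (fun w => y i j w * y i l w) = fun w =>
    \sum_(p : 'I_n * 'I_n) K j p.1 * K l p.2 * (X0 i w p.1 ord0 * X0 i w p.2 ord0).
  apply/funext => w; rewrite !yE mulr_suml.
  rewrite -(pair_bigA _ (fun a b => K j a * K l b * (X0 i w a ord0 * X0 i w b ord0))) /=.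
  by apply: eq_bigr => a _; rewrite mulr_sumr; apply: eq_bigr => b _; rewrite mulrACA.
have iyy i j l : P.-integrable setT (EFin \o (fun w => y i j w * y i l w)).
  by rewrite fyy; exact: proj1 (lin2 i j l).
have yS i j l : (\int[P]_w (y i j w * y i l w)%:E = (S j l)%:E)%E.
  transitivity (\sum_(p : 'I_n * 'I_n) K j p.1 * K l p.2 * (p.1 == p.2)%:R)%:E.
    rewrite -(proj2 (lin2 i j l)); apply: eq_integral => w _; congr EFin.
    exact: (congr1 (@^~ w) (fyy i j l)).
  congr EFin.
  rewrite SE -(pair_bigA _ (fun a b => K j a * K l b * (a == b)%:R)) /=.
  apply: eq_bigr => a _; rewrite (bigD1 a) //= eqxx mulr1 big1 ?addr0 // => b ba.
  by rewrite eq_sym (negPf ba) mulr0.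
have yfin i j : (psi2norm P (y i j) < +oo)%E.
  by have := sg i (row j K)^T; rewrite /subgaussian yu.
have ypsi i j : (c0%:E * psi2norm P (y i j) * psi2norm P (y i j) <= (S j j)%:E)%E.
  have := psi i (row j K)^T; rewrite yu => /le_trans; apply.
  rewrite -(yS i) le_eqVlt; apply/orP; left; apply/eqP; apply: eq_integral => w _.
  by have := congr1 (@^~ w) (yu i j) => /= ->; rewrite expr2.
have S0 j : 0 <= S j j by rewrite SE; apply: sumr_ge0 => m _; rewrite -expr2 sqr_ge0.
have y00 j : S j j = 0 -> forall i w, y i j w = 0.
  rewrite SE => /eqP; rewrite psumr_eq0; last by move=> m _; rewrite -expr2 sqr_ge0.
  move=> /allP h i w; rewrite yE big1 // => l _.
  have := h l (mem_index_enum l); rewrite /= -expr2 sqrf_eq0 => /eqP ->.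
  by rewrite mul0r.
have SCS j l : `|S j l| <= Num.sqrt (S j j) * Num.sqrt (S l l).
  have Sf j' l' : S j' l' = frob (row j' K) (row l' K).
    by rewrite SE frobE big_ord1; apply: eq_bigr => m _; rewrite !mxE.
  rewrite !Sf -/(sqn (row j K)) -/(sqn (row l K)).
  by apply: frob_le; rewrite ?sqrtr_ge0 ?sqr_sqrtr ?sqn_ge0.
have dm := sample_mean_dev (y := y) (S := S) c00 s4 GM ind my iy y0 yfin ypsi S0 y00.
have dc := sample_cov_dev (y := y) (S := S) c00 s4 GM ind my iyy yS yfin ypsi S0 y00 SCS.
set t2 := sample_const c0 * (ln s%:R / s%:R) in dm dc *.
set U1 := [set w | _] in dm; set U2 := [set w | _] in dc.
have mG (f : Omega -> R) : measurable_fun setT (f : g_sigma_algebraType GG -> R) ->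
    forall b, <<s GG >> [set w | b < f w].
  move=> mf b; rewrite (_ : [set w | b < f w] = setT `&` f @^-1` `]b, +oo[%classic).
    exact: mf.
  by rewrite setTI; apply/seteqP; split => w; rewrite /= in_itv /= andbT.
have myG i j : measurable_fun setT (y i j : g_sigma_algebraType GG -> R).
  rewrite fy; apply: measurable_sum => l; apply: measurable_funM; first exact: measurable_cst.
  exact: (rvgen_coord (X := fun w (p : 'I_s * 'I_n) => X0 p.1 w p.2 ord0) (i, l)).
have gU1 : <<s GG >> U1.
  apply: mG; apply: measurable_sum => j; apply: measurable_funX.
  by apply: measurable_funM; [exact: measurable_cst|apply: measurable_sum].
have gU2 : <<s GG >> U2.
  apply: mG; apply: measurable_sum => p; apply: measurable_funX.
  apply: measurable_funB; last exact: measurable_cst.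
  apply: measurable_funM; first exact: measurable_cst.
  by apply: measurable_sum => i; exact: measurable_funM.
have mU1 := g_sigma_sub GGM gU1; have mU2 := g_sigma_sub GGM gU2.
have gU : <<s GG >> (U1 `|` U2).
  exact: (@measurableU _ (g_sigma_algebraType GG) U1 U2 gU1 gU2).
have mU := g_sigma_sub GGM gU.
exists (~` (U1 `|` U2)); split.
- exact: measurableC.
- exact: sigma_algebraC gU.
- rewrite probability_setC //.
  have h : (P (U1 `|` U2) <= (4 / s%:R)%:E)%E.
    apply: le_trans (measureU2 _ mU1 mU2) _.
    rewrite (_ : 4 / s%:R = 2 / s%:R + 2 / s%:R); last by rewrite -mulrDl -natrD.
    by rewrite EFinD; apply: leeD.
  by rewrite EFinB; apply: leeB.
move=> w /= hw.
have {hw}[h1 h2] : ~ U1 w /\ ~ U2 w by split => h; apply: hw; [left|right].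
have s0 : (0 < s)%N by apply: leq_trans s4.
have trS : \tr (K *m K^T) = \sum_j S j j by [].
have W0 : 0 <= \sum_j S j j by apply: sumr_ge0.
have sc0 := sample_const_ge0 c0.
have t20 : 0 <= t2.
  rewrite /t2 mulr_ge0 // divr_ge0 // ln_ge0 // ler1n //.
have := @sample_cov_opb n s (fun i => K *m X0 i w) (K *m K^T) (\sum_j S j j) t2 s0 W0 t20.
rewrite -mulrDr trS; apply.
  by rewrite leNgt; apply/negP.
by rewrite leNgt; apply/negP.
Qed.

End SampleCovariance.

(** * The random graph *)

Section GraphLaw.
Context {R : realType} {d : measure_display} {Omega : measurableType d}.
Variable P : probability Omega R.
Context {n : nat} (A : Omega -> 'M[R]_n) (p : 'I_n -> 'I_n -> R).
Hypothesis Asym : forall w i j, A w i j = A w j i.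
Hypothesis mA : forall i j, measurable_fun setT (fun w => A w i j).
Hypothesis lawA : forall i j, P [set w | A w i j = 1] = (p i j)%:E /\
                              P [set w | A w i j = 0] = (1 - p i j)%:E.
Hypothesis indA : mutual_indep P [pred ij : 'I_n * 'I_n | (ij.1 <= ij.2)%N]
  (fun ij => sigmaRV (fun w (_ : 'I_1) => A w ij.1 ij.2)).
Implicit Types (a : {ffun 'I_n * 'I_n -> bool}).

Definition graph_event a : set Omega := [set w | A w = cfg_adj a].

(** [cfg_adj] reads only increasing pairs, so configurations that differ below the diagonal describe
    the same graph. Those that are false there give disjoint graph events, and all others have
    weight 0. *)
Definition upper_cfg a : bool := [forall e : 'I_n * 'I_n, a e ==> (e.1 <= e.2)%N].

Let edge_event a (e : 'I_n * 'I_n) : set Omega := [set w | A w e.1 e.2 = (a e)%:R].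

Let graph_eventE a : graph_event a =
  \big[setI/setT]_(e in [set e : 'I_n * 'I_n | (e.1 <= e.2)%N]%SET) edge_event a e.
Proof.
apply/seteqP; split => w; rewrite big_setIP /graph_event /edge_event /=.
  move=> -> e; rewrite inE => he; rewrite mxE; congr (a _)%:R.
  by rewrite /ordpair he; case: e {he}.
move=> h; apply/matrixP => i j; rewrite mxE.
have := h (ordpair i j); rewrite inE ordpair_le => /(_ isT) <-.
by rewrite /ordpair; case: ifP.
Qed.

Lemma graph_event_measurable a : measurable (graph_event a).
Proof.
rewrite graph_eventE; apply: big_ind => //; first exact: measurableI.
move=> e _; rewrite -[X in measurable X]setTI.
exact: (mA _ _ measurableT (measurable_set1 _)).
Qed.

Lemma graph_event_sigma a :
  sigmaRV (fun w (ij : 'I_n * 'I_n) => A w ij.1 ij.2) (graph_event a).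
Proof.
apply: sub_sigma_algebra; exists (fun ij => [set (a (ordpair ij.1 ij.2))%:R]).
  by move=> ij; exact: measurable_set1.
apply/seteqP; split => w; rewrite /graph_event /=.
  by move=> h; apply/matrixP => i j; rewrite mxE; exact: (h (i, j)).
by move=> -> [i j]; rewrite mxE.
Qed.

Lemma graph_event_prob a : upper_cfg a ->
  P (graph_event a) = (cfg_wt (edge_prob p) a)%:E.
Proof.
move=> /forallP ua; rewrite graph_eventE indA; last 2 first.
- by apply/fintype.subsetP => e; rewrite !inE.
- move=> e _; apply: sub_sigma_algebra; exists (fun=> [set (a e)%:R]).
    by move=> _; exact: measurable_set1.
  by apply/seteqP; split => w /= h; [exact: (h ord0)|move=> _].
have -> : cfg_wt (edge_prob p) a =
    \prod_(e : 'I_n * 'I_n | (e.1 <= e.2)%N) bern_wt (edge_prob p) e (a e).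
  rewrite /cfg_wt [RHS]big_mkcond; apply: eq_bigr => e _; case: ifPn => // he.
  rewrite /bern_wt /edge_prob (negPf he).
  by have := ua e; rewrite (negPf he) implybF => /negPf ->; rewrite subr0.
rewrite -prodEFin; apply: eq_big => e; first by rewrite inE.
rewrite inE => he; rewrite /edge_event /bern_wt /edge_prob he.
by have [h1 h0] := lawA e.1 e.2; case: (a e).
Qed.

Lemma cfg_wt_upper a : ~~ upper_cfg a -> cfg_wt (edge_prob p) a = 0.
Proof.
move=> /forallPn [e]; rewrite negb_imply => /andP[ae he].
by rewrite /cfg_wt (bigD1 e) //= ae /bern_wt /edge_prob (negPf he) mul0r.
Qed.

Lemma graph_event_inj a b w : upper_cfg a -> upper_cfg b ->
  graph_event a w -> graph_event b w -> a = b.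
Proof.
move=> /forallP ua /forallP ub; rewrite /graph_event /= => -> /matrixP h.
apply/ffunP => e; have [he|he] := boolP (e.1 <= e.2)%N; last first.
  have := ua e; have := ub e; rewrite (negPf he) !implybF.
  by move=> /negPf -> /negPf ->.
have := h e.1 e.2; rewrite !mxE /ordpair he -surjective_pairing => /eqP.
by rewrite eqr_nat; case: (a e); case: (b e).
Qed.

End GraphLaw.

Lemma big_setUP (T : Type) (I : eqType) (l : seq I) (F : I -> set T) w :
  (\big[setU/set0]_(i <- l) F i) w <-> exists2 i, i \in l & F i w.
Proof.
elim: l => [|i l IH]; first by rewrite big_nil; split => // -[].
rewrite big_cons; split => [[Fi|/IH [j jl Fj]]|[j]].
- by exists i; rewrite ?mem_head.
- by exists j; rewrite // inE jl orbT.
- by rewrite inE => /orP[/eqP ->|jl] Fj; [left|right; apply/IH; exists j].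
Qed.

Lemma measure_disjoint_union (R : realType) (d : measure_display) (Omega : measurableType d)
    (P : probability Omega R) (I : eqType) (l : seq I) (F : I -> set Omega) :
  uniq l -> (forall i, measurable (F i)) ->
  (forall i j w, i \in l -> j \in l -> F i w -> F j w -> i = j) ->
  P (\big[setU/set0]_(i <- l) F i) = (\sum_(i <- l) P (F i))%E.
Proof.
move=> + mF; elim: l => [|i l IH] /=; first by rewrite !big_nil measure0.
move=> /andP[il ul] dF; rewrite !big_cons measureU //.
- by congr (_ + _)%E; apply: IH => // j k w jl kl; apply: dF; rewrite inE ?jl ?kl orbT.
- by apply: big_ind => //; exact: measurableU.
- apply/seteqP; split => // w [Fi Fb].
  have [j jl Fj] := iffLR (big_setUP l F w) Fb.
  have ij : i = j by apply: (dF i j w) => //; rewrite inE ?eqxx ?jl ?orbT.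
  by move: il; rewrite ij jl.
Qed.

Lemma iter_mulmx (R : realType) (n T : nat) (L : 'M[R]_n) (x : 'cV[R]_n) :
  iter T (mulmx L) x = L ^+ T *m x.
Proof.
elim: T => [|T IH]; first by rewrite expr0 mul1mx.
by rewrite iterS IH exprS mulmxA.
Qed.

Lemma exp_adjE (R : realType) (n k : nat) (g : 'I_n -> 'I_k) (Om : 'M[R]_k) i j :
  exp_adj g Om i j = Om (g i) (g j).
Proof.
have gi l : (memb_mx g *m Om) i l = Om (g i) l.
  rewrite mxE (bigD1 (g i)) //= mxE eqxx mul1r big1 ?addr0 // => m.
  by rewrite mxE eq_sym => /negPf ->; rewrite mul0r.
rewrite /exp_adj mxE (bigD1 (g j)) //= gi !mxE eqxx mulr1 big1 ?addr0 // => m.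
by rewrite !mxE eq_sym => /negPf ->; rewrite mulr0.
Qed.

Lemma deg_min_le (R : realType) (n : nat) (A : 'M[R]_n) i : deg_min A <= degs A i.
Proof.
apply: ge_inf; last by exists i.
exists (- \sum_j `|degs A j|) => _ [j _ <-].
rewrite lerNl; apply: le_trans (ler_norm _) _; rewrite normrN.
by rewrite (bigD1 j) //= lerDl sumr_ge0.
Qed.

(** * Assembly of the bound *)

Section SampleBound.
Context {R : realType} {n : nat}.

Lemma specnorm_sample_le (s T k : nat) (L B : 'M[R]_n) (mu : 'I_n -> R) (x : 'I_s -> 'cV[R]_n)
    (M C c rt : R) :
  (1 <= T)%N -> (1 <= k <= n)%N -> L^T = L -> B^T = B -> opb L 1 -> opb B 1 -> opb (L - B) M ->
  (\rank B <= k)%N -> char_poly B = \prod_(i < n) ('X - (mu i)%:P) ->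
  (forall i j : 'I_n, (i <= j)%N -> `|mu j| <= `|mu i|) ->
  0 <= rt -> 0 <= c -> c <= C * rt ->
  opb (sample_cov (fun i => L ^+ T *m x i) - L ^+ T *m (L ^+ T)^T)
      (\tr (L ^+ T *m (L ^+ T)^T) * c) ->
  specnorm (sample_cov (fun i => iter T (mulmx L) (x i)) - B ^+ (2 * T)) <=
    2 * T%:R * M + C * (1 + \sum_(i < n | (1 <= i < k)%N) (Num.min 1 (`|mu i| + M)) ^+ (2 * T)
                    + (n - k)%:R * M ^+ (2 * T)) * rt.
Proof.
move=> T1 kn sL sB oL oB oLB rB eB smu rt0 c0 cC hx.
have eL : L ^+ T *m (L ^+ T)^T = L ^+ (2 * T).
  by rewrite trmx_exp sL -[_ *m _]/(_ * _) -exprD addnn mul2n.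
rewrite eL in hx; apply: specnorm_le.
have -> : sample_cov (fun i => iter T (mulmx L) (x i)) - B ^+ (2 * T) =
   (L ^+ (2 * T) - B ^+ (2 * T)) + (sample_cov (fun i => L ^+ T *m x i) - L ^+ (2 * T)).
  rewrite [RHS]addrC addrA subrK; congr (sample_cov _ - _).
  by apply/funext => i; exact: iter_mulmx.
apply: opbD.
  have [m em] : exists m, (2 * T = m.+1)%N by exists (2 * T).-1; rewrite prednK // muln_gt0.
  rewrite em; have := opb_expB m oL oB oLB.
  by rewrite expr1n mulr1 -em natrM.
apply: opbW hx.
have tr0 : 0 <= \tr (L ^+ (2 * T)) by rewrite -eL tr_sqr_ge0.
apply: le_trans (_ : \tr (L ^+ (2 * T)) * (C * rt) <= _); first by rewrite ler_wpM2l.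
have C0 : 0 <= C * rt by exact: le_trans cC.
rewrite [leRHS]mulrAC [leRHS]mulrC ler_wpM2r //.
exact: (trace_pow_bound T kn sL sB oL oLB rB eB smu).
Qed.

End SampleBound.

Theorem theorem4p1 (R : realType) (c0 : R) : 0 < c0 ->
  exists C : R, 0 < C /\
  forall (eps : R) (n k s T : nat)
    (d : measure_display) (Omega : measurableType d) (P : probability Omega R)
    (g : 'I_n -> 'I_k) (Om : 'M[R]_k)
    (A : Omega -> 'M[R]_n) (X0 : 'I_s -> Omega -> 'cV[R]_n) (mu : 'I_n -> R),
    0 < eps -> (1 <= k <= n)%N -> (2 <= s)%N -> (1 <= T)%N ->
    (* stochastic block model M(calA) *)
    (forall j : 'I_k, exists i : 'I_n, g i = j) ->
    Om^T = Om -> (forall a b, 0 <= Om a b <= 1) ->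
    (forall w i j, A w i j = A w j i) ->
    (forall i j, measurable_fun setT (fun w => A w i j)) ->
    (forall i j, P [set w | A w i j = 1] = (Om (g i) (g j))%:E /\
                 P [set w | A w i j = 0] = (1 - Om (g i) (g j))%:E) ->
    mutual_indep P [pred ij : 'I_n * 'I_n | (ij.1 <= ij.2)%N]
      (fun ij => sigmaRV (fun w (_ : 'I_1) => A w ij.1 ij.2)) ->
    \rank (exp_adj g Om) = k ->
    27 * ln (4 * n%:R / eps) < deg_min (exp_adj g Om) ->
    (* the initial signals *)
    (forall i j, measurable_fun setT (fun w => X0 i w j ord0)) ->
    mutual_indep P predT (fun i => sigmaRV (fun w j => X0 i w j ord0)) ->
    (forall i i', ident_distr P (fun w j => X0 i w j ord0) (fun w j => X0 i' w j ord0)) ->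
    indep2 P (sigmaRV (fun w (ij : 'I_n * 'I_n) => A w ij.1 ij.2))
             (sigmaRV (fun w (p : 'I_s * 'I_n) => X0 p.1 w p.2 ord0)) ->
    (forall i j, P.-integrable setT (fun w => (X0 i w j ord0)%:E) /\
                 (\int[P]_w (X0 i w j ord0)%:E = 0)%E) ->
    (forall i j l, P.-integrable setT (fun w => (X0 i w j ord0 * X0 i w l ord0)%:E) /\
                 (\int[P]_w (X0 i w j ord0 * X0 i w l ord0)%:E = (j == l)%:R%:E)%E) ->
    (forall i (u : 'cV[R]_n), subgaussian P (fun w => (u^T *m X0 i w) ord0 ord0)) ->
    (forall i (u : 'cV[R]_n),
       (c0%:E * psi2norm P (fun w => (u^T *m X0 i w) ord0 ord0)
              * psi2norm P (fun w => (u^T *m X0 i w) ord0 ord0)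
        <= \int[P]_w (((u^T *m X0 i w) ord0 ord0) ^+ 2)%:E)%E) ->
    (* eigenvalues of calL, ordered by decreasing modulus *)
    char_poly (norm_lap (exp_adj g Om)) = \prod_(i < n) ('X - (mu i)%:P) ->
    (forall i j : 'I_n, (i <= j)%N -> `|mu j| <= `|mu i|) ->
    let calL := norm_lap (exp_adj g Om) in
    let M := 3 * Num.sqrt (3 * ln (4 * n%:R / eps) / deg_min (exp_adj g Om)) in
    let B := C * (1 + \sum_(i < n | (1 <= i < k)%N) (Num.min 1 (`|mu i| + M)) ^+ (2 * T)
                    + (n - k)%:R * M ^+ (2 * T))
               * Num.sqrt (ln s%:R / s%:R) in
    exists E : set Omega, measurable E /\
      E `<=` [set w | specnorm (sample_cov (fun i => iter T (mulmx (norm_lap (A w))) (X0 i w))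
                                - calL ^+ (2 * T)) <= 2 * T%:R * M + B] /\
      ((1 - 5 / s%:R - 2 * eps)%:E <= P E)%E.
Proof.
move=> c00; set sc := sample_const c0.
have sc0 : 0 <= sc := sample_const_ge0 c0.
(* With x = ln s / s <= 1, the deviation sqrt(sc x) + sc x is at most (sqrt sc + sc) sqrt x; the 1
   ensures positivity. The constant depends on c0 alone. *)
exists (Num.sqrt sc + sc + 1); split.
  by rewrite ltr_wpDl // addr_ge0 // sqrtr_ge0.
move=> eps n k s T d Omega P g Om A X0 mu eps0 kn s2 T1 _ sOm Om01 Asym mA lawA indA rk hdm
  mX indX _ indAX iX iXX sg psi echar smu.
set dl := deg_min (exp_adj g Om) in hdm *.
set L := ln (4 * n%:R / eps) in hdm *.
move=> calL M B.
have s0 : 0 < s%:R :> R by rewrite ltr0n (leq_trans _ s2).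
(* Here 1 - 5/s - 2 eps <= 0 and the empty event will do. Afterwards eps < 1/2 makes L positive, and
   s >= 6 covers the demand s >= 4. *)
have [triv|nontriv] := boolP ((s < 6)%N || (2^-1 <= eps)).
  exists set0; split; first exact: measurable0.
  split; first exact: sub0set.
  rewrite measure0 lee_fin; case/orP: triv => [s6|e2].
    have : 1 <= 5 / s%:R :> R by rewrite ler_pdivlMr // mul1r ler_nat -ltnS.
    lra.
  have : 0 <= 5 / s%:R :> R by rewrite divr_ge0 // ltW.
  lra.
move: nontriv; rewrite negb_or -leqNgt -ltNge => /andP[s6 e2].
have s4 : (4 <= s)%N by apply: leq_trans s6.
have /andP[k1 kn'] := kn.
have n0 : (0 < n)%N by apply: leq_trans kn'.
have np : 1 <= n%:R :> R by rewrite ler1n.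
pose p i j := Om (g i) (g j).
have calA : exp_adj g Om = \matrix_(i, j) p i j.
  by apply/matrixP => i j; rewrite exp_adjE mxE.
have L0 : 0 < L.
  rewrite /L ln_gt0 // ltr_pdivlMr // mul1r; lra.
have dl0 : 0 < dl by apply: le_lt_trans hdm; rewrite mulr_ge0 // ltW.
have hdl i : dl <= \sum_j p i j.
  apply: le_trans (deg_min_le _ i) _; rewrite /degs le_eqVlt; apply/orP; left; apply/eqP.
  by apply: eq_bigr => j _; rewrite exp_adjE.
have psym i j : p i j = p j i by rewrite /p -{1}sOm mxE.
have p01 i j : 0 <= p i j <= 1 by exact: Om01.
have bad := good_cfg_prob psym p01 dl0 hdl L0 hdm.
pose good (a : {ffun 'I_n * 'I_n -> bool}) := upper_cfg a && `[< good_cfg p dl L a >].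
pose K (a : {ffun 'I_n * 'I_n -> bool}) := norm_lap (cfg_adj a : 'M[R]_n) ^+ T.
have /choice[F hF] := fun a => sample_cov_event (K a) c00 s4 mX indX iX iXX sg psi.
pose l := [seq a <- index_enum {ffun 'I_n * 'I_n -> bool} | good a].
pose H a := graph_event A a `&` F a.
have mH a : measurable (H a).
  by apply: measurableI; [exact: (graph_event_measurable Asym mA)|case: (hF a)].
exists (\big[setU/set0]_(a <- l) H a); split.
  by apply: big_ind => //; exact: measurableU.
split.
  move=> w /big_setUP [a]; rewrite mem_filter => /andP[/andP[ua /asboolP ga] _] [Aw Fw].
  have [oL oLB] := good_cfg_lap dl0 hdl L0 hdm ga.
  rewrite -calA in oLB.
  have sB : (exp_adj g Om)^T = exp_adj g Om.
    by apply/matrixP => i j; rewrite mxE !exp_adjE; exact: psym.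
  have sA : (cfg_adj a : 'M[R]_n)^T = cfg_adj a.
    by apply/matrixP => i j; rewrite !mxE ordpairC.
  have oB : opb calL 1.
    by apply: norm_lap_opb => // i j; rewrite exp_adjE; case/andP: (p01 i j).
  have rB : (\rank calL <= k)%N.
    rewrite -rk /calL /norm_lap.
    by apply: leq_trans (mxrankM_maxl _ _) (mxrankM_maxr _ _).
  set x := ln s%:R / s%:R : R.
  have x0 : 0 <= x by rewrite divr_ge0 ?ln_ge0 ?ler1n ?(leq_trans _ s2) // ltW.
  have x1 : x <= 1 by rewrite ler_pdivrMr // mul1r ltW // ln_sublinear.
  have xx : x <= Num.sqrt x.
    rewrite -{1}(sqr_sqrtr x0) expr2 ler_piMr ?sqrtr_ge0 // -sqrtr1 ler_wsqrtr //.
  have cx : Num.sqrt (sc * x) + sc * x <= (Num.sqrt sc + sc + 1) * Num.sqrt x.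
    rewrite sqrtrM // !mulrDl mul1r; have := sqrtr_ge0 x.
    have : sc * x <= sc * Num.sqrt x by rewrite ler_wpM2l.
    lra.
  have c_ge0 : 0 <= Num.sqrt (sc * x) + sc * x by rewrite addr_ge0 ?sqrtr_ge0 // mulr_ge0.
  have [_ _ _ hw] := hF a.
  have Lw : norm_lap (A w) = norm_lap (cfg_adj a) by rewrite (Aw : A w = cfg_adj a).
  rewrite /= Lw.
  exact: (specnorm_sample_le T1 kn (norm_lap_sym sA) (norm_lap_sym sB) oL oB oLB rB echar
    smu (sqrtr_ge0 x) c_ge0 cx (hw w Fw)).
have ul : uniq l by rewrite filter_uniq // index_enum_uniq.
rewrite measure_disjoint_union //; last first.
  move=> a b w; rewrite !mem_filter => /andP[/andP[ua _] _] /andP[/andP[ub _] _] [Aa _] [Ab _].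
  exact: (graph_event_inj ua ub Aa Ab).
rewrite big_filter.
have PH a : good a -> ((cfg_wt (edge_prob p) a * (1 - 4 / s%:R))%:E <= P (H a))%E.
  move=> /andP[ua _]; have [mF gF PF _] := hF a.
  rewrite /H (indAX _ _ (graph_event_sigma (A := A) a) gF) (graph_event_prob Asym lawA indA ua) EFinM.
  by apply: lee_wpmul2l => //; rewrite lee_fin cfg_wt_ge0 // => e; exact: edge_prob01.
apply: le_trans (lee_sum _ PH); rewrite sumEFin lee_fin -mulr_suml.
set W := \sum_(a | good a) _.
have hW : 1 - 3 / 2 * eps <= W.
  have := sum_cfg_wt (edge_prob p).
  rewrite (bigID (fun a => `[< good_cfg p dl L a >])) /= => e1.
  have -> : W = \sum_(a | `[< good_cfg p dl L a >]) cfg_wt (edge_prob p) a.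
    rewrite /W big_mkcond [RHS]big_mkcond; apply: eq_bigr => a _; rewrite /good.
    have [_|ua] /= := boolP (upper_cfg a); first by [].
    by rewrite cfg_wt_upper // if_same.
  have eb : 6 * n%:R * expR (- L) = 3 / 2 * eps.
    rewrite expRN lnK ?posrE ?divr_gt0 ?mulr_gt0 ?ltr0n //.
    by field; rewrite !gt_eqF ?ltr0n.
  by move: bad; rewrite eb; lra.
have W0 : 0 <= W by apply: sumr_ge0 => a _; rewrite cfg_wt_ge0 // => e; exact: edge_prob01.
have s1 : 0 <= 4 / s%:R :> R by rewrite divr_ge0 // ltW.
have s5 : 4 / s%:R <= 5 / s%:R :> R by rewrite ler_wpM2r ?invr_ge0 ?(ltW s0) // ler_nat.
have s41 : 0 <= 1 - 4 / s%:R :> R by rewrite subr_ge0 ler_pdivrMr // mul1r ler_nat.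
(* Expanding, the cross term (3/2) eps * (4/s) is nonnegative, so the product is at least 1 - 4/s -
   (3/2) eps, within the allowed 5/s and 2 eps. *)
have : (1 - 3 / 2 * eps) * (1 - 4 / s%:R) <= W * (1 - 4 / s%:R) by rewrite ler_wpM2r.
have : 0 <= eps * (4 / s%:R) by rewrite mulr_ge0 // ltW.
lra.
Qed.
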